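(* Define $\tilde V(\cdot;0)=\tilde V_0(\cdot)$ and $F(0)=G(0)=\frac{1}{2\delta}$. Let $\tilde Q:\mathbb{R}\times[0,c_0)\to[0,\infty)$ be the even (in $x$) extension of $\tilde V$, i.e. $\tilde Q(x,c)=\tilde V(|x|;c)$, and let $f=F$, $g=G$ on $[0,c_0)$. Then $c_0>0$ and the following conditions hold. (i) $f,g:[0,c_0)\to(0,\infty)$ are continuous, $f,g\in C^1((0,c_0))$, $f'(c)\le 0$ and $g'(c)>0$ for $c\in(0,c_0)$, $f(0)\le g(0)$, and $f(c)<g(c)$ for all $c\in(0,c_0)$. (ii) $\tilde Q$ is evenly symmetric in $x$, continuous and continuously differentiable, as well as twice continuously differentiable in its first argument with locally bounded second derivatives away from $\{(x,c):|x|\in\{f(c),g(c),f_0+c\}\}$. (iii) There is a continuous and increasing function $K:[0,\infty)\to(0,\infty)$ such that $|\tilde Q_x(x,c)|\le K(c)(1+|x|)$ for all $x\ge0$, $c\in[0,c_0)$. (iv) $\tilde Q(x,c)\le\delta x^2$ for all $x\ge 0$, $c\in[0,c_0)$. (v) $\tilde Q_x(x,c)+\tilde Q_c(x,c)\le 1$ for all $x\ge0$, $c\in(0,c_0)$. (vi) $\alpha\tilde Q(x,c)\le\frac12\tilde Q_{xx}(x,c)+\lambda x^2$ for all $c\in[0,c_0)$ and $x\in[0,\infty)\setminus\{f(c),g(c),f_0+c\}$. (vii) For all $c\in(0,c_0)$ and $x\in[0,\infty)\setminus\{f(c),g(c),f_0+c\}$, $$\left[\delta x^2-\tilde Q(x,c)\right]\cdot\left[1-\tilde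 Q_x(x,c)-\tilde Q_c(x,c)\right]\cdot\left[\tfrac12\tilde Q_{xx}(x,c)+\lambda x^2-\alpha\tilde Q(x,c)\right]=0.$$
   Context: Fix $\alpha>0$, $\delta>0$ and $0<\lambda<\alpha\delta$. Let $\rho(x)=x^2+\frac{2x}{\sqrt{2\alpha}}-\frac{\lambda/\alpha}{\alpha\delta-\lambda}$ and let $f_0=\frac{1}{\sqrt{2\alpha}}\left(\sqrt{\frac{\alpha\delta+\lambda}{\alpha\delta-\lambda}}-1\right)>0$ be its unique positive root. Standing assumption: $f_0>\frac{\alpha}{2\lambda}$ (equivalently $\lambda\in(\lambda^\dagger,\alpha\delta)$, where $\lambda^\dagger$ is the unique value of $\lambda$ at which $f_0=\frac{\alpha}{2\lambda}$), so that $\frac{1}{2\delta}<\frac{\alpha}{2\lambda}<f_0$. Let $B_0=-\frac{2f_0}{\alpha\sqrt{2\alpha}}(\alpha\delta-\lambda)e^{f_0\sqrt{2\alpha}}$ and $\Psi(x)=e^{2\sqrt{2\alpha}\,x}$. Subscripts $x$, $c$ on functions of $(x,c)$ denote partial derivatives. For $x\ge 0$, $c>0$ put $h_l(x)=\left(\delta-\frac{\lambda}{\alpha}\right)x^2-\frac{\lambda}{\alpha^2}$, $h_{r1}(x;c)=\delta c(c-2x)+\left(\delta-\frac{\lambda}{\alpha}\right)x^2+c-\frac{\lambda}{\alpha^2}$, $h_{r2}(x;c)=\frac{\lambda}{\alpha}c(c-2x)+c+B_0e^{-(x-c)\sqrt{2\alpha}}$, $h_r(x;c)=h_{r1}(x;c)$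 for $x\in[0,f_0+c]$, $h_r(x;c)=h_{r2}(x;c)$ for $x\ge f_0+c$, and $h=\min\{h_l,h_r\}$. For $y\ge1$ and $x=\Psi^{-1}(y)$ let $H_l(y)=e^{\sqrt{2\alpha}\,x}h_l(x)$, $H_r(y;c)=e^{\sqrt{2\alpha}\,x}h_r(x;c)$, $H(y;c)=e^{\sqrt{2\alpha}\,x}h(x;c)$. Put $y_c=\Psi\left(\frac1{2\delta}+\frac c2\right)$ and let $y_v(c)\in[y_c,\Psi(f_0+c))$ be the unique point such that $H_r(\cdot;c)$ is strictly convex on $(y_v(c),\infty)$ and strictly concave on $(y_c,y_v(c))$ (if $y_v(c)>y_c$). Let $c_1>0$ be a fixed constant (one exists) such that for every $c\in(0,c_1)$ there is a unique couple $(\hat y_1(c),\hat y_2(c))$ with $1<\hat y_1(c)<y_c\le y_v(c)<\hat y_2(c)$ solving $\frac{\partial H_l}{\partial y}(y_1)=\frac{\partial H_r}{\partial y}(y_2;c)$ and $H_l(y_1)-\frac{\partial H_l}{\partial y}(y_1)y_1=H_r(y_2;c)-\frac{\partial H_r}{\partial y}(y_2;c)y_2$; moreover $\hat y_1(c)<\Psi(f_0)$, and, with $A(c)=\frac{\partial H_l}{\partial y}(\hat y_1(c))$ and $B(c)=H_l(\hat y_1(c))-A(c)\hat y_1(c)$, the function equal to $H_l$ on $[1,\hat y_1(c)]$, to $A(c)y+B(c)$ on $(\hat y_1(c),\hat y_2(c))$ and to $H_r(\cdot;c)$ on $[\hat y_2(c),\infty)$ is the greatest nonpositive convex minorant of $H(\cdot;c)$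 on $[1,\infty)$, and $A(c)y+B(c)\le H(y;c)$ for $y>1$. Set $F(c)=\Psi^{-1}(\hat y_1(c))$, $G(c)=\Psi^{-1}(\hat y_2(c))$ for $c\in(0,c_1)$. Let $\tilde V_0$ be the even function with $\tilde V_0(x)=\delta x^2$ for $0\le x\le f_0$ and $\tilde V_0(x)=\frac{\lambda}{\alpha^2}+\frac{\lambda}{\alpha}x^2+B_0e^{-x\sqrt{2\alpha}}$ for $x>f_0$ (it is the value function of the problem $\inf_\tau\mathsf E[\int_0^\tau e^{-\alpha t}\lambda X_t^2dt+e^{-\alpha\tau}\delta X_\tau^2]$ over stopping times, for $X$ a Brownian motion started at $x$). For $c\in(0,c_1)$ and $x\ge0$ let $\tilde V(x;c)=\delta x^2$ if $0\le x\le F(c)$; $\tilde V(x;c)=\frac{\lambda}{\alpha}x^2+\frac{\lambda}{\alpha^2}+A(c)e^{x\sqrt{2\alpha}}+B(c)e^{-x\sqrt{2\alpha}}$ if $F(c)<x<G(c)$; $\tilde V(x;c)=\tilde V_0(x-c)+c$ if $x\ge G(c)$ (for such $c$ and $x\ge 0$ this is the value function $\inf_\tau\mathsf E[\int_0^\tau e^{-\alpha t}\lambda X_t^2dt+e^{-\alpha\tau}\min(c+\tilde V_0(X_\tau-c),\delta X_\tau^2)]$). Define $h_1(x)=\frac{\alpha\delta-\lambda}{2\alpha}e^{-x\sqrt{2\alpha}}\rho(x)$ and $h_2(x)=\frac{\alpha\delta-\lambda}{2\alpha}e^{x\sqrt{2\alpha}}\left(\rho(x)-\frac{4x}{\sqrt{2\alpha}}\right)$.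 The function $h_1$ is strictly increasing from $[0,f_0]$ onto $[-\frac{\lambda}{2\alpha^2},0]$, and $h_1^{-1}:[-\frac{\lambda}{2\alpha^2},0]\to[0,f_0]$ denotes the inverse. Define $\tilde{\mathcal H}_3(x,c)=\frac{e^{-x\sqrt{2\alpha}}}{2\sqrt{2\alpha}}\left(\frac{\partial h_{r1}}{\partial x}(x;c)+\sqrt{2\alpha}\,h_{r1}(x;c)\right)$, $\tilde{\mathcal H}_4(x,c)=\frac{e^{x\sqrt{2\alpha}}}{2\sqrt{2\alpha}}\left(-\frac{\partial h_{r1}}{\partial x}(x;c)+\sqrt{2\alpha}\,h_{r1}(x;c)\right)$, $L(x,c)=\tilde{\mathcal H}_4(x,c)-h_2\left(h_1^{-1}(\tilde{\mathcal H}_3(x,c))\right)$ (well defined at $x=f_0+c$ for all $c\in(0,c_1)$), $c_2=\min\{c_1,\inf\{c\in(0,c_1):L(f_0+c,c)\ge0\}\}>0$, and, since $F,G\in C^1(0,c_2)$, $c_0=\min\{c_2,\inf\{c\in(0,c_2):G'(c)\le1\}\}$ (with $\inf\emptyset=+\infty$). *)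

(* Defs.v *)
From Stdlib Require Import Reals.
From Coquelicot Require Export Coquelicot.
Open Scope R_scope.

Definition convex_on (D : R -> Prop) (u : R -> R) : Prop :=
  forall x y t, D x -> D y -> 0 <= t <= 1 ->
    u (t * x + (1 - t) * y) <= t * u x + (1 - t) * u y.

Definition strictly_convex_on (D : R -> Prop) (u : R -> R) : Prop :=
  forall x y t, D x -> D y -> x <> y -> 0 < t < 1 ->
    u (t * x + (1 - t) * y) < t * u x + (1 - t) * u y.

Definition strictly_concave_on (D : R -> Prop) (u : R -> R) : Prop :=
  strictly_convex_on D (fun x => - u x).

Definition nonpos_convex_minorant (D : R -> Prop) (u m : R -> R) : Prop :=
  convex_on D m /\ forall y, D y -> m y <= 0 /\ m y <= u y.

Definition greatest_nonpos_convex_minorant (D : R -> Prop) (u m : R -> R)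
  : Prop :=
  nonpos_convex_minorant D u m /\
  forall n, nonpos_convex_minorant D u n -> forall y, D y -> n y <= m y.

Section Model.

Context (alpha delta lambda : R).

Definition s2a : R := sqrt (2 * alpha).

Definition rho (x : R) : R :=
  x ^ 2 + 2 * x / s2a - (lambda / alpha) / (alpha * delta - lambda).

Definition f0 : R :=
  1 / s2a *
  (sqrt ((alpha * delta + lambda) / (alpha * delta - lambda)) - 1).

Definition B0 : R :=
  - (2 * f0 / (alpha * s2a)) * (alpha * delta - lambda) * exp (f0 * s2a).

Definition Psi (x : R) : R := exp (2 * s2a * x).
Definition Psi_inv (y : R) : R := ln y / (2 * s2a).

Definition hl (x : R) : R :=
  (delta - lambda / alpha) * x ^ 2 - lambda / alpha ^ 2.

Definition hr1 (x c : R) : R :=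
  delta * c * (c - 2 * x) + (delta - lambda / alpha) * x ^ 2 + c
  - lambda / alpha ^ 2.

Definition hr2 (x c : R) : R :=
  lambda / alpha * c * (c - 2 * x) + c + B0 * exp (- (x - c) * s2a).

(* [hr1] and [hr2] agree at [x = f0 + c], because [rho f0 = 0]. *)
Definition hr (x c : R) : R :=
  if Rle_dec x (f0 + c) then hr1 x c else hr2 x c.

Definition h (x c : R) : R := Rmin (hl x) (hr x c).

Definition Hl (y : R) : R := exp (s2a * Psi_inv y) * hl (Psi_inv y).
Definition Hr (y c : R) : R := exp (s2a * Psi_inv y) * hr (Psi_inv y) c.
Definition H (y c : R) : R := exp (s2a * Psi_inv y) * h (Psi_inv y) c.

Definition dHl (y : R) : R := Derive Hl y.
Definition dHr (y c : R) : R := Derive (fun y' => Hr y' c) y.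

Definition y_ (c : R) : R := Psi (1 / (2 * delta) + c / 2).

(* For [v = y_ c] the concavity clause is vacuous. *)
Definition inflection_point (c v : R) : Prop :=
  y_ c <= v < Psi (f0 + c) /\
  strictly_convex_on (fun y => v < y) (fun y => Hr y c) /\
  strictly_concave_on (fun y => y_ c < y < v) (fun y => Hr y c).

Definition tangent_couple (yv : R -> R) (c : R) (p : R * R) : Prop :=
  let (y1, y2) := p in
  (1 < y1 /\ y1 < y_ c /\ y_ c <= yv c /\ yv c < y2) /\
  dHl y1 = dHr y2 c /\
  Hl y1 - dHl y1 * y1 = Hr y2 c - dHr y2 c * y2.

Section Boundaries.

Context (y1h y2h : R -> R).

Definition A (c : R) : R := dHl (y1h c).
Definition B (c : R) : R := Hl (y1h c) - A c * y1h c.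

Definition minorant (c y : R) : R :=
  if Rle_dec y (y1h c) then Hl y
  else if Rlt_dec y (y2h c) then A c * y + B c
  else Hr y c.

Definition admissible_c1 (yv : R -> R) (c1 : R) : Prop :=
  0 < c1 /\
  forall c, 0 < c < c1 ->
    unique (tangent_couple yv c) (y1h c, y2h c) /\
    y1h c < Psi f0 /\
    greatest_nonpos_convex_minorant
      (fun y => 1 <= y) (fun y => H y c) (minorant c) /\
    forall y, 1 < y -> A c * y + B c <= H y c.

(* Includes the value [1 / (2 * delta)] prescribed at [c = 0]. *)
Definition F (c : R) : R :=
  if Req_EM_T c 0 then 1 / (2 * delta) else Psi_inv (y1h c).
Definition G (c : R) : R :=
  if Req_EM_T c 0 then 1 / (2 * delta) else Psi_inv (y2h c).

Definition V0 (x : R) : R :=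
  if Rle_dec (Rabs x) f0 then delta * x ^ 2
  else lambda / alpha ^ 2 + lambda / alpha * x ^ 2 + B0 * exp (- Rabs x * s2a).

Definition V (x c : R) : R :=
  if Req_EM_T c 0 then V0 x
  else if Rle_dec x (F c) then delta * x ^ 2
  else if Rlt_dec x (G c) then
    lambda / alpha * x ^ 2 + lambda / alpha ^ 2
    + A c * exp (x * s2a) + B c * exp (- x * s2a)
  else V0 (x - c) + c.

Definition Q (x c : R) : R := V (Rabs x) c.

Definition h1 (x : R) : R :=
  (alpha * delta - lambda) / (2 * alpha) * exp (- x * s2a) * rho x.
Definition h2 (x : R) : R :=
  (alpha * delta - lambda) / (2 * alpha) * exp (x * s2a)
  * (rho x - 4 * x / s2a).

Definition inverse_of_h1 (h1inv : R -> R) : Prop :=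
  forall z, - (lambda / (2 * alpha ^ 2)) <= z <= 0 ->
    0 <= h1inv z <= f0 /\ h1 (h1inv z) = z.

Definition H3 (x c : R) : R :=
  exp (- x * s2a) / (2 * s2a)
  * (Derive (fun x' => hr1 x' c) x + s2a * hr1 x c).
Definition H4 (x c : R) : R :=
  exp (x * s2a) / (2 * s2a)
  * (- Derive (fun x' => hr1 x' c) x + s2a * hr1 x c).

Definition L (h1inv : R -> R) (x c : R) : R := H4 x c - h2 (h1inv (H3 x c)).

(* [Glb_Rbar] of the empty set is [p_infty]; both minima below are finite, so
   the coercion [real] loses nothing. *)
Definition c2 (h1inv : R -> R) (c1 : R) : R :=
  real (Rbar_min c1
    (Glb_Rbar (fun c => 0 < c < c1 /\ L h1inv (f0 + c) c >= 0))).

Definition c0 (h1inv : R -> R) (c1 : R) : R :=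
  real (Rbar_min (c2 h1inv c1)
    (Glb_Rbar (fun c => 0 < c < c2 h1inv c1 /\ Derive G c <= 1))).

Definition exceptional (x c : R) : Prop :=
  Rabs x = F c \/ Rabs x = G c \/ Rabs x = f0 + c.

Definition Qx (x c : R) : R := Derive (fun x' => Q x' c) x.
Definition Qc (x c : R) : R := Derive (fun c' => Q x c') c.
Definition Qxx (x c : R) : R := Derive_n (fun x' => Q x' c) 2 x.

End Boundaries.

End Model.

(* Continuous differentiability of [u] on [R * [0, cm)]: the derivative in the
   second argument is taken relative to [[0, cm)], hence is one-sided at [0]. *)
Definition C1_on_strip (cm : R) (u : R -> R -> R) : Prop :=
  exists ux uc : R -> R -> R,
    (forall x c, 0 <= c < cm ->
      is_derive (fun x' => u x' c) x (ux x c) /\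
      filterdiff (fun c' => u x c') (within (fun c' => 0 <= c' < cm) (locally c))
        (fun t : R => scal t (uc x c))) /\
    continuous_on (fun p : R * R => 0 <= snd p < cm)
      (fun p => ux (fst p) (snd p)) /\
    continuous_on (fun p : R * R => 0 <= snd p < cm)
      (fun p => uc (fst p) (snd p)).

(* Main.v *)
Require Import Defs.
From Stdlib Require Import Reals.
From Coquelicot Require Import Coquelicot.
From Stdlib Require Import Ranalysis5 Lra.
Open Scope R_scope.

(** Put [s = sqrt (2 * alpha)], [mu = lambda / alpha] and [phi = f0]. Between its
    boundaries [a < b] the value function solves
    [v'' / 2 + lambda * x ^ 2 = alpha * v], that is, it is
    [mu * x ^ 2 + 2 * mu / s ^ 2] plus a combination of [exp (s * x)] and
    [exp (- (s * x))]. Joining the payoff on the left at [a] with matching slope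
    determines the two coefficients as functions [P a], [N a]; joining the payoff
    on the right at [b] determines them as [Pin b c], [Nin b c]. In the coordinate
    [y = exp (2 * s * x)] these pairs are slope and intercept of tangents of [Hl]
    and [Hr], so the tangent couples of the convex minorant are the solutions of
    [P a = Pin b c], [N a = Nin b c] ([smooth_fit]). The derivatives of [P] and [N]
    are [exp (- (s * x)) * (s / 2 * w x)] and [- (exp (s * x) * (s / 2 * w x))],
    where [w] is up to a factor what the generator makes of the payoff; the same
    holds for [Pin], [Nin] and a concave quadratic polynomial [Win]. Comparing such
    pairs ([exp_pair_compare]) is the main tool for the boundaries.

    The boundaries. If the right tangency point lay beyond the corner
    [x = phi + c], then [L] would be nonnegative there ([corner_nonneg]); and [L]
    is negative there for small [c] ([corner_neg]), so that the bound [c2] is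
    positive. Once [a] is eliminated, the remaining equation for [b] is strictly
    monotone ([reduced_decr]). The intermediate value theorem then yields solutions
    for neighbouring [c], uniqueness of the tangent couple identifies them with the
    given boundaries, which are therefore continuous ([FG_cont]), and the linearized
    equations give explicit derivatives ([FG_derive]). As [c] tends to [0], both
    boundaries tend to [1 / (2 * delta)] and [G'] tends to
    [1 / 2 + delta / (s ^ 2 * w (1 / (2 * delta)))], which exceeds [1]
    ([dG_gt_1_near_0]): hence [c0 > 0]. As long as [G' > 1] one has
    [G c > c + 1 / (2 * delta)], and this is the condition for [F' < 0].

    The value function. Its derivative in [c] is explicit as well: [0] on the left,
    [(1 - 2 * delta * (G - c)) * sinh (s * (x - F)) / sinh (s * (G - F))] in the
    middle, [1 - V0' (x - c)] on the right. The formulas match along the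
    boundaries, which gives joint continuous differentiability, also at [c = 0]
    where the boundaries merge.

    The inequalities. The value lies below [delta * x ^ 2] in the middle because
    the tangent line lies below [H]. The generator inequality amounts to the sign
    of [w], of [Win] and of its analogue [Wout] beyond the corner; the concave [Win] is
    positive at the corner because [phi > 1 / (2 * mu)], and it cannot be negative
    where [Hr] is convex, that is, past the inflection point. For the gradient inequality, [V_x + V_c] equals
    [1] on the right and is at most [1] on the left. In between,
    [u = V_x + V_c - 1] satisfies [u'' = s ^ 2 * u + s ^ 2 * (1 - 2 * mu * x)]; it
    is nonpositive at both ends, and its slope at the right end is
    [s ^ 2 * Win * (G' - 1)], hence positive. The right-hand side changes sign only
    once, from plus to minus, and [max_principle] yields [u <= 0]. Finally, on each
    of the three intervals one factor of the complementarity relation vanishes. *)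

(** * Limits and derivatives *)

Definition tends {T : Type} (Fil : (T -> Prop) -> Prop) (f : T -> R) (a : R) :=
  filterlim f Fil (locally a).

Section Limits.

Context {T : Type} {Fil : (T -> Prop) -> Prop} {FF : Filter Fil}.

Lemma tends_eps (f : T -> R) (a : R) :
  tends Fil f a <-> forall eps, 0 < eps -> Fil (fun p => Rabs (f p - a) < eps).
Proof.
  unfold tends; rewrite filterlim_locally; split; intros hyp eps.
  - intros he. apply (filter_imp (F := Fil)) with (2 := hyp (mkposreal eps he)).
    intros p hp. exact hp.
  - apply (hyp eps). apply cond_pos.
Qed.

Lemma tends_const (a : R) : tends Fil (fun _ => a) a.
Proof. apply filterlim_const. Qed.

Lemma tends_plus (f g : T -> R) (a b : R) :
  tends Fil f a -> tends Fil g b -> tends Fil (fun p => f p + g p) (a + b).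
Proof.
  intros hf hg.
  exact (filterlim_comp_2 f g (fun u v => u + v) hf hg
           (filterlim_plus a b)).
Qed.

Lemma tends_opp (f : T -> R) (a : R) :
  tends Fil f a -> tends Fil (fun p => - f p) (- a).
Proof.
  intros hf. exact (filterlim_comp _ _ _ f Ropp Fil _ _ hf (filterlim_opp a)).
Qed.

Lemma tends_minus (f g : T -> R) (a b : R) :
  tends Fil f a -> tends Fil g b -> tends Fil (fun p => f p - g p) (a - b).
Proof. intros hf hg. apply tends_plus; [exact hf | now apply tends_opp]. Qed.

Lemma tends_mult (f g : T -> R) (a b : R) :
  tends Fil f a -> tends Fil g b -> tends Fil (fun p => f p * g p) (a * b).
Proof.
  intros hf hg.
  exact (filterlim_comp_2 f g (fun u v => u * v) hf hg
           (filterlim_mult a b)).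
Qed.

Lemma tends_comp (u : R -> R) (f : T -> R) (a : R) :
  continuous u a -> tends Fil f a -> tends Fil (fun p => u (f p)) (u a).
Proof. intros hu hf. exact (filterlim_comp _ _ _ f u Fil _ _ hf hu). Qed.

Lemma tends_exp (f : T -> R) (a : R) :
  tends Fil f a -> tends Fil (fun p => exp (f p)) (exp a).
Proof.
  apply tends_comp. apply (ex_derive_continuous exp). exists (exp a).
  apply is_derive_exp.
Qed.

Lemma tends_inv (f : T -> R) (a : R) :
  a <> 0 -> tends Fil f a -> tends Fil (fun p => / f p) (/ a).
Proof.
  intros ha. apply tends_comp. apply (ex_derive_continuous Rinv).
  auto_derive; exact ha.
Qed.

Lemma tends_div (f g : T -> R) (a b : R) :
  b <> 0 -> tends Fil f a -> tends Fil g b -> tends Fil (fun p => f p / g p) (a / b).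
Proof. intros hb hf hg. apply tends_mult; [exact hf | now apply tends_inv]. Qed.

Lemma tends_pow (f : T -> R) (a : R) (n : nat) :
  tends Fil f a -> tends Fil (fun p => f p ^ n) (a ^ n).
Proof.
  intros hf. induction n as [|n IH]; simpl.
  - apply tends_const.
  - now apply tends_mult.
Qed.

Lemma tends_abs (f : T -> R) (a : R) :
  tends Fil f a -> tends Fil (fun p => Rabs (f p)) (Rabs a).
Proof. apply tends_comp. apply continuous_Rabs. Qed.

Lemma tends_ext (f g : T -> R) (a : R) :
  Fil (fun p => f p = g p) -> tends Fil f a -> tends Fil g a.
Proof. intros e. apply filterlim_ext_loc. exact e. Qed.

Lemma tends_gt (f : T -> R) (a b : R) :
  tends Fil f a -> b < a -> Fil (fun p => b < f p).
Proof.
  intros hf hab. rewrite tends_eps in hf.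
  apply (filter_imp (F := Fil)) with (2 := hf (a - b) ltac:(lra)).
  intros p hp. apply Rabs_def2 in hp. lra.
Qed.

Lemma tends_lt (f : T -> R) (a b : R) :
  tends Fil f a -> a < b -> Fil (fun p => f p < b).
Proof.
  intros hf hab. rewrite tends_eps in hf.
  apply (filter_imp (F := Fil)) with (2 := hf (b - a) ltac:(lra)).
  intros p hp. apply Rabs_def2 in hp. lra.
Qed.

Lemma tends_squeeze (f g : T -> R) (a : R) :
  Fil (fun p => Rabs (f p - a) <= g p) -> tends Fil g 0 -> tends Fil f a.
Proof.
  intros hle hg. rewrite tends_eps. intros eps he.
  apply (filter_imp (F := Fil)) with (2 := filter_and _ _ hle (tends_lt g 0 eps hg he)).
  intros p [h1p h2p]. lra.
Qed.

End Limits.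

Lemma tends_within {T} (Fil : (T -> Prop) -> Prop) {FF : Filter Fil} (D : T -> Prop)
  (f : T -> R) (a : R) : tends Fil f a -> tends (within D Fil) f a.
Proof.
  intros hf. apply filterlim_filter_le_1 with (2 := hf).
  apply filter_le_within.
Qed.

(** Gluing of limits. Each piece is tested along its own region only, so that a
    piece may fail to converge elsewhere. *)
Lemma tends_cover3 {T} (Fil : (T -> Prop) -> Prop) {FF : Filter Fil}
  (R1 R2 R3 : T -> Prop) (f f1 f2 f3 : T -> R) (a : R) :
  Fil (fun p => (R1 p /\ f p = f1 p) \/ (R2 p /\ f p = f2 p) \/ (R3 p /\ f p = f3 p)) ->
  tends (within R1 Fil) f1 a -> tends (within R2 Fil) f2 a -> tends (within R3 Fil) f3 a ->
  tends Fil f a.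
Proof.
  intros hc l1 l2 l3. rewrite tends_eps. intros eps he.
  pose proof (proj1 (tends_eps (Fil := within R1 Fil) _ _) l1 eps he) as e1.
  pose proof (proj1 (tends_eps (Fil := within R2 Fil) _ _) l2 eps he) as e2.
  pose proof (proj1 (tends_eps (Fil := within R3 Fil) _ _) l3 eps he) as e3.
  unfold within in e1, e2, e3.
  apply (filter_imp (F := Fil)) with
    (2 := filter_and _ _ hc (filter_and _ _ e1 (filter_and _ _ e2 e3))).
  intros p [[[r e] | [[r e] | [r e]]] [k1 [k2 k3]]]; rewrite e; auto.
Qed.

Lemma tends_within_empty {T} (Fil : (T -> Prop) -> Prop) {FF : Filter Fil}
  (D : T -> Prop) (f : T -> R) (a : R) :
  Fil (fun p => ~ D p) -> tends (within D Fil) f a.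
Proof.
  intros hD. apply (tends_eps (Fil := within D Fil)). intros eps he. unfold within.
  apply (filter_imp (F := Fil)) with (2 := hD). intros p h1 h2. contradiction.
Qed.

Lemma locally_R (P : R -> Prop) (x : R) :
  locally x P <-> exists d, 0 < d /\ forall z, Rabs (z - x) < d -> P z.
Proof.
  split.
  - intros [d hd]. exists d. split; [apply cond_pos |]. intros z hz. now apply hd.
  - intros [d [h hd]]. exists (mkposreal d h). intros z hz. now apply hd.
Qed.

Lemma locally_R2 (P : R * R -> Prop) (x c : R) :
  locally (x, c) P <->
  exists d, 0 < d /\
    forall z e, Rabs (z - x) < d -> Rabs (e - c) < d -> P (z, e).
Proof.
  split.
  - intros [d hd]. exists d. split; [apply cond_pos |].
    intros z e hz he. apply hd. split; assumption.
  - intros [d [h hd]]. exists (mkposreal d h).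
    intros [z e] [hz he]. apply hd; assumption.
Qed.

Lemma tends_fst (x c : R) : tends (locally (x, c)) fst x.
Proof. exact (continuous_fst x c). Qed.

Lemma tends_snd (x c : R) : tends (locally (x, c)) snd c.
Proof. exact (continuous_snd x c). Qed.

Lemma tends_id (x : R) : tends (locally x) (fun z => z) x.
Proof. apply filterlim_id. Qed.

Lemma locally_lt (x b : R) : x < b -> locally x (fun z => z < b).
Proof. intros h. apply tends_lt with (a := x); [apply tends_id | exact h]. Qed.

Lemma locally_gt (x b : R) : b < x -> locally x (fun z => b < z).
Proof. intros h. apply tends_gt with (a := x); [apply tends_id | exact h]. Qed.

Lemma tends_lt_lt {T} (Fil : (T -> Prop) -> Prop) {FF : Filter Fil} (f g : T -> R) (a b : R) :
  tends Fil f a -> tends Fil g b -> a < b -> Fil (fun p => f p < g p).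
Proof.
  intros hf hg hab.
  apply (filter_imp (F := Fil)) with (2 := tends_gt _ _ 0 (tends_minus g f b a hg hf) ltac:(lra)).
  intros p k. lra.
Qed.

(** The function is matched by its syntax: unification up to conversion would
    take numerals and quotients apart. *)
Ltac tends_step :=
  match goal with
  | |- tends _ _ _ => assumption
  | |- tends _ (fun _ => ?a) _ => apply tends_const
  | |- tends _ (fun p => p) _ => apply tends_id
  | |- tends _ (fun p => @?f p + @?g p) _ => apply (tends_plus f g)
  | |- tends _ (fun p => @?f p - @?g p) _ => apply (tends_minus f g)
  | |- tends _ (fun p => @?f p * @?g p) _ => apply (tends_mult f g)
  | |- tends _ (fun p => @?f p / @?g p) _ => apply (tends_div f g)
  | |- tends _ (fun p => - @?f p) _ => apply (tends_opp f)
  | |- tends _ (fun p => @?f p ^ ?n) _ => apply (tends_pow f)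
  | |- tends _ (fun p => exp (@?f p)) _ => apply (tends_exp f)
  | |- tends _ (fun p => Rabs (@?f p)) _ => apply (tends_abs f)
  end.
Ltac tends_auto := repeat tends_step.

(** Differentiability of [f] at [x] relative to a set, in the elementary form
    that suits both interior points and the left end of a half-open interval. *)
Definition dwithin (D : R -> Prop) (f : R -> R) (x l : R) : Prop :=
  forall eps, 0 < eps ->
    exists d, 0 < d /\ forall z, D z -> Rabs (z - x) < d ->
      Rabs (f z - f x - l * (z - x)) <= eps * Rabs (z - x).

Lemma is_derive_dwithin (f : R -> R) (x l : R) :
  is_derive f x l <-> dwithin (fun _ => True) f x l.
Proof.
  split.
  - intros [_ hd] eps he.
    destruct (hd x (fun P hP => hP) (mkposreal eps he)) as [d hd'].
    exists d. split; [apply cond_pos |]. intros z _ hz.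
    specialize (hd' z hz). simpl in hd'.
    unfold norm, minus, plus, opp, scal in hd'; simpl in hd'.
    unfold abs, mult in hd'; simpl in hd'.
    replace (f z - f x - l * (z - x)) with (f z + - f x + - ((z + - x) * l)) by ring.
    exact hd'.
  - intros hd. split.
    + apply is_linear_scal_l.
    + intros y hy. pose proof (is_filter_lim_locally_unique (V := R_NormedModule) x y hy) as e. subst y.
      intros eps. destruct (hd eps (cond_pos eps)) as [d [hd0 hd']].
      exists (mkposreal d hd0). intros z hz. specialize (hd' z I hz).
      unfold norm, minus, plus, opp, scal; simpl. unfold abs, mult; simpl.
      replace (f z + - f x + - ((z + - x) * l)) with (f z - f x - l * (z - x)) by ring.
      exact hd'.
Qed.

Lemma dwithin_weaken (D : R -> Prop) (f : R -> R) (x l : R) :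
  is_derive f x l -> dwithin D f x l.
Proof.
  rewrite is_derive_dwithin. intros hd eps he.
  destruct (hd eps he) as [d [hd0 hd']]. exists d. split; auto.
Qed.

Lemma dwithin_interior (D : R -> Prop) (f : R -> R) (x l : R) :
  locally x D -> dwithin D f x l -> is_derive f x l.
Proof.
  rewrite locally_R, is_derive_dwithin. intros [r [hr hD]] hd eps he.
  destruct (hd eps he) as [d [hd0 hd']]. exists (Rmin d r). split.
  - now apply Rmin_glb_lt.
  - intros z _ hz. apply hd'.
    + apply hD. apply Rlt_le_trans with (1 := hz). apply Rmin_r.
    + apply Rlt_le_trans with (1 := hz). apply Rmin_l.
Qed.

Lemma dwithin_filterdiff (D : R -> Prop) (f : R -> R) (x l : R) :
  D x -> dwithin D f x l ->
  filterdiff f (within D (locally x)) (fun t : R => scal t l).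
Proof.
  intros hx hd. split.
  - exact (is_linear_scal_l (K := R_AbsRing) (V := R_NormedModule) l).
  - intros y hy.
    assert (y = x) as ->.
    { apply Rminus_diag_uniq.
      destruct (Req_dec (y - x) 0) as [| hne]; [assumption | exfalso].
      assert (hp : 0 < Rabs (y - x)) by now apply Rabs_pos_lt.
      specialize (hy (fun z => Rabs (z - y) < Rabs (y - x))).
      destruct hy as [d hd'].
      { rewrite locally_R. exists (Rabs (y - x)). auto. }
      specialize (hd' x (ball_center x d) hx). rewrite Rabs_minus_sym in hd'. lra. }
    intros eps. destruct (hd eps (cond_pos eps)) as [d [hd0 hd']].
    exists (mkposreal d hd0). intros z hz hDz. specialize (hd' z hDz hz).
    unfold norm, minus, plus, opp, scal; simpl. unfold abs, mult; simpl.
    replace (f z + - f x + - ((z + - x) * l)) with (f z - f x - l * (z - x)) by ring.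
    exact hd'.
Qed.

(** Gluing of derivatives. A piece whose region stays away from [x] imposes no
    condition. *)
Lemma dwithin_cover3 (D R1 R2 R3 : R -> Prop) (f f1 f2 f3 : R -> R) (x l : R) :
  (forall z, D z -> (R1 z /\ f z = f1 z) \/ (R2 z /\ f z = f2 z) \/ (R3 z /\ f z = f3 z)) ->
  (f x = f1 x /\ dwithin (fun z => D z /\ R1 z) f1 x l) \/ locally x (fun z => D z -> ~ R1 z) ->
  (f x = f2 x /\ dwithin (fun z => D z /\ R2 z) f2 x l) \/ locally x (fun z => D z -> ~ R2 z) ->
  (f x = f3 x /\ dwithin (fun z => D z /\ R3 z) f3 x l) \/ locally x (fun z => D z -> ~ R3 z) ->
  dwithin D f x l.
Proof.
  intros hc k1 k2 k3 eps he.
  assert (step : forall (Ri : R -> Prop) fi,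
    (f x = fi x /\ dwithin (fun z => D z /\ Ri z) fi x l) \/ locally x (fun z => D z -> ~ Ri z) ->
    exists d, 0 < d /\ forall z, D z -> Ri z -> f z = fi z -> Rabs (z - x) < d ->
      Rabs (f z - f x - l * (z - x)) <= eps * Rabs (z - x)).
  { intros Ri fi [[e hd] | hn].
    - destruct (hd eps he) as [d [hd0 hd']]. exists d. split; [assumption |].
      intros z hD hR hf hz. rewrite hf, e. now apply hd'.
    - rewrite locally_R in hn. destruct hn as [d [hd0 hd']].
      exists d. split; [assumption |]. intros z hD hR _ hz.
      exfalso. exact (hd' z hz hD hR). }
  destruct (step R1 f1 k1) as [d1 [p1 q1]].
  destruct (step R2 f2 k2) as [d2 [p2 q2]].
  destruct (step R3 f3 k3) as [d3 [p3 q3]].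
  exists (Rmin d1 (Rmin d2 d3)). split.
  { repeat apply Rmin_glb_lt; assumption. }
  intros z hD hz.
  pose proof (Rmin_l d1 (Rmin d2 d3)). pose proof (Rmin_r d1 (Rmin d2 d3)).
  pose proof (Rmin_l d2 d3). pose proof (Rmin_r d2 d3).
  destruct (hc z hD) as [[r e] | [[r e] | [r e]]].
  - apply q1; auto; lra.
  - apply q2; auto; lra.
  - apply q3; auto; lra.
Qed.

Lemma is_derive_congr (f g : R -> R) (x l l' : R) :
  (forall z, f z = g z) -> l = l' -> is_derive f x l -> is_derive g x l'.
Proof. intros e <- h. exact (is_derive_ext f g x l e h). Qed.

(** Replaces the derivatives of unknown functions that [auto_derive] leaves. *)
Ltac derive_value f x d :=
  match type of d with
  | is_derive _ _ ?l =>
      replace (Derive (fun t => f t) x) with l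
        by (symmetry; apply (is_derive_unique f); exact d)
  end.

(** ** Consequences of the mean value theorem *)

Lemma mvt (f df : R -> R) (a b : R) :
  a <= b -> (forall x, a <= x <= b -> is_derive f x (df x)) ->
  exists x, a <= x <= b /\ f b - f a = df x * (b - a).
Proof.
  intros hab hd. destruct (MVT_gen f a b df) as [x [hx e]].
  - rewrite Rmin_left, Rmax_right by assumption. intros x hx. apply hd. lra.
  - rewrite Rmin_left, Rmax_right by assumption. intros x hx.
    apply continuity_pt_filterlim. apply (ex_derive_continuous f). exists (df x).
    now apply hd.
  - rewrite Rmin_left, Rmax_right in hx by assumption. exists x. auto.
Qed.

Lemma incr_le (f df : R -> R) (a b : R) :
  a <= b -> (forall x, a <= x <= b -> is_derive f x (df x)) ->
  (forall x, a <= x <= b -> 0 <= df x) -> f a <= f b.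
Proof.
  intros hab hd hp. destruct (mvt f df a b hab hd) as [x [hx e]].
  specialize (hp x hx). nra.
Qed.

Lemma incr_lt (f df : R -> R) (a b : R) :
  a < b -> (forall x, a <= x <= b -> is_derive f x (df x)) ->
  (forall x, a <= x <= b -> 0 < df x) -> f a < f b.
Proof.
  intros hab hd hp. destruct (mvt f df a b (Rlt_le _ _ hab) hd) as [x [hx e]].
  specialize (hp x hx). nra.
Qed.

Lemma decr_le (f df : R -> R) (a b : R) :
  a <= b -> (forall x, a <= x <= b -> is_derive f x (df x)) ->
  (forall x, a <= x <= b -> df x <= 0) -> f b <= f a.
Proof.
  intros hab hd hp. destruct (mvt f df a b hab hd) as [x [hx e]].
  specialize (hp x hx). nra.
Qed.

(** Strict convexity at the midpoint, which is enough to contradict concavity. *)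
Lemma midpoint_strict (f df : R -> R) (a b : R) :
  a < b -> (forall x, a <= x <= b -> is_derive f x (df x)) ->
  (forall x y, a <= x -> x < y -> y <= b -> df x < df y) ->
  f (/ 2 * a + (1 - / 2) * b) < / 2 * f a + (1 - / 2) * f b.
Proof.
  intros hab hd hm. set (m := / 2 * a + (1 - / 2) * b).
  assert (hm1 : a < m < b) by (unfold m; lra).
  destruct (mvt f df m b) as [y [hy ey]]; [lra | intros; apply hd; lra |].
  (* the mean values on the two halves might both be [m]; halving the left
     half once more yields one that is strictly smaller *)
  set (m' := (a + m) / 2).
  destruct (mvt f df a m') as [x1 [hx1 ex1]];
    [unfold m'; lra | intros; apply hd; unfold m' in *; lra |].
  destruct (mvt f df m' m) as [x2 [hx2 ex2]];
    [unfold m'; lra | intros; apply hd; unfold m' in *; lra |].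
  assert (df x1 < df m).
  { apply hm; unfold m' in *; lra. }
  assert (df x2 <= df m).
  { destruct (Req_dec x2 m) as [-> | hne]; [lra |]. apply Rlt_le, hm; unfold m' in *; lra. }
  assert (df m <= df y).
  { destruct (Req_dec m y) as [<- | hne]; [lra |]. apply Rlt_le, hm; lra. }
  replace (b - m) with (m - a) in ey by (unfold m; lra).
  replace (m' - a) with ((m - a) / 2) in ex1 by (unfold m'; lra).
  replace (m - m') with ((m - a) / 2) in ex2 by (unfold m'; lra).
  nra.
Qed.

Lemma right_limit_lt (f : R -> R) (l a b : R) :
  b <= a -> (forall x y, 0 < x -> x < y -> y < b -> f x < f y) ->
  tends (within (fun c => 0 < c < a) (locally 0)) f l ->
  forall c, 0 < c < b -> l < f c.
Proof.
  intros hab hf hl c hc. apply Rle_lt_trans with (f (c / 2)); [| apply hf; lra].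
  apply Rnot_lt_le. intros hlt. assert (k := tends_gt _ _ _ hl hlt). unfold within in k.
  destruct (proj1 (locally_R _ _) k) as [d [hd hk]].
  set (e := Rmin (d / 2) (c / 4)).
  assert (he : 0 < e /\ e <= d / 2 /\ e <= c / 4).
  { unfold e. repeat split; [apply Rmin_glb_lt; lra | apply Rmin_l | apply Rmin_r]. }
  pose proof (hk e ltac:(apply Rabs_def1; lra) ltac:(lra)).
  pose proof (hf e (c / 2) ltac:(lra) ltac:(lra) ltac:(lra)). lra.
Qed.

(** ** Differentiating an implicitly defined pair of functions *)

Definition slope (f : R -> R) (x l z : R) : R :=
  if Req_EM_T z x then l else (f z - f x) / (z - x).

Lemma slope_at (f : R -> R) (x l : R) : slope f x l x = l.
Proof. unfold slope. destruct (Req_EM_T x x); [reflexivity | contradiction]. Qed.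

Lemma slope_eq (f : R -> R) (x l z : R) : f z - f x = slope f x l z * (z - x).
Proof.
  unfold slope. destruct (Req_EM_T z x) as [-> | hne]; [ring |].
  field. lra.
Qed.

Lemma slope_cont (f : R -> R) (x l : R) :
  is_derive f x l -> continuous (slope f x l) x.
Proof.
  rewrite is_derive_dwithin. intros hd. unfold continuous. rewrite slope_at.
  apply tends_eps. intros eps he. destruct (hd (eps / 2) ltac:(lra)) as [d [hd0 hd']].
  apply locally_R. exists d. split; [assumption |]. intros z hz.
  unfold slope. destruct (Req_EM_T z x) as [-> | hne].
  - rewrite Rminus_diag, Rabs_R0. lra.
  - specialize (hd' z I hz).
    assert (hp : 0 < Rabs (z - x)) by (apply Rabs_pos_lt; lra).
    replace ((f z - f x) / (z - x) - l) with ((f z - f x - l * (z - x)) / (z - x))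
      by (field; lra).
    unfold Rdiv at 1. rewrite Rabs_mult, Rabs_inv.
    apply Rmult_lt_reg_r with (1 := hp).
    rewrite Rmult_assoc, Rinv_l by lra. nra.
Qed.

Lemma is_derive_slope (f u : R -> R) (x : R) :
  continuous u x -> locally x (fun z => f z - f x = u z * (z - x)) ->
  is_derive f x (u x).
Proof.
  intros hu hl. apply is_derive_dwithin. intros eps he.
  assert (hu' := proj1 (tends_eps u (u x)) hu eps he).
  destruct (proj1 (locally_R _ _) (filter_and _ _ hu' hl)) as [d [hd hd']].
  exists d. split; [assumption |]. intros z _ hz. destruct (hd' z hz) as [k1 k2].
  rewrite k2. replace (u z * (z - x) - u x * (z - x)) with ((u z - u x) * (z - x)) by ring.
  rewrite Rabs_mult. apply Rmult_le_compat_r; [apply Rabs_pos | lra].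
Qed.

(** Along a curve [c -> (G c, c)] a function [a x + c * b x + c ^ 2 * d x] has
    difference quotients that are affine in those of [G], with continuous
    coefficients; two such equations are then solved by Cramer's rule before
    any limit is taken, so that continuity of [F] and [G] suffices. *)
Lemma implicit_pair_derive
  (p1 p2 a1 b1 d1 a2 b2 d2 F G : R -> R) (c : R) (p1' p2' a1' b1' d1' a2' b2' d2' : R) :
  is_derive p1 (F c) p1' -> is_derive p2 (F c) p2' ->
  is_derive a1 (G c) a1' -> is_derive b1 (G c) b1' -> is_derive d1 (G c) d1' ->
  is_derive a2 (G c) a2' -> is_derive b2 (G c) b2' -> is_derive d2 (G c) d2' ->
  continuous F c -> continuous G c ->
  locally c (fun e => p1 (F e) = a1 (G e) + e * b1 (G e) + e ^ 2 * d1 (G e)) ->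
  locally c (fun e => p2 (F e) = a2 (G e) + e * b2 (G e) + e ^ 2 * d2 (G e)) ->
  let q1 := a1' + c * b1' + c ^ 2 * d1' in
  let q2 := a2' + c * b2' + c ^ 2 * d2' in
  p1' * q2 - p2' * q1 <> 0 ->
  exists F' G', is_derive F c F' /\ is_derive G c G' /\
    p1' * F' = q1 * G' + b1 (G c) + 2 * c * d1 (G c) /\
    p2' * F' = q2 * G' + b2 (G c) + 2 * c * d2 (G c).
Proof.
  intros hp1 hp2 ha1 hb1 hd1 ha2 hb2 hd2 hF hG e1 e2 q1 q2 hD.
  set (P1 := fun e => slope p1 (F c) p1' (F e)).
  set (P2 := fun e => slope p2 (F c) p2' (F e)).
  set (Q1 := fun e => slope a1 (G c) a1' (G e) + e * slope b1 (G c) b1' (G e)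
                      + e ^ 2 * slope d1 (G c) d1' (G e)).
  set (Q2 := fun e => slope a2 (G c) a2' (G e) + e * slope b2 (G c) b2' (G e)
                      + e ^ 2 * slope d2 (G c) d2' (G e)).
  set (K1 := fun e => b1 (G c) + (e + c) * d1 (G c)).
  set (K2 := fun e => b2 (G c) + (e + c) * d2 (G c)).
  assert (comp : forall f x l u, is_derive f x l -> continuous u c -> u c = x ->
            tends (locally c) (fun e => slope f x l (u e)) l).
  { intros f x l u hd hu <-.
    pose proof (tends_comp (slope f (u c) l) u (u c) (slope_cont _ _ _ hd) hu) as h.
    rewrite slope_at in h. exact h. }
  assert (LP1 : tends (locally c) P1 p1') by (apply comp; auto).
  assert (LP2 : tends (locally c) P2 p2') by (apply comp; auto).
  assert (LQ1 : tends (locally c) Q1 q1).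
  { repeat apply tends_plus; try apply tends_mult; try apply tends_pow; try apply tends_id;
      apply comp; auto. }
  assert (LQ2 : tends (locally c) Q2 q2).
  { repeat apply tends_plus; try apply tends_mult; try apply tends_pow; try apply tends_id;
      apply comp; auto. }
  assert (LK1 : tends (locally c) K1 (b1 (G c) + (c + c) * d1 (G c))).
  { apply tends_plus; [apply tends_const |]. apply tends_mult; [| apply tends_const].
    apply tends_plus; [apply tends_id | apply tends_const]. }
  assert (LK2 : tends (locally c) K2 (b2 (G c) + (c + c) * d2 (G c))).
  { apply tends_plus; [apply tends_const |]. apply tends_mult; [| apply tends_const].
    apply tends_plus; [apply tends_id | apply tends_const]. }
  set (D := fun e => P1 e * Q2 e - P2 e * Q1 e).
  assert (LD : tends (locally c) D (p1' * q2 - p2' * q1)).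
  { apply tends_minus; now apply tends_mult. }
  assert (hDne : locally c (fun e => D e <> 0)).
  { destruct (Rtotal_order 0 (p1' * q2 - p2' * q1)) as [h | [h | h]].
    - apply filter_imp with (2 := tends_gt D _ 0 LD h). intros e he. lra.
    - congruence.
    - apply filter_imp with (2 := tends_lt D _ 0 LD h). intros e he. lra. }
  assert (eqs : locally c (fun e =>
     P1 e * (F e - F c) = Q1 e * (G e - G c) + K1 e * (e - c) /\
     P2 e * (F e - F c) = Q2 e * (G e - G c) + K2 e * (e - c))).
  { apply filter_imp with (2 := filter_and _ _ e1 e2). intros e [k1 k2].
    pose proof (locally_singleton _ _ e1) as k1c. pose proof (locally_singleton _ _ e2) as k2c.
    cbv beta in k1c, k2c.
    unfold P1, P2, Q1, Q2, K1, K2. split.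
    - rewrite <- slope_eq, k1, k1c.
      pose proof (slope_eq a1 (G c) a1' (G e)). pose proof (slope_eq b1 (G c) b1' (G e)).
      pose proof (slope_eq d1 (G c) d1' (G e)).
      replace (a1 (G e)) with (a1 (G c) + slope a1 (G c) a1' (G e) * (G e - G c)) by lra.
      replace (b1 (G e)) with (b1 (G c) + slope b1 (G c) b1' (G e) * (G e - G c)) by lra.
      replace (d1 (G e)) with (d1 (G c) + slope d1 (G c) d1' (G e) * (G e - G c)) by lra.
      ring.
    - rewrite <- slope_eq, k2, k2c.
      pose proof (slope_eq a2 (G c) a2' (G e)). pose proof (slope_eq b2 (G c) b2' (G e)).
      pose proof (slope_eq d2 (G c) d2' (G e)).
      replace (a2 (G e)) with (a2 (G c) + slope a2 (G c) a2' (G e) * (G e - G c)) by lra.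
      replace (b2 (G e)) with (b2 (G c) + slope b2 (G c) b2' (G e) * (G e - G c)) by lra.
      replace (d2 (G e)) with (d2 (G c) + slope d2 (G c) d2' (G e) * (G e - G c)) by lra.
      ring. }
  set (U := fun e => (Q2 e * K1 e - Q1 e * K2 e) / D e).
  set (Vv := fun e => (P2 e * K1 e - P1 e * K2 e) / D e).
  assert (LU : continuous U c).
  { unfold continuous.
    assert (LU' : tends (locally c) U ((q2 * (b1 (G c) + (c + c) * d1 (G c))
        - q1 * (b2 (G c) + (c + c) * d2 (G c))) / (p1' * q2 - p2' * q1))).
    { apply tends_div; [assumption | | assumption]. apply tends_minus; now apply tends_mult. }
    replace (U c) with ((q2 * (b1 (G c) + (c + c) * d1 (G c))
        - q1 * (b2 (G c) + (c + c) * d2 (G c))) / (p1' * q2 - p2' * q1)); [exact LU' |].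
    unfold U, D, P1, P2, Q1, Q2, K1, K2. rewrite !slope_at. reflexivity. }
  assert (LV : continuous Vv c).
  { unfold continuous.
    assert (LV' : tends (locally c) Vv ((p2' * (b1 (G c) + (c + c) * d1 (G c))
        - p1' * (b2 (G c) + (c + c) * d2 (G c))) / (p1' * q2 - p2' * q1))).
    { apply tends_div; [assumption | | assumption]. apply tends_minus; now apply tends_mult. }
    replace (Vv c) with ((p2' * (b1 (G c) + (c + c) * d1 (G c))
        - p1' * (b2 (G c) + (c + c) * d2 (G c))) / (p1' * q2 - p2' * q1)); [exact LV' |].
    unfold Vv, D, P1, P2, Q1, Q2, K1, K2. rewrite !slope_at. reflexivity. }
  exists (U c), (Vv c).
  assert (val : P1 c = p1' /\ P2 c = p2' /\ Q1 c = q1 /\ Q2 c = q2).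
  { unfold P1, P2, Q1, Q2. rewrite !slope_at. auto. }
  destruct val as [v1 [v2 [v3 v4]]].
  split; [| split; [| split]].
  - apply is_derive_slope; [exact LU |].
    apply filter_imp with (2 := filter_and _ _ eqs hDne). intros e [[k1 k2] hne].
    unfold U. apply Rmult_eq_reg_l with (2 := hne).
    replace (D e * ((Q2 e * K1 e - Q1 e * K2 e) / D e * (e - c)))
      with ((Q2 e * K1 e - Q1 e * K2 e) * (e - c)) by (field; exact hne).
    unfold D.
    replace ((P1 e * Q2 e - P2 e * Q1 e) * (F e - F c))
      with (Q2 e * (P1 e * (F e - F c)) - Q1 e * (P2 e * (F e - F c))) by ring.
    rewrite k1, k2. ring.
  - apply is_derive_slope; [exact LV |].
    apply filter_imp with (2 := filter_and _ _ eqs hDne). intros e [[k1 k2] hne].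
    unfold Vv. apply Rmult_eq_reg_l with (2 := hne).
    replace (D e * ((P2 e * K1 e - P1 e * K2 e) / D e * (e - c)))
      with ((P2 e * K1 e - P1 e * K2 e) * (e - c)) by (field; exact hne).
    unfold D.
    assert (P2 e * (P1 e * (F e - F c)) = P1 e * (P2 e * (F e - F c))) by ring.
    rewrite k1, k2 in H. lra.
  - unfold U, Vv, D, K1, K2. rewrite v1, v2, v3, v4. field. exact hD.
  - unfold U, Vv, D, K1, K2. rewrite v1, v2, v3, v4. field. exact hD.
Qed.

Lemma dwithin_ext (D : R -> Prop) (f g : R -> R) (x l : R) :
  (forall z, D z -> f z = g z) -> D x -> dwithin D f x l -> dwithin D g x l.
Proof.
  intros e hx hd eps he. destruct (hd eps he) as [d [hd0 hd']].
  exists d. split; [assumption |]. intros z hz hzx. rewrite <- !e by assumption. now apply hd'.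
Qed.

(** ** Even functions *)

Definition odd_ext (f : R -> R) (x : R) : R := if Rle_dec 0 x then f x else - f (- x).

Lemma opp_derive (x : R) : is_derive (fun z : R => - z) x (-1).
Proof. auto_derive; [exact I | ring]. Qed.

(** The parabola near [0] takes care of the kink of [Rabs]. *)
Lemma even_derive (f f' : R -> R) (k r x : R) :
  0 < r -> (forall z, z <= r -> f z = k * z ^ 2) -> f' 0 = 0 ->
  is_derive f (Rabs x) (f' (Rabs x)) ->
  is_derive (fun z => f (Rabs z)) x (odd_ext f' x).
Proof.
  intros hr hf h0 hd. destruct (Rtotal_order x 0) as [h | [-> | h]].
  - unfold odd_ext. destruct (Rle_dec 0 x); [lra |]. rewrite Rabs_left in hd by assumption.
    apply (is_derive_ext_loc (fun z => f (- z))).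
    + apply filter_imp with (2 := tends_lt _ _ 0 (tends_id x) h). intros z hz.
      now rewrite Rabs_left.
    + replace (- f' (- x)) with (-1 * f' (- x)) by ring.
      apply (is_derive_comp f (fun z => - z) x); [exact hd | exact (opp_derive x)].
  - unfold odd_ext. destruct (Rle_dec 0 0); [| lra]. rewrite h0.
    apply (is_derive_ext_loc (fun z => k * z ^ 2)).
    + apply locally_R. exists r. split; [assumption |]. intros z hz. rewrite Rminus_0_r in hz.
      rewrite hf by lra. now rewrite pow2_abs.
    + auto_derive; [exact I | ring].
  - unfold odd_ext. destruct (Rle_dec 0 x); [| lra]. rewrite Rabs_pos_eq in hd by lra.
    apply (is_derive_ext_loc f); [| exact hd].
    apply filter_imp with (2 := tends_gt _ _ 0 (tends_id x) h). intros z hz.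
    rewrite Rabs_pos_eq; [reflexivity | lra].
Qed.

Lemma odd_derive (f : R -> R) (k r x l : R) :
  0 < r -> (forall z, z <= r -> f z = k * z) ->
  is_derive f (Rabs x) l -> is_derive (odd_ext f) x l.
Proof.
  intros hr hf hd. destruct (Rtotal_order x 0) as [h | [-> | h]].
  - rewrite Rabs_left in hd by assumption.
    apply (is_derive_ext_loc (fun z => - f (- z))).
    + apply filter_imp with (2 := tends_lt _ _ 0 (tends_id x) h). intros z hz.
      unfold odd_ext. destruct (Rle_dec 0 z); [lra | reflexivity].
    + replace l with (- (-1 * l)) by ring.
      apply (is_derive_opp (fun z => f (- z))).
      apply (is_derive_comp f (fun z => - z) x); [exact hd | exact (opp_derive x)].
  - rewrite Rabs_R0 in hd.
    apply (is_derive_ext_loc f); [| exact hd].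
    apply locally_R. exists r. split; [assumption |]. intros z hz.
    rewrite Rminus_0_r in hz. apply Rabs_def2 in hz.
    assert (q : f z = - f (- z)) by (rewrite !hf by lra; ring).
    unfold odd_ext. destruct (Rle_dec 0 z); [reflexivity | exact q].
  - rewrite Rabs_pos_eq in hd by lra.
    apply (is_derive_ext_loc f); [| exact hd].
    apply filter_imp with (2 := tends_gt _ _ 0 (tends_id x) h). intros z hz.
    unfold odd_ext. destruct (Rle_dec 0 z); [reflexivity | lra].
Qed.

(** This treats both truncated infima that delimit the range of [c]; the last
    clause is how they are seen to be positive. *)
Lemma min_glb (a : R) (E : R -> Prop) : 0 < a -> (forall c, E c -> 0 < c) ->
  let m := real (Rbar_min a (Glb_Rbar E)) in
  m <= a /\ (forall c, c < m -> ~ E c) /\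
  (forall eps, 0 < eps -> (forall c, E c -> eps <= c) -> 0 < m).
Proof.
  intros ha hE. destruct (Glb_Rbar_correct E) as [hlb hglb].
  assert (h0 : Rbar_le 0 (Glb_Rbar E)).
  { apply hglb. intros c hc. simpl. apply Rlt_le, hE, hc. }
  destruct (Glb_Rbar E) as [g | |]; simpl in *; [| | contradiction].
  - split; [apply Rmin_l | split].
    + intros c hc k. specialize (hlb c k). simpl in hlb. pose proof (Rmin_r a g). lra.
    + intros eps he hle. apply Rmin_glb_lt; [assumption |].
      apply Rlt_le_trans with (1 := he). apply (hglb (Finite eps)). intros c hc. now apply hle.
  - split; [lra | split].
    + intros c hc k. exact (hlb c k).
    + intros _ _ _. exact ha.
Qed.

(** * Smooth fit in exponential coordinates *)

Lemma exp_le (x y : R) : x <= y -> exp x <= exp y.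
Proof. intros [h | ->]; [left; now apply exp_increasing | right; reflexivity]. Qed.

Lemma sinh_pos (x : R) : 0 < x -> 0 < sinh x.
Proof. intros hx. rewrite <- sinh_0. now apply sinh_lt. Qed.

Lemma sinh_minus (x y : R) :
  sinh (x - y) = (exp x * exp (- y) - exp y * exp (- x)) / 2.
Proof.
  unfold sinh. rewrite <- !exp_plus. f_equal. f_equal; f_equal; ring.
Qed.

Lemma cosh_minus (x y : R) :
  cosh (x - y) = (exp x * exp (- y) + exp y * exp (- x)) / 2.
Proof.
  unfold cosh. rewrite <- !exp_plus. f_equal. f_equal; f_equal; ring.
Qed.

Lemma sinh_cont (x : R) : continuous sinh x.
Proof.
  apply (ex_derive_continuous sinh). eexists. apply is_derive_Reals, derivable_pt_lim_sinh.
Qed.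

Lemma cosh_cont (x : R) : continuous cosh x.
Proof.
  apply (ex_derive_continuous cosh). eexists. apply is_derive_Reals, derivable_pt_lim_cosh.
Qed.

(** Two functions that move with rates [exp (- s x) * k x] and
    [- exp (s x) * k x], [k >= 0], are comparable up to the extreme values of
    the ratio [exp (2 s x)] of the rates. *)
Lemma exp_pair_compare (s : R) (p n k : R -> R) (a b : R) :
  0 < s -> a <= b ->
  (forall x, a <= x <= b -> is_derive p x (exp (- (s * x)) * k x)) ->
  (forall x, a <= x <= b -> is_derive n x (- (exp (s * x) * k x))) ->
  (forall x, a <= x <= b -> 0 <= k x) ->
  exp (2 * s * a) * (p b - p a) <= n a - n b <= exp (2 * s * b) * (p b - p a).
Proof.
  intros hs hab hp hn hk.
  assert (key : forall z x, exp (2 * s * z) * (exp (- (s * x)) * k x) - exp (s * x) * k x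
     = exp (s * x) * k x * (exp (2 * s * (z - x)) - 1)).
  { intros z x. replace (2 * s * z) with (2 * s * (z - x) + (s * x + s * x)) by ring.
    rewrite exp_Ropp, !exp_plus. field. apply Rgt_not_eq, exp_pos. }
  assert (mon : forall z, (forall x, a <= x <= b ->
      is_derive (fun x => exp (2 * s * z) * p x + n x) x
        (exp (s * x) * k x * (exp (2 * s * (z - x)) - 1)))).
  { intros z x hx. rewrite <- key.
    apply (is_derive_plus (fun x => exp (2 * s * z) * p x) n).
    - apply (is_derive_scal p x (exp (2 * s * z)) (exp (- (s * x)) * k x)). now apply hp.
    - now apply hn. }
  split.
  - assert (exp (2 * s * a) * p b + n b <= exp (2 * s * a) * p a + n a); [| lra].
    apply (decr_le (fun x => exp (2 * s * a) * p x + n x) _ a b hab (mon a)).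
    intros x hx. specialize (hk x hx). pose proof (exp_pos (s * x)).
    assert (exp (2 * s * (a - x)) <= exp 0) as h0 by (apply exp_le; nra).
    rewrite exp_0 in h0. assert (0 <= exp (s * x) * k x) by nra. nra.
  - assert (exp (2 * s * b) * p a + n a <= exp (2 * s * b) * p b + n b); [| lra].
    apply (incr_le (fun x => exp (2 * s * b) * p x + n x) _ a b hab (mon b)).
    intros x hx. specialize (hk x hx). pose proof (exp_pos (s * x)).
    assert (exp 0 <= exp (2 * s * (b - x))) as h0 by (apply exp_le; nra).
    rewrite exp_0 in h0. assert (0 <= exp (s * x) * k x) by nra. nra.
Qed.

Section FreeBoundary.

Context (s delta mu phi : R).

Definition beta : R := delta - mu.
(** [s ^ 2 / 2 * w x] is the value of [v'' / 2 + lambda * x ^ 2 - alpha * v] for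
    the left payoff [v = delta * x ^ 2]; [Win] and [Wout] play this part for the
    right payoff, which changes its formula at [x = phi + c]: the inner regime is
    [x <= phi + c], the outer one [phi + c <= x]. *)
Definition w (x : R) : R := 2 * delta / s ^ 2 - beta * x ^ 2.
(** Relative to the particular solution [mu * x ^ 2 + 2 * mu / s ^ 2] of
    [v'' / 2 + lambda * x ^ 2 = alpha * v], the solution that meets the left payoff
    at [x] with the same slope is
    [t -> P x * exp (s * t) + N x * exp (- (s * t))]. *)
Definition P (x : R) : R :=
  exp (- (s * x)) / 2 * (beta * x ^ 2 + 2 * beta * x / s - 2 * mu / s ^ 2).
Definition N (x : R) : R :=
  exp (s * x) / 2 * (beta * x ^ 2 - 2 * beta * x / s - 2 * mu / s ^ 2).

(** At [xc c] the left and the right payoff cross. *)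
Definition xc (c : R) : R := 1 / (2 * delta) + c / 2.
Definition Win (x c : R) : R := w x + 2 * delta * c * (x - xc c).
Definition Pin (x c : R) : R :=
  P x - delta * c / s * exp (- (s * x)) * (1 + s * (x - xc c)).
Definition Nin (x c : R) : R :=
  N x + delta * c / s * exp (s * x) * (1 - s * (x - xc c)).

Definition Wout (x c : R) : R := c * (2 * mu * x - mu * c - 1).
Definition Pout (x c : R) : R :=
  c / (2 * s) * exp (- (s * x)) * (s * (1 + mu * c - 2 * mu * x) - 2 * mu).
Definition Nout (x c : R) : R :=
  c / (2 * s) * exp (s * x) * (s * (1 + mu * c - 2 * mu * x) + 2 * mu)
  - 2 * beta * phi / s * exp (s * (phi + c)).

Context (s_pos : 0 < s) (mu_pos : 0 < mu) (mu_lt : mu < delta)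
  (phi_pos : 0 < phi)
  (phi_root : s ^ 2 * beta * phi ^ 2 + 2 * s * beta * phi = 2 * mu)
  (phi_large : 1 < 2 * mu * phi).

Lemma beta_pos : 0 < beta.
Proof. unfold beta. lra. Qed.

Lemma delta_pos : 0 < delta.
Proof. lra. Qed.

Lemma P_derive (x : R) : is_derive P x (exp (- (s * x)) * (s / 2 * w x)).
Proof.
  unfold P, w, beta. auto_derive; [lra |]. field. lra.
Qed.

Lemma N_derive (x : R) : is_derive N x (- (exp (s * x) * (s / 2 * w x))).
Proof.
  unfold N, w, beta. auto_derive; [lra |]. field. lra.
Qed.

Lemma Pin_derive (x c : R) :
  is_derive (fun z => Pin z c) x (exp (- (s * x)) * (s / 2 * Win x c)).
Proof.
  pose proof delta_pos.
  unfold Pin, P, Win, w, beta, xc. auto_derive; [lra |]. field. lra.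
Qed.

Lemma Nin_derive (x c : R) :
  is_derive (fun z => Nin z c) x (- (exp (s * x) * (s / 2 * Win x c))).
Proof.
  pose proof delta_pos.
  unfold Nin, N, Win, w, beta, xc. auto_derive; [lra |]. field. lra.
Qed.

Lemma Pout_derive (x c : R) :
  is_derive (fun z => Pout z c) x (exp (- (s * x)) * (s / 2 * Wout x c)).
Proof. unfold Pout, Wout. auto_derive; [lra |]. field. lra. Qed.

Lemma Nout_derive (x c : R) :
  is_derive (fun z => Nout z c) x (- (exp (s * x) * (s / 2 * Wout x c))).
Proof. unfold Nout, Wout. auto_derive; [lra |]. field. lra. Qed.

Lemma Pout_Pin (c : R) : Pout (phi + c) c = Pin (phi + c) c.
Proof.
  pose proof delta_pos.
  assert (e : 2 * mu / s ^ 2 = beta * phi ^ 2 + 2 * beta * phi / s).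
  { rewrite <- phi_root. field. lra. }
  unfold Pout, Pin, P, xc. rewrite e. unfold beta. field. lra.
Qed.

Lemma Nout_Nin (c : R) : Nout (phi + c) c = Nin (phi + c) c.
Proof.
  pose proof delta_pos.
  assert (e : 2 * mu / s ^ 2 = beta * phi ^ 2 + 2 * beta * phi / s).
  { rewrite <- phi_root. field. lra. }
  unfold Nout, Nin, N, xc. rewrite e. unfold beta. field. lra.
Qed.

Lemma P_phi : P phi = 0.
Proof.
  unfold P. replace (beta * phi ^ 2 + 2 * beta * phi / s - 2 * mu / s ^ 2) with 0; [ring |].
  rewrite <- phi_root. field. lra.
Qed.

Lemma P_0 : P 0 = - (mu / s ^ 2).
Proof. unfold P. replace (- (s * 0)) with 0 by ring. rewrite exp_0. field. lra. Qed.

Lemma w_phi : 0 < w phi.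
Proof.
  pose proof beta_pos.
  replace (w phi) with (2 * beta / s ^ 2 + 2 * beta * phi / s).
  - assert (0 < beta * phi) by nra. assert (0 < s ^ 2) by nra.
    apply Rplus_lt_0_compat; apply Rdiv_lt_0_compat; lra.
  - unfold w. replace (2 * delta) with (2 * beta + 2 * mu) by (unfold beta; ring).
    rewrite <- phi_root. field. lra.
Qed.

Lemma w_decr (x y : R) : 0 <= x -> x <= y -> w y <= w x.
Proof.
  intros hx hxy. pose proof beta_pos. unfold w. assert (x ^ 2 <= y ^ 2) by nra. nra.
Qed.

Lemma w_pos (x : R) : 0 <= x <= phi -> 0 < w x.
Proof. intros hx. pose proof w_phi. pose proof (w_decr x phi). lra. Qed.

(** A lower bound of [P'] on [[0, phi]], where both of its factors decrease. *)
Definition pslope : R := s / 2 * exp (- (s * phi)) * w phi.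

Lemma pslope_pos : 0 < pslope.
Proof.
  unfold pslope. pose proof w_phi. pose proof (exp_pos (- (s * phi))).
  apply Rmult_lt_0_compat; [nra | assumption].
Qed.

Lemma P_expand (x y : R) : 0 <= x -> x <= y -> y <= phi -> pslope * (y - x) <= P y - P x.
Proof.
  intros hx hxy hy.
  destruct (mvt P _ x y hxy (fun z _ => P_derive z)) as [z [hz ->]].
  apply Rmult_le_compat_r; [lra |].
  unfold pslope.
  assert (exp (- (s * phi)) <= exp (- (s * z))) by (apply exp_le; nra).
  pose proof (w_decr z phi ltac:(lra) ltac:(lra)). pose proof w_phi.
  pose proof (exp_pos (- (s * phi))).
  assert (exp (- (s * phi)) * w phi <= exp (- (s * z)) * w z) by (apply Rmult_le_compat; lra).
  nra.
Qed.

Lemma P_incr (x y : R) : 0 <= x -> x < y -> y <= phi -> P x < P y.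
Proof.
  intros hx hxy hy. pose proof (P_expand x y hx ltac:(lra) hy). pose proof pslope_pos. nra.
Qed.

Lemma P_le (x y : R) : 0 <= x <= phi -> 0 <= y <= phi -> P x <= P y -> x <= y.
Proof.
  intros hx hy h. destruct (Rle_lt_dec x y) as [| hl]; [assumption |].
  pose proof (P_incr y x ltac:(lra) hl ltac:(lra)). lra.
Qed.

Lemma N_compare (x y : R) : 0 <= x -> x <= y -> y <= phi ->
  exp (2 * s * x) * (P y - P x) <= N x - N y <= exp (2 * s * y) * (P y - P x).
Proof.
  intros hx hxy hy.
  apply (exp_pair_compare s P N (fun x => s / 2 * w x)); auto.
  - intros z _. apply P_derive.
  - intros z _. apply N_derive.
  - intros z hz. pose proof (w_pos z). nra.
Qed.

(** By [phi > 1 / (2 * mu)], as the difference to [w phi] is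
    [c * (2 * mu * phi - 1) + mu * c ^ 2]. *)
Lemma Win_corner (c : R) : 0 <= c -> 0 < Win (phi + c) c.
Proof.
  intros hc. pose proof w_phi. pose proof delta_pos.
  replace (Win (phi + c) c) with (w phi + c * (2 * mu * phi - 1) + mu * c ^ 2).
  - nra.
  - unfold Win, w, beta, xc. field. lra.
Qed.

Lemma Wout_nonneg (x c : R) : 0 <= c -> phi + c <= x -> 0 <= Wout x c.
Proof. intros hc hx. unfold Wout. apply Rmult_le_pos; nra. Qed.

(** [Win] is a concave quadratic polynomial that is positive at [phi + c]. *)
Lemma Win_pos_after (x y c : R) :
  0 <= c -> x < y -> y <= phi + c -> 0 <= Win x c -> 0 < Win y c.
Proof.
  intros hc hxy hy hx. pose proof (Win_corner c hc) as h0. pose proof beta_pos as hb.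
  destruct (Req_dec y (phi + c)) as [-> | hne]; [assumption |].
  set (z := phi + c) in *.
  assert (id : Win y c * (z - x) = Win x c * (z - y) + Win z c * (y - x)
                 + beta * (y - x) * (z - y) * (z - x)).
  { unfold Win, w, xc. ring. }
  assert (0 < Win y c * (z - x)); [| nra].
  rewrite id. assert (0 <= Win x c * (z - y)) by (apply Rmult_le_pos; lra).
  assert (0 < Win z c * (y - x)) by (apply Rmult_lt_0_compat; lra).
  assert (0 <= beta * (y - x) * (z - y) * (z - x)) by (repeat apply Rmult_le_pos; lra).
  lra.
Qed.

(** ** The corner [x = phi + c] *)

(** The corner value lies in the range of [P] on [[0, phi]], so that a left
    boundary corresponds to it. *)
Lemma Pin_corner (c : R) : 0 <= c ->
  P 0 <= Pin (phi + c) c <= 0.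
Proof.
  intros hc. pose proof beta_pos. rewrite <- Pout_Pin, P_0. unfold Pout.
  set (E := exp (- (s * (phi + c)))). assert (hE : 0 < E) by apply exp_pos.
  set (D := 2 * mu * s * phi - s + mu * (s * c) + 2 * mu).
  assert (hD : 0 < D).
  { unfold D. assert (0 < s * (2 * mu * phi - 1)) by (apply Rmult_lt_0_compat; lra).
    assert (0 <= mu * (s * c)) by (repeat apply Rmult_le_pos; lra). nra. }
  replace (c / (2 * s) * E * (s * (1 + mu * c - 2 * mu * (phi + c)) - 2 * mu))
    with (- (c * E * D / (2 * s))) by (unfold D; field; lra).
  assert (hc0 : 0 <= c * E * D / (2 * s)).
  { apply Rdiv_le_0_compat; [| lra]. repeat apply Rmult_le_pos; lra. }
  split; [| lra].
  assert (c * E * D / (2 * s) <= mu / s ^ 2); [| lra].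
    (* with t = s c and a = s phi the claim is
       t (2 mu (1 + a) + mu t - s) <= 2 mu exp (a + t) *)
    assert (hx : (s * c) * D <= 2 * mu * exp (s * (phi + c))).
    { set (t := s * c). set (a := s * phi).
      assert (ht : 0 <= t) by (apply Rmult_le_pos; lra).
      assert (ha : 0 < a) by (apply Rmult_lt_0_compat; lra).
      replace (s * (phi + c)) with (a + t) by (unfold a, t; ring).
      rewrite exp_plus.
      assert (e1 : 1 + a <= exp a) by (left; apply exp_ineq1; lra).
      assert (e2 : 1 + t + t ^ 2 / 2 <= exp t).
      { assert (hm : forall x, is_derive (fun x => exp x - (1 + x + x ^ 2 / 2)) x
                   (exp x - (1 + x))).
        { intros x. auto_derive; [exact I | field]. }
        assert (exp 0 - (1 + 0 + 0 ^ 2 / 2) <= exp t - (1 + t + t ^ 2 / 2)).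
        { apply (incr_le (fun x => exp x - (1 + x + x ^ 2 / 2)) _ 0 t ht (fun x _ => hm x)).
          intros x hx. pose proof (exp_ineq1_le x). lra. }
        rewrite exp_0 in *. lra. }
      assert (D <= mu * (2 + 2 * a + t)) by (unfold D, a, t; nra).
      assert (t * D <= mu * (t * (2 + 2 * a + t))) by nra.
      assert (t * (2 + 2 * a + t) <= 2 * (exp a * exp t)); [| nra].
      assert ((1 + a) * (1 + t + t ^ 2 / 2) <= exp a * exp t)
        by (apply Rmult_le_compat; nra).
      nra. }
    apply Rmult_le_reg_r with (2 * s ^ 2); [nra |].
    replace (mu / s ^ 2 * (2 * s ^ 2)) with (2 * mu) by (field; lra).
    replace (c * E * D / (2 * s) * (2 * s ^ 2)) with ((s * c * D) * E) by (field; lra).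
    replace (2 * mu) with (2 * mu * exp (s * (phi + c)) * E).
    + apply Rmult_le_compat_r; lra.
    + unfold E. rewrite exp_Ropp. field. apply Rgt_not_eq, exp_pos.
Qed.

(** Between the corner and a tangency point in the outer regime [Nout] falls by at
    least [exp (2 * s * (phi + c))] times the growth of [Pout], while the
    corresponding factor for [N] and [P] on [[0, phi]] is at most
    [exp (2 * s * phi)]. *)
Lemma corner_nonneg (x c a b : R) :
  0 <= c -> phi + c <= x -> 0 <= a <= phi -> 0 <= b <= phi ->
  P a = Pout x c -> N a = Nout x c -> P b = Pin (phi + c) c ->
  0 <= Nin (phi + c) c - N b.
Proof.
  intros hc hx ha hb e1 e2 e3. rewrite <- Nout_Nin, <- Pout_Pin in *.
  assert (cmp := exp_pair_compare s (fun z => Pout z c) (fun z => Nout z c)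
    (fun z => s / 2 * Wout z c) (phi + c) x s_pos hx (fun z _ => Pout_derive z c)
    (fun z _ => Nout_derive z c)).
  destruct cmp as [cmp _].
  { intros z hz. pose proof (Wout_nonneg z c hc ltac:(lra)). nra. }
  assert (hinc : Pout (phi + c) c <= Pout x c).
  { apply (incr_le (fun z => Pout z c) _ _ _ hx (fun z _ => Pout_derive z c)).
    intros z hz. apply Rmult_le_pos; [left; apply exp_pos |].
    pose proof (Wout_nonneg z c hc ltac:(lra)). nra. }
  rewrite <- e1, <- e2, <- e3 in *.
  assert (hba : b <= a) by (apply P_le; auto).
  pose proof (N_compare b a ltac:(lra) hba ltac:(lra)) as [_ cmp2].
  assert (exp (2 * s * a) <= exp (2 * s * (phi + c))) by (apply exp_le; nra).
  assert (exp (2 * s * a) * (P a - P b) <= exp (2 * s * (phi + c)) * (P a - P b))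
    by (apply Rmult_le_compat_r; lra).
  lra.
Qed.

(** Eliminating the left boundary through [P a = Pin x c], the remaining
    equation in [x] has a strictly decreasing left-hand side. *)
Lemma reduced_decr (x y c a b : R) :
  x < y -> (forall z, x <= z <= y -> 0 < Win z c) ->
  0 <= a <= phi -> 0 <= b <= phi -> P a = Pin x c -> P b = Pin y c -> b < x ->
  Nin y c - N b < Nin x c - N a.
Proof.
  intros hxy hW ha hb e1 e2 hbx.
  assert (cmp := exp_pair_compare s (fun z => Pin z c) (fun z => Nin z c)
    (fun z => s / 2 * Win z c) x y s_pos ltac:(lra) (fun z _ => Pin_derive z c)
    (fun z _ => Nin_derive z c)).
  destruct cmp as [cmp _].
  { intros z hz. specialize (hW z hz). nra. }
  assert (hinc : Pin x c < Pin y c).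
  { apply (incr_lt (fun z => Pin z c) _ _ _ hxy (fun z _ => Pin_derive z c)).
    intros z hz. apply Rmult_lt_0_compat; [apply exp_pos |]. specialize (hW z hz). nra. }
  rewrite <- e1, <- e2 in *.
  assert (hab : a <= b) by (apply P_le; auto; lra).
  pose proof (N_compare a b ltac:(lra) hab ltac:(lra)) as [_ cmp2].
  assert (exp (2 * s * b) < exp (2 * s * x)) by (apply exp_increasing; nra).
  assert (exp (2 * s * b) * (P b - P a) < exp (2 * s * x) * (P b - P a))
    by (apply Rmult_lt_compat_r; lra).
  lra.
Qed.


(** * A maximum principle and the case without intervention *)

(** A maximum principle for [u'' = s ^ 2 * u + k] with [k] changing sign once,
    from plus to minus: [T = u' sinh - s u cosh] is then unimodal, hence
    nonnegative by its end values, so that [u / sinh] increases. *)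
Lemma max_principle (u u' k : R -> R) (a m b : R) :
  a < b ->
  (forall x, a <= x <= b -> is_derive u x (u' x)) ->
  (forall x, a <= x <= b -> is_derive u' x (s ^ 2 * u x + k x)) ->
  (forall x, a <= x <= b -> x <= m -> 0 <= k x) ->
  (forall x, a <= x <= b -> m <= x -> k x <= 0) ->
  u a <= 0 -> u b <= 0 -> (m < b -> 0 <= u' b) ->
  forall x, a <= x <= b -> u x <= 0.
Proof.
  intros hab hu hu' k1 k2 ha hb hb' x hx.
  set (T := fun x => u' x * sinh (s * (x - a)) - s * u x * cosh (s * (x - a))).
  assert (hT : forall z, a <= z <= b -> is_derive T z (k z * sinh (s * (z - a)))).
  { intros z hz. pose proof (hu z hz) as d1. pose proof (hu' z hz) as d2.
    unfold T. auto_derive.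
    - repeat split; eexists; eassumption.
    - derive_value u z d1.
      replace (Derive (fun x => u' x) z) with (s ^ 2 * u z + k z)
        by (symmetry; apply (is_derive_unique u'); exact d2).
      change (z + - a) with (z - a). ring. }
  assert (sh : forall z, a <= z -> 0 <= sinh (s * (z - a))).
  { intros z hz. destruct (Req_dec z a) as [-> | hne].
    - rewrite Rminus_diag, Rmult_0_r, sinh_0. lra.
    - apply Rlt_le, sinh_pos, Rmult_lt_0_compat; lra. }
  assert (ch : forall z, 0 < cosh z).
  { intros z. unfold cosh. pose proof (exp_pos z). pose proof (exp_pos (- z)). lra. }
  assert (Ta : 0 <= T a).
  { unfold T. rewrite Rminus_diag, Rmult_0_r, sinh_0, cosh_0. nra. }
  assert (Tpos : forall z, a <= z <= b -> 0 <= T z).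
  { intros z hz. destruct (Rle_lt_dec z m) as [hm | hm].
    - apply Rle_trans with (1 := Ta).
      apply (incr_le T _ a z ltac:(lra) (fun t ht => hT t ltac:(lra))).
      intros t ht. apply Rmult_le_pos; [apply k1; lra | apply sh; lra].
    - apply Rle_trans with (T b).
      + unfold T. pose proof (sh b ltac:(lra)). pose proof (ch (s * (b - a))).
        specialize (hb' ltac:(lra)).
        assert (0 <= u' b * sinh (s * (b - a))) by now apply Rmult_le_pos.
        assert (0 <= s * - u b * cosh (s * (b - a))).
        { apply Rmult_le_pos; [apply Rmult_le_pos; lra | lra]. }
        lra.
      + apply (decr_le T _ z b ltac:(lra) (fun t ht => hT t ltac:(lra))).
        intros t ht. pose proof (k2 t ltac:(lra) ltac:(lra)). pose proof (sh t ltac:(lra)). nra. }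
  destruct (Req_dec x a) as [-> | hne]; [assumption |].
  assert (shp : forall z, a < z -> 0 < sinh (s * (z - a))).
  { intros z hz. apply sinh_pos, Rmult_lt_0_compat; lra. }
  assert (hq : u x / sinh (s * (x - a)) <= u b / sinh (s * (b - a))).
  { apply (incr_le (fun z => u z / sinh (s * (z - a)))
      (fun z => T z / (sinh (s * (z - a))) ^ 2) x b ltac:(lra)).
    - intros z hz. pose proof (hu z ltac:(lra)) as d1. pose proof (shp z ltac:(lra)).
      auto_derive.
      + repeat split; [eexists; eassumption |]. change (z + - a) with (z - a). lra.
      + derive_value u z d1.
        change (z + - a) with (z - a). unfold T. field. lra.
    - intros z hz. pose proof (shp z ltac:(lra)). pose proof (Tpos z ltac:(lra)).
      apply Rdiv_le_0_compat; [assumption | nra]. }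
  pose proof (shp x ltac:(lra)) as p1. pose proof (shp b ltac:(lra)) as p2.
  assert (u b / sinh (s * (b - a)) <= 0).
  { apply Rmult_le_reg_r with (1 := p2). unfold Rdiv. rewrite Rmult_assoc, Rinv_l by lra. lra. }
  assert (hx0 : u x / sinh (s * (x - a)) <= 0) by lra.
  replace (u x) with (u x / sinh (s * (x - a)) * sinh (s * (x - a))) by (field; lra). nra.
Qed.

(** [U] is the value on [z >= 0] of pure stopping against [delta * x ^ 2]; it
    follows the payoff up to [phi] and [tail] beyond. *)
Definition tail (z : R) : R :=
  2 * mu / s ^ 2 + mu * z ^ 2 - 2 * beta * phi / s * (exp (s * phi) * exp (- (s * z))).
Definition dtail (z : R) : R := 2 * mu * z + 2 * beta * phi * (exp (s * phi) * exp (- (s * z))).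
Definition ddtail (z : R) : R := 2 * mu - 2 * beta * phi * s * (exp (s * phi) * exp (- (s * z))).

Definition U (z : R) : R := if Rle_dec z phi then delta * z ^ 2 else tail z.
Definition dU (z : R) : R := if Rle_dec z phi then 2 * delta * z else dtail z.

Lemma tail_derive (z : R) : is_derive tail z (dtail z).
Proof. unfold tail, dtail. auto_derive; [exact I |]. field. lra. Qed.

Lemma dtail_derive (z : R) : is_derive dtail z (ddtail z).
Proof. unfold dtail, ddtail. auto_derive; [exact I |]. ring. Qed.

Lemma exp_phi_inv : exp (s * phi) * exp (- (s * phi)) = 1.
Proof. rewrite <- exp_plus, Rplus_opp_r. apply exp_0. Qed.

Lemma tail_phi : tail phi = delta * phi ^ 2.
Proof.
  unfold tail. rewrite exp_phi_inv, <- phi_root. unfold beta. field. lra.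
Qed.

Lemma dtail_phi : dtail phi = 2 * delta * phi.
Proof. unfold dtail. rewrite exp_phi_inv. unfold beta. ring. Qed.

Lemma U_left (z : R) : z <= phi -> U z = delta * z ^ 2.
Proof. intros hz. unfold U. destruct (Rle_dec z phi); [reflexivity | lra]. Qed.

Lemma U_right (z : R) : phi <= z -> U z = tail z.
Proof.
  intros hz. unfold U. destruct (Rle_dec z phi); [| reflexivity].
  replace z with phi by lra. now rewrite tail_phi.
Qed.

Lemma dU_left (z : R) : z <= phi -> dU z = 2 * delta * z.
Proof. intros hz. unfold dU. destruct (Rle_dec z phi); [reflexivity | lra]. Qed.

Lemma dU_right (z : R) : phi <= z -> dU z = dtail z.
Proof.
  intros hz. unfold dU. destruct (Rle_dec z phi); [| reflexivity].
  replace z with phi by lra. now rewrite dtail_phi.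
Qed.

Lemma U_derive (z : R) : is_derive U z (dU z).
Proof.
  apply is_derive_dwithin.
  apply (dwithin_cover3 _ (fun y => y <= phi) (fun y => phi <= y) (fun _ => False)
    U (fun y => delta * y ^ 2) tail tail).
  - intros y _. destruct (Rle_lt_dec y phi).
    + left. split; [assumption | now apply U_left].
    + right; left. split; [lra | apply U_right; lra].
  - destruct (Rle_lt_dec z phi) as [h | h].
    + left. split; [now apply U_left |]. apply dwithin_weaken. rewrite dU_left by assumption.
      auto_derive; [exact I | ring].
    + right. apply filter_imp with (2 := locally_gt z phi h). intros y hy _. lra.
  - destruct (Rle_lt_dec phi z) as [h | h].
    + left. split; [now apply U_right |]. apply dwithin_weaken. rewrite dU_right by assumption.
      apply tail_derive.
    + right. apply filter_imp with (2 := locally_lt z phi h). intros y hy _. lra.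
  - right. apply filter_forall. tauto.
Qed.

Lemma dU_cont (z : R) : continuous dU z.
Proof.
  apply (tends_cover3 (locally z) (fun y => y <= phi) (fun y => phi <= y) (fun _ => False)
    dU (fun y => 2 * delta * y) dtail dtail).
  - apply filter_forall. intros y. destruct (Rle_lt_dec y phi).
    + left. split; [assumption | now apply dU_left].
    + right; left. split; [lra | apply dU_right; lra].
  - destruct (Rle_lt_dec z phi) as [h | h].
    + apply tends_within; [apply locally_filter |]. rewrite dU_left by assumption. tends_auto.
    + apply tends_within_empty; [apply locally_filter |].
      apply filter_imp with (2 := locally_gt z phi h). intros y hy. lra.
  - destruct (Rle_lt_dec phi z) as [h | h].
    + apply tends_within; [apply locally_filter |]. rewrite dU_right by assumption.
      apply (ex_derive_continuous dtail). eexists. apply dtail_derive.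
    + apply tends_within_empty; [apply locally_filter |].
      apply filter_imp with (2 := locally_lt z phi h). intros y hy. lra.
  - apply tends_within_empty; [apply locally_filter |]. apply filter_forall. tauto.
Qed.

Lemma U_cont (z : R) : continuous U z.
Proof. apply (ex_derive_continuous U). eexists. apply U_derive. Qed.

Lemma tail_exp_bound (z : R) : phi <= z -> 0 < exp (s * phi) * exp (- (s * z)) <= 1.
Proof.
  intros hz. rewrite <- exp_plus. split; [apply exp_pos |].
  rewrite <- exp_0. apply exp_le. nra.
Qed.

Lemma U_nonneg (z : R) : 0 <= U z.
Proof.
  pose proof beta_pos as hbe. pose proof delta_pos as hdel.
  destruct (Rle_lt_dec z phi) as [h | h].
  - rewrite U_left by assumption. nra.
  - rewrite U_right by lra. unfold tail. pose proof (tail_exp_bound z ltac:(lra)) as hE.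
    set (E := exp (s * phi) * exp (- (s * z))) in *.
    assert (hk : 0 < 2 * beta * phi / s) by (apply Rdiv_lt_0_compat; nra).
    replace (2 * mu / s ^ 2) with (beta * phi ^ 2 + 2 * beta * phi / s)
      by (rewrite <- phi_root; field; lra).
    assert (2 * beta * phi / s * E <= 2 * beta * phi / s * 1) by (apply Rmult_le_compat_l; lra).
    assert (0 <= beta * phi ^ 2) by nra. assert (0 <= mu * z ^ 2) by nra. lra.
Qed.

Lemma dU_bounds (z : R) : 0 <= z -> 0 <= dU z <= 2 * delta * z.
Proof.
  intros hz. pose proof beta_pos as hbe. pose proof delta_pos as hdel.
  destruct (Rle_lt_dec z phi) as [h | h].
  - rewrite dU_left by assumption. nra.
  - rewrite dU_right by lra. unfold dtail. pose proof (tail_exp_bound z ltac:(lra)) as hE.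
    set (E := exp (s * phi) * exp (- (s * z))) in *.
    assert (hk : 0 < 2 * beta * phi) by nra.
    assert (0 < 2 * beta * phi * E <= 2 * beta * phi) by nra.
    assert (2 * beta * phi <= 2 * beta * z) by nra.
    replace (2 * delta * z) with (2 * mu * z + 2 * beta * z) by (unfold beta; ring). nra.
Qed.

Lemma U_le (z : R) : 0 <= z -> U z <= delta * z ^ 2.
Proof.
  intros hz.
  assert (delta * 0 ^ 2 - U 0 <= delta * z ^ 2 - U z) as h.
  { apply (incr_le (fun y => delta * y ^ 2 - U y) (fun y => 2 * delta * y - dU y) 0 z hz).
    - intros y _. apply (is_derive_minus (fun y => delta * y ^ 2) U); [| apply U_derive].
      auto_derive; [exact I | ring].
    - intros y hy. pose proof (dU_bounds y ltac:(lra)). lra. }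
  rewrite (U_left 0) in h by lra. lra.
Qed.


Lemma x0_lt_phi : 1 / (2 * delta) < phi.
Proof.
  apply Rmult_lt_reg_l with (2 * delta); [lra |]. field_simplify; [nra | lra].
Qed.

(** As [c] decreases to [0] the point [b] tends to [phi], and to first order the
    difference is [- 2 * delta * c * exp (s * phi) * (phi - 1 / (2 * delta))]. *)
Lemma corner_neg :
  locally 0 (fun c => forall b, 0 < c -> 0 <= b <= phi -> P b = Pin (phi + c) c ->
    Nin (phi + c) c - N b < 0).
Proof.
  pose proof delta_pos as hdel. pose proof pslope_pos as hps. pose proof x0_lt_phi as hx0.
  set (u := fun c => phi + c - xc c).
  assert (l1 : locally 0 (fun c => (c - Pin (phi + c) c / pslope) * (1 + s * u c) - u c < 0)).
  { assert (e0 : Pin (phi + 0) 0 = 0).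
    { unfold Pin. rewrite Rplus_0_r, P_phi. field. lra. }
    apply tends_lt with
      (a := (0 - Pin (phi + 0) 0 / pslope) * (1 + s * u 0) - u 0).
    - apply (ex_derive_continuous (fun c => (c - Pin (phi + c) c / pslope) * (1 + s * u c) - u c)).
      unfold Pin, P, u, xc. auto_derive. repeat split; lra.
    - rewrite e0. unfold u, xc, Rdiv. rewrite Rmult_0_l. lra. }
  assert (l2 : locally 0 (fun c => 0 < w (phi + c))).
  { apply tends_gt with (a := w (phi + 0)).
    - apply (ex_derive_continuous (fun c => w (phi + c))).
      unfold w, beta. auto_derive. exact I.
    - rewrite Rplus_0_r. apply w_phi. }
  apply filter_imp with (2 := filter_and _ _ l1 l2).
  intros c [k1 k2] b hc hb e.
  set (x := phi + c) in *.
  assert (hw : forall z, b <= z <= x -> 0 <= s / 2 * w z).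
  { intros z hz. pose proof (w_decr z x ltac:(lra) ltac:(lra)). nra. }
  assert (hbx : b <= x) by (unfold x; lra).
  destruct (exp_pair_compare s P N (fun z => s / 2 * w z) b x s_pos hbx
    (fun z _ => P_derive z) (fun z _ => N_derive z) hw) as [cmp _].
  assert (hu : 0 < u c) by (unfold u, xc; lra).
  assert (hdist : phi - b <= - Pin x c / pslope).
  { pose proof (P_expand b phi ltac:(lra) ltac:(lra) ltac:(lra)) as h.
    rewrite P_phi, e in h. apply Rmult_le_reg_l with (1 := hps).
    replace (pslope * (- Pin x c / pslope)) with (- Pin x c) by (field; lra). lra. }
  assert (hsmall : (x - b) * (1 + s * u c) < u c).
  { apply Rle_lt_trans with ((c - Pin x c / pslope) * (1 + s * u c)); [| lra].
    apply Rmult_le_compat_r; [nra |]. unfold x in *. lra. }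
  rewrite e in cmp. unfold Pin in cmp. unfold Nin. fold (u c) in *.
  replace (x - xc c) with (u c) in * by reflexivity.
  assert (hk : 0 < delta * c / s) by (apply Rdiv_lt_0_compat; nra).
  set (k := delta * c / s) in *.
  assert (hE : exp (2 * s * b) * (k * exp (- (s * x)) * (1 + s * u c)) <= N b - N x).
  { eapply Rle_trans; [| exact cmp]. right. ring. }
  assert (hexp : exp (2 * s * b) * exp (- (s * x)) = exp (s * x) * exp (- (2 * s * (x - b)))).
  { rewrite <- !exp_plus. f_equal. ring. }
  assert (hlin : 1 - 2 * s * (x - b) <= exp (- (2 * s * (x - b)))).
  { pose proof (exp_ineq1_le (- (2 * s * (x - b)))). lra. }
  assert (hkey : (1 - s * u c) < exp (- (2 * s * (x - b))) * (1 + s * u c)).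
  { apply Rlt_le_trans with ((1 - 2 * s * (x - b)) * (1 + s * u c)); [nra |].
    apply Rmult_le_compat_r; [nra | exact hlin]. }
  pose proof (exp_pos (s * x)) as hpx.
  assert (exp (2 * s * b) * (k * exp (- (s * x)) * (1 + s * u c))
    = k * exp (s * x) * (exp (- (2 * s * (x - b))) * (1 + s * u c))) as e1.
  { replace (exp (2 * s * b) * (k * exp (- (s * x)) * (1 + s * u c)))
      with (k * (exp (2 * s * b) * exp (- (s * x))) * (1 + s * u c)) by ring.
    rewrite hexp. ring. }
  assert (k * exp (s * x) * (1 - s * u c)
    < k * exp (s * x) * (exp (- (2 * s * (x - b))) * (1 + s * u c))).
  { apply Rmult_lt_compat_l; [apply Rmult_lt_0_compat; assumption | exact hkey]. }
  lra.
Qed.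

(** * The free boundaries *)

(** The condition [0 < Win b c] stands for [b] lying past the inflection point;
    unlike that one it is visibly stable under small changes of [(b, c)]. *)
Definition smooth_fit (a b c : R) : Prop :=
  0 < a /\ a < xc c /\ xc c < b /\ b < phi + c /\ a < phi /\ 0 < Win b c /\
  P a = Pin b c /\ N a = Nin b c.

(** What Cramer's rule gives for the derivatives of the two boundaries when the
    smooth-fit equations are differentiated in [c]. *)
Definition dF (a b c : R) : R :=
  2 * delta * (c + 1 / (2 * delta) - b) / (s * w a * sinh (s * (b - a))).
Definition dG (a b c : R) : R :=
  2 * delta / (s ^ 2 * Win b c)
  * (1 + s * (c + 1 / (2 * delta) - b) * cosh (s * (b - a)) / sinh (s * (b - a))).

(** The smooth-fit equations say that [w] integrates against
    [cosh (s * (b - x))] over [[a, b]] to [2 * delta * c / s ^ 2] and against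
    [sinh (s * (b - x))] to [2 * delta * c * (b - xc c) / s]; bounding the
    decreasing function [w] by its end values gives these estimates. *)
Lemma smooth_fit_estimates (a b c : R) : 0 < c -> smooth_fit a b c ->
  s * w b * sinh (s * (b - a)) <= 2 * delta * c /\
  2 * delta * c * (b - xc c) <= w a * (cosh (s * (b - a)) - 1).
Proof.
  intros hc [h1 [h2 [h3 [h4 [h5 [h6 [e1 e2]]]]]]]. pose proof delta_pos as hdel.
  assert (inv : exp (- (s * b)) * exp (s * b) = 1).
  { rewrite <- exp_plus. replace (- (s * b) + s * b) with 0 by ring. apply exp_0. }
  assert (eP : exp (s * b) * (P b - P a) = delta * c / s * (1 + s * (b - xc c))).
  { rewrite e1. unfold Pin.
    transitivity (delta * c / s * (1 + s * (b - xc c)) * (exp (- (s * b)) * exp (s * b)));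
      [ring | rewrite inv; ring]. }
  assert (eN : exp (- (s * b)) * (N a - N b) = delta * c / s * (1 - s * (b - xc c))).
  { rewrite e2. unfold Nin.
    transitivity (delta * c / s * (1 - s * (b - xc c)) * (exp (- (s * b)) * exp (s * b)));
      [ring | rewrite inv; ring]. }
  assert (hpe : forall x, exp (s * b) * exp (- (s * x)) = exp (s * (b - x))).
  { intros x. rewrite <- exp_plus. f_equal. ring. }
  assert (hne : forall x, exp (- (s * b)) * exp (s * x) = exp (- (s * (b - x)))).
  { intros x. rewrite <- exp_plus. f_equal. ring. }
  split.
  - set (f := fun x => exp (s * b) * P x - exp (- (s * b)) * N x + w b * sinh (s * (b - x))).
    assert (fd : forall x, is_derive f x (s * cosh (s * (b - x)) * (w x - w b))).
    { intros x. unfold f. pose proof (P_derive x) as dp. pose proof (N_derive x) as dn.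
      auto_derive.
      - repeat split; eexists; eassumption.
      - derive_value P x dp.
        derive_value N x dn.
       
        change (b + - x) with (b - x). unfold cosh. rewrite <- hpe, <- hne. field. }
    assert (f a <= f b).
    { apply (incr_le f _ a b ltac:(lra) (fun x _ => fd x)). intros x hx.
      pose proof (w_decr x b ltac:(lra) ltac:(lra)).
      assert (0 < cosh (s * (b - x))).
      { unfold cosh. pose proof (exp_pos (s * (b - x))). pose proof (exp_pos (- (s * (b - x)))). lra. }
      apply Rmult_le_pos; [nra | lra]. }
    unfold f in H. rewrite Rminus_diag, Rmult_0_r, sinh_0, Rmult_0_r in H.
    assert (exp (s * b) * (P b - P a) + exp (- (s * b)) * (N a - N b) = 2 * delta * c / s).
    { rewrite eP, eN. field. lra. }
    assert (w b * sinh (s * (b - a)) <= 2 * delta * c / s) by lra.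
    apply Rmult_le_reg_r with (/ s); [now apply Rinv_0_lt_compat |].
    replace (s * w b * sinh (s * (b - a)) * / s) with (w b * sinh (s * (b - a))) by (field; lra).
    lra.
  - set (f := fun x => exp (s * b) * P x + exp (- (s * b)) * N x + w a * cosh (s * (b - x))).
    assert (fd : forall x, is_derive f x (s * sinh (s * (b - x)) * (w x - w a))).
    { intros x. unfold f. pose proof (P_derive x) as dp. pose proof (N_derive x) as dn.
      auto_derive.
      - repeat split; eexists; eassumption.
      - derive_value P x dp.
        derive_value N x dn.
       
        change (b + - x) with (b - x). unfold sinh. rewrite <- hpe, <- hne. field. }
    assert (f b <= f a).
    { apply (decr_le f _ a b ltac:(lra) (fun x _ => fd x)). intros x hx.
      pose proof (w_decr a x ltac:(lra) ltac:(lra)).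
      assert (0 <= sinh (s * (b - x))).
      { destruct (Req_dec x b) as [-> | hne'].
        - rewrite Rminus_diag, Rmult_0_r, sinh_0. lra.
        - apply Rlt_le, sinh_pos. apply Rmult_lt_0_compat; lra. }
      assert (0 <= s * sinh (s * (b - x))) by (apply Rmult_le_pos; lra). nra. }
    unfold f in H. rewrite Rminus_diag, Rmult_0_r, cosh_0 in H.
    assert (exp (s * b) * (P b - P a) - exp (- (s * b)) * (N a - N b)
            = 2 * delta * c * (b - xc c)).
    { rewrite eP, eN. field. lra. }
    lra.
Qed.

(** Together with the limits of [a] and [b] this bounds [dG] from below by
    [1 / 2 + delta / (s ^ 2 * w (1 / (2 * delta)))] in the limit [c -> 0]. *)
Lemma dG_lower (a b c : R) : 0 < c -> smooth_fit a b c -> 0 < w b ->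
  2 * delta + s ^ 2 / 2 * w b * cosh (s * (b - a))
  - 2 * delta * (w a / w b) * (cosh (s * (b - a)) / (cosh (s * (b - a)) + 1))
  <= s ^ 2 * Win b c * dG a b c.
Proof.
  intros hc hs hwb. destruct (smooth_fit_estimates a b c hc hs) as [i1 i2].
  destruct hs as [h1 [h2 [h3 [h4 [h5 [h6 [e1 e2]]]]]]]. pose proof delta_pos as hdel.
  set (v := s * (b - a)) in *.
  assert (hv : 0 < v) by (apply Rmult_lt_0_compat; lra).
  pose proof (sinh_pos v hv) as hS.
  assert (hid : cosh v * cosh v - sinh v * sinh v = 1).
  { unfold cosh, sinh. assert (exp v * exp (- v) = 1).
    { rewrite <- exp_plus, Rplus_opp_r. apply exp_0. }
    nra. }
  assert (hC : 1 < cosh v).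
  { assert (0 < cosh v); [| nra]. unfold cosh.
    pose proof (exp_pos v). pose proof (exp_pos (- v)). lra. }
  set (S := sinh v) in *. set (C := cosh v) in *.
  assert (hwa : 0 < w a) by (apply w_pos; lra).
  set (u := b - xc c) in *. assert (hu : 0 < u) by (unfold u; lra).
  assert (i3 : s * w b * S * u <= w a * (C - 1)).
  { apply Rle_trans with (2 * delta * c * u); [| exact i2].
    apply Rmult_le_compat_r; lra. }
  unfold dG. fold v. fold S. fold C.
  replace (s ^ 2 * Win b c * (2 * delta / (s ^ 2 * Win b c) * (1 + s * (c + 1 / (2 * delta) - b) * C / S)))
    with (2 * delta + s * (delta * c - 2 * delta * u) * C / S).
  2: { unfold u, xc. field. repeat split; lra. }
  assert (s ^ 2 / 2 * w b * C - 2 * delta * (w a / w b) * (C / (C + 1))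
          <= s * (delta * c - 2 * delta * u) * C / S); [| lra].
  apply Rmult_le_reg_r with (S * S * w b).
  { apply Rmult_lt_0_compat; [apply Rmult_lt_0_compat; assumption | assumption]. }
  replace (s * (delta * c - 2 * delta * u) * C / S * (S * S * w b))
    with (C * (s * w b * S / 2 * (2 * delta * c) - 2 * delta * (s * w b * S * u))) by (field; lra).
  replace ((s ^ 2 / 2 * w b * C - 2 * delta * (w a / w b) * (C / (C + 1))) * (S * S * w b))
    with (C * (s * w b * S / 2 * (s * w b * S) - 2 * delta * (w a * (S * S / (C + 1)))))
    by (field; lra).
  replace (S * S / (C + 1)) with (C - 1).
  2: { replace (S * S) with ((C - 1) * (C + 1)) by lra. field. lra. }
  apply Rmult_le_compat_l; [lra |].
  assert (s * w b * S / 2 * (s * w b * S) <= s * w b * S / 2 * (2 * delta * c)).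
  { apply Rmult_le_compat_l; [| exact i1].
    assert (0 < s * w b * S); [| lra].
    apply Rmult_lt_0_compat; [apply Rmult_lt_0_compat; assumption | assumption]. }
  nra.
Qed.

(** On [[0, phi + c]] the function [P] grows at a rate bounded below, while smooth
    fit makes [P b - P a] of order [c]. *)
Lemma smooth_fit_gap : exists K, 0 <= K /\
  locally 0 (fun c => forall a b, 0 < c -> smooth_fit a b c -> b - a <= K * c).
Proof.
  pose proof delta_pos as hdel.
  set (x1 := phi + 1).
  set (w1 := w phi / 2). pose proof w_phi as hw.
  set (m := s / 2 * exp (- (s * x1)) * w1).
  assert (hm : 0 < m).
  { unfold m, w1. pose proof (exp_pos (- (s * x1))). repeat apply Rmult_lt_0_compat; lra. }
  exists (delta / s * (1 + s * x1) / m). split.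
  { assert (0 < delta / s) by (apply Rdiv_lt_0_compat; lra).
    apply Rlt_le, Rdiv_lt_0_compat; [| exact hm]. apply Rmult_lt_0_compat; [lra |].
    unfold x1. nra. }
  assert (l2 : locally 0 (fun c => w1 < w (phi + c))).
  { apply tends_gt with (a := w (phi + 0)).
    - apply (ex_derive_continuous (fun c => w (phi + c))).
      unfold w, beta. auto_derive. exact I.
    - rewrite Rplus_0_r. unfold w1. lra. }
  assert (l3 : locally 0 (fun c => c < 1)) by (apply tends_lt with (a := 0); [apply tends_id | lra]).
  apply filter_imp with (2 := filter_and _ _ l2 l3).
  intros c [k2 k3] a b hc [h1 [h2 [h3 [h4 [h5 [h6 [e1 e2]]]]]]].
  destruct (mvt P _ a b ltac:(lra) (fun z _ => P_derive z)) as [z [hz ez]].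
  assert (eP : P b - P a = delta * c / s * exp (- (s * b)) * (1 + s * (b - xc c))).
  { rewrite e1. unfold Pin. ring. }
  assert (hxc : 0 < xc c) by (unfold xc; assert (0 < 1 / (2 * delta)) by (apply Rdiv_lt_0_compat; lra); lra).
  assert (lower : m <= exp (- (s * z)) * (s / 2 * w z)).
  { unfold m. assert (exp (- (s * x1)) <= exp (- (s * z))) by (apply exp_le; unfold x1; nra).
    pose proof (w_decr z (phi + c) ltac:(lra) ltac:(lra)).
    pose proof (exp_pos (- (s * x1))).
    assert (exp (- (s * x1)) * w1 <= exp (- (s * z)) * w z)
      by (apply Rmult_le_compat; unfold w1 in *; lra).
    nra. }
  assert (upper : delta * c / s * exp (- (s * b)) * (1 + s * (b - xc c))
                  <= delta * c / s * (1 + s * x1)).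
  { assert (0 < delta * c / s) by (apply Rdiv_lt_0_compat; nra).
    rewrite Rmult_assoc. apply Rmult_le_compat_l; [lra |].
    assert (exp (- (s * b)) <= exp 0) as hle by (apply exp_le; nra). rewrite exp_0 in hle.
    assert (0 < 1 + s * (b - xc c)) by nra.
    assert (s * (b - xc c) <= s * x1) by (apply Rmult_le_compat_l; unfold x1; lra).
    pose proof (exp_pos (- (s * b))). nra. }
  apply Rmult_le_reg_l with (1 := hm).
  replace (m * (delta / s * (1 + s * x1) / m * c)) with (delta * c / s * (1 + s * x1))
    by (field; lra).
  apply Rle_trans with (P b - P a); [| lra].
  rewrite ez. apply Rmult_le_compat_r; lra.
Qed.


(** ** Regularity of a family of solutions *)

Section Family.

Context (F G J : R -> R) (cm : R)
  (sol : forall c, 0 < c < cm -> smooth_fit (F c) (G c) c)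
  (sol_unique : forall a b c, 0 < c < cm -> smooth_fit a b c -> a = F c /\ b = G c)
  (J_inv : forall z, P 0 <= z <= 0 -> 0 <= J z <= phi /\ P (J z) = z).

Lemma J_P (x : R) : 0 <= x <= phi -> J (P x) = x.
Proof.
  intros hx.
  assert (hz : P 0 <= P x <= 0).
  { split.
    - destruct (Req_dec x 0) as [-> | hne]; [lra |]. apply Rlt_le, P_incr; lra.
    - rewrite <- P_phi. destruct (Req_dec x phi) as [-> | hne]; [lra |].
      apply Rlt_le, P_incr; lra. }
  destruct (J_inv _ hz) as [j1 j2].
  apply Rle_antisym; apply P_le; auto; lra.
Qed.

(** [P] expands distances by at least [pslope], so its inverse is Lipschitz. *)
Lemma J_cont (z : R) : P 0 < z < 0 -> continuous J z.
Proof.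
  intros hz. pose proof pslope_pos as hp.
  apply (tends_squeeze (Fil := locally z)) with (g := fun y => Rabs (y - z) / pslope).
  - assert (h1 : locally z (fun y => P 0 < y)) by (apply tends_gt with (a := z); [apply tends_id | lra]).
    assert (h2 : locally z (fun y => y < 0)) by (apply tends_lt with (a := z); [apply tends_id | lra]).
    apply filter_imp with (2 := filter_and _ _ h1 h2). intros y [k1 k2].
    destruct (J_inv z) as [[a1 a2] a3]; [lra |]. destruct (J_inv y) as [[b1 b2] b3]; [lra |].
    apply Rmult_le_reg_l with (1 := hp).
    replace (pslope * (Rabs (y - z) / pslope)) with (Rabs (y - z)) by (field; lra).
    destruct (Rle_dec (J z) (J y)) as [hle | hle].
    + pose proof (P_expand (J z) (J y) a1 hle b2) as h. rewrite a3, b3 in h.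
      rewrite Rabs_pos_eq by lra. rewrite Rabs_pos_eq by nra. exact h.
    + pose proof (P_expand (J y) (J z) b1 ltac:(lra) a2) as h. rewrite a3, b3 in h.
      rewrite Rabs_left by lra. rewrite Rabs_left1 by nra. lra.
  - replace 0 with (Rabs (z - z) / pslope).
    + apply tends_div; [lra | | apply tends_const]. apply tends_abs.
      apply tends_minus; [apply tends_id | apply tends_const].
    + rewrite Rminus_diag, Rabs_R0. field. lra.
Qed.

(** Near a solution, [reduced_decr] and the intermediate value theorem produce
    solutions for neighbouring [c]; uniqueness identifies them with [F], [G]. *)
Lemma FG_cont (c : R) : 0 < c < cm -> continuous F c /\ continuous G c.
Proof.
  intros hc. pose proof (sol c hc) as [h1 [h2 [h3 [h4 [h5 [h6 [e1 e2]]]]]]].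
  pose proof delta_pos as hdel.
  assert (hPF : P 0 < P (F c) < 0).
  { split; [| rewrite <- P_phi]; apply P_incr; lra. }
  assert (limPR : forall (T : Type) (Fil : (T -> Prop) -> Prop) (FF : Filter Fil)
      (u v : T -> R) (x e : R), tends Fil u x -> tends Fil v e ->
      tends Fil (fun p => Pin (u p) (v p)) (Pin x e)).
  { intros. unfold Pin, P, xc.
    tends_auto; lra. }
  assert (limNR : forall (T : Type) (Fil : (T -> Prop) -> Prop) (FF : Filter Fil)
      (u v : T -> R) (x e : R), tends Fil u x -> tends Fil v e ->
      tends Fil (fun p => Nin (u p) (v p)) (Nin x e)).
  { intros. unfold Nin, N, xc.
    tends_auto; lra. }
  assert (contN : forall x, continuous N x).
  { intros x. apply (ex_derive_continuous N). eexists. apply N_derive. }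
  (* conditions under which a root of the reduced equation is a solution *)
  set (box := fun (eps : R) (p : R * R) =>
    (0 < snd p < cm /\ xc (snd p) < fst p < phi + snd p /\ 0 < Win (fst p) (snd p)) /\
    (P 0 < Pin (fst p) (snd p) < 0) /\
    (0 < J (Pin (fst p) (snd p)) < phi /\ J (Pin (fst p) (snd p)) < xc (snd p)) /\
    Rabs (J (Pin (fst p) (snd p)) - F c) < eps).
  assert (hbox : forall eps, 0 < eps -> locally (G c, c) (box eps)).
  { intros eps he.
    pose proof (tends_fst (G c) c) as lf. pose proof (tends_snd (G c) c) as ls.
    assert (lx : tends (locally (G c, c)) (fun p => xc (snd p)) (xc c)).
    { unfold xc. tends_auto; lra. }
    assert (lp : tends (locally (G c, c)) (fun p => phi + snd p) (phi + c)).
    { apply tends_plus; [apply tends_const | assumption]. }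
    assert (lW : tends (locally (G c, c)) (fun p => Win (fst p) (snd p)) (Win (G c) c)).
    { unfold Win, w, xc. tends_auto; lra. }
    pose proof (limPR _ _ _ _ _ _ _ lf ls) as lPR. cbv beta in lPR. rewrite <- e1 in lPR.
    assert (lJ : tends (locally (G c, c)) (fun p => J (Pin (fst p) (snd p))) (F c)).
    { rewrite <- (J_P (F c)) by lra. apply tends_comp; [now apply J_cont | exact lPR]. }
    assert (l1 := tends_gt _ _ 0 ls ltac:(lra)). assert (l2 := tends_lt _ _ cm ls ltac:(lra)).
    assert (l3 := tends_gt _ _ 0 (tends_minus _ _ _ _ lf lx) ltac:(lra)).
    assert (l4 := tends_gt _ _ 0 (tends_minus _ _ _ _ lp lf) ltac:(lra)).
    assert (l5 := tends_gt _ _ 0 lW ltac:(lra)).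
    assert (l6 := tends_gt _ _ (P 0) lPR ltac:(lra)). assert (l7 := tends_lt _ _ 0 lPR ltac:(lra)).
    assert (l8 := tends_gt _ _ 0 lJ ltac:(lra)). assert (l9 := tends_lt _ _ phi lJ ltac:(lra)).
    assert (l10 := tends_gt _ _ 0 (tends_minus _ _ _ _ lx lJ) ltac:(lra)).
    assert (l11 := proj1 (tends_eps _ _) lJ eps he).
    apply filter_imp with (2 := filter_and _ _ l1 (filter_and _ _ l2 (filter_and _ _ l3
      (filter_and _ _ l4 (filter_and _ _ l5 (filter_and _ _ l6 (filter_and _ _ l7
      (filter_and _ _ l8 (filter_and _ _ l9 (filter_and _ _ l10 l11)))))))))).
    intros p [k1 [k2 [k3 [k4 [k5 [k6 [k7 [k8 [k9 [k10 k11]]]]]]]]]].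
    cbv beta in *. unfold box. repeat split; try assumption; now apply Rlt_0_minus. }
  assert (main : forall eps, 0 < eps ->
    locally c (fun e => Rabs (F e - F c) < eps /\ Rabs (G e - G c) < eps)).
  { intros eps he. destruct (proj1 (locally_R2 _ _ _) (hbox eps he)) as [d [hd hb]].
    set (r := Rmin d eps / 2).
    assert (hr : 0 < r /\ r < d /\ r < eps).
    { unfold r. pose proof (Rmin_glb_lt d eps 0 hd he).
      pose proof (Rmin_l d eps). pose proof (Rmin_r d eps). lra. }
    assert (inr : forall x, G c - r <= x <= G c + r -> Rabs (x - G c) < d).
    { intros x hx. apply Rabs_def1; lra. }
    assert (hcc : Rabs (c - c) < d) by (rewrite Rminus_diag, Rabs_R0; exact hd).
    set (Lf := fun x e => Nin x e - N (J (Pin x e))).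
    assert (Lzero : Lf (G c) c = 0).
    { unfold Lf. rewrite <- e1, J_P, <- e2 by lra. ring. }
    assert (dec : forall x y, G c - r <= x -> x < y -> y <= G c + r -> Lf y c < Lf x c).
    { intros x y hx hxy hy.
      destruct (hb x c (inr x ltac:(lra)) hcc) as [[b1 [b2 b3]] [b4 [[b5 b6] b7]]].
      destruct (hb y c (inr y ltac:(lra)) hcc) as [[b1' [b2' b3']] [b4' [[b5' b6'] b7']]].
      simpl in *. unfold Lf. apply reduced_decr; try assumption; try lra.
      - intros z hz. destruct (hb z c (inr z ltac:(lra)) hcc) as [[_ [_ q]] _]. exact q.
      - apply J_inv. lra.
      - apply J_inv. lra. }
    assert (limL : forall x, G c - r <= x <= G c + r -> tends (locally c) (Lf x) (Lf x c)).
    { intros x hx. destruct (hb x c (inr x hx) hcc) as [_ [b4 _]]. simpl in b4.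
      unfold Lf. apply tends_minus.
      - apply limNR; [apply locally_filter | apply tends_const | apply tends_id].
      - apply tends_comp; [apply contN |]. apply tends_comp; [now apply J_cont |].
        apply limPR; [apply locally_filter | apply tends_const | apply tends_id]. }
    assert (s1 : locally c (fun e => 0 < Lf (G c - r) e)).
    { apply (tends_gt _ (Lf (G c - r) c)); [apply limL; lra |].
      rewrite <- Lzero. apply dec; lra. }
    assert (s2 : locally c (fun e => Lf (G c + r) e < 0)).
    { apply (tends_lt _ (Lf (G c + r) c)); [apply limL; lra |].
      rewrite <- Lzero. apply dec; lra. }
    assert (s3 : locally c (fun e => Rabs (e - c) < d)).
    { apply locally_R. exists d. auto. }
    apply filter_imp with (2 := filter_and _ _ s1 (filter_and _ _ s2 s3)).
    intros e [k1 [k2 k3]].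
    destruct (IVT_interv (fun x => - Lf x e) (G c - r) (G c + r)) as [x [hx hz]]; try lra.
    { intros x hx. apply continuity_pt_filterlim.
      destruct (hb x e (inr x hx) k3) as [_ [b4 _]]. simpl in b4.
      apply (tends_opp (Fil := locally x)). unfold Lf.
      apply (tends_minus (Fil := locally x)).
      - apply limNR; [apply locally_filter | apply tends_id | apply tends_const].
      - apply tends_comp; [apply contN |]. apply tends_comp; [now apply J_cont |].
        apply limPR; [apply locally_filter | apply tends_id | apply tends_const]. }
    destruct (hb x e (inr x hx) k3) as [[b1 [b2 b3]] [b4 [[b5 b6] b7]]]. simpl in *.
    destruct (sol_unique (J (Pin x e)) x e b1) as [u1 u2].
    { unfold smooth_fit. repeat split; try assumption; try lra.
      - apply J_inv. lra.
      - unfold Lf in hz. lra. }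
    rewrite <- u1, <- u2. split; [exact b7 |]. apply Rabs_def1; lra. }
  split; apply tends_eps; intros eps he; apply filter_imp with (2 := main eps he); tauto.
Qed.

Lemma sinh_gap (c : R) : 0 < c < cm -> 0 < sinh (s * (G c - F c)).
Proof.
  intros hc. destruct (sol c hc) as [h1 [h2 [h3 _]]].
  apply sinh_pos, Rmult_lt_0_compat; lra.
Qed.

Lemma FG_derive (c : R) : 0 < c < cm ->
  is_derive F c (dF (F c) (G c) c) /\ is_derive G c (dG (F c) (G c) c).
Proof.
  intros hc. pose proof delta_pos as hdel. pose proof (sinh_gap c hc) as hS.
  destruct (FG_cont c hc) as [hF hG].
  assert (hin : locally c (fun e => 0 < e < cm)).
  { apply filter_and; [apply tends_gt with (a := c) | apply tends_lt with (a := c)];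
      try apply tends_id; lra. }
  destruct (sol c hc) as [h1 [h2 [h3 [h4 [h5 [h6 [e1 e2]]]]]]].
  assert (hw : 0 < w (F c)) by (apply w_pos; lra).
  (* [Pin x c = P x + c * b1 x + c ^ 2 * d1 x], and likewise for [Nin] *)
  set (b1 := fun x => - (delta / s) * exp (- (s * x)) * (1 + s * (x - 1 / (2 * delta)))).
  set (d1 := fun x => delta / 2 * exp (- (s * x))).
  set (b2 := fun x => delta / s * exp (s * x) * (1 - s * (x - 1 / (2 * delta)))).
  set (d2 := fun x => delta / 2 * exp (s * x)).
  set (b1' := fun x => delta * s * exp (- (s * x)) * (x - 1 / (2 * delta))).
  set (d1' := fun x => - (s * delta / 2) * exp (- (s * x))).
  set (b2' := fun x => - (delta * s) * exp (s * x) * (x - 1 / (2 * delta))).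
  set (d2' := fun x => s * delta / 2 * exp (s * x)).
  assert (q1 : exp (- (s * G c)) * (s / 2 * w (G c)) + c * b1' (G c) + c ^ 2 * d1' (G c)
               = exp (- (s * G c)) * (s / 2 * Win (G c) c)).
  { unfold b1', d1', Win, xc. field. lra. }
  assert (q2 : - (exp (s * G c) * (s / 2 * w (G c))) + c * b2' (G c) + c ^ 2 * d2' (G c)
               = - (exp (s * G c) * (s / 2 * Win (G c) c))).
  { unfold b2', d2', Win, xc. field. lra. }
  assert (hsh : 2 * sinh (s * (G c - F c))
    = exp (s * G c) * exp (- (s * F c)) - exp (s * F c) * exp (- (s * G c))).
  { rewrite Rmult_minus_distr_l, sinh_minus. field. }
  assert (hch : 2 * cosh (s * (G c - F c))
    = exp (s * G c) * exp (- (s * F c)) + exp (s * F c) * exp (- (s * G c))).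
  { rewrite Rmult_minus_distr_l, cosh_minus. field. }
  destruct (implicit_pair_derive P N P b1 d1 N b2 d2 F G c
    (exp (- (s * F c)) * (s / 2 * w (F c))) (- (exp (s * F c) * (s / 2 * w (F c))))
    (exp (- (s * G c)) * (s / 2 * w (G c))) (b1' (G c)) (d1' (G c))
    (- (exp (s * G c) * (s / 2 * w (G c)))) (b2' (G c)) (d2' (G c)))
    as [F' [G' [dF' [dG' [i1 i2]]]]];
    try apply P_derive; try apply N_derive; try assumption.
  - unfold b1, b1'. auto_derive; [lra |]. field. lra.
  - unfold d1, d1'. auto_derive; [exact I |]. field.
  - unfold b2, b2'. auto_derive; [lra |]. field. lra.
  - unfold d2, d2'. auto_derive; [exact I |]. field.
  - apply filter_imp with (2 := hin). intros e he.
    destruct (sol e he) as [_ [_ [_ [_ [_ [_ [k1 _]]]]]]]. rewrite k1.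
    unfold Pin, b1, d1, xc. field. lra.
  - apply filter_imp with (2 := hin). intros e he.
    destruct (sol e he) as [_ [_ [_ [_ [_ [_ [_ k2]]]]]]]. rewrite k2.
    unfold Nin, b2, d2, xc. field. lra.
  - rewrite q1, q2. apply Rlt_not_eq.
    replace (exp (- (s * F c)) * (s / 2 * w (F c)) * - (exp (s * G c) * (s / 2 * Win (G c) c)) -
     - (exp (s * F c) * (s / 2 * w (F c))) * (exp (- (s * G c)) * (s / 2 * Win (G c) c)))
      with (- (s ^ 2 / 4 * (w (F c) * Win (G c) c)
         * (exp (s * G c) * exp (- (s * F c)) - exp (s * F c) * exp (- (s * G c))))) by field.
    rewrite <- hsh. assert (0 < w (F c) * Win (G c) c) by (apply Rmult_lt_0_compat; lra).
    assert (0 < s ^ 2 / 4) by nra.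
    assert (0 < s ^ 2 / 4 * (w (F c) * Win (G c) c)) by (apply Rmult_lt_0_compat; lra). nra.
  - rewrite q1 in i1. rewrite q2 in i2.
    assert (pF := exp_pos (s * F c)). assert (pG := exp_pos (s * G c)).
    rewrite exp_Ropp in i1, hsh, hch. rewrite (exp_Ropp (s * G c)) in *.
    unfold b1, d1 in i1. unfold b2, d2 in i2. rewrite ?exp_Ropp in i1.
    set (X := exp (s * F c)) in *. set (Y := exp (s * G c)) in *.
    set (rr := c + 1 / (2 * delta) - G c).
    assert (hXY : Y * Y - X * X <> 0).
    { intros h. assert (2 * sinh (s * (G c - F c)) = (Y * Y - X * X) / (X * Y)) as h0.
      { rewrite hsh. field. lra. }
      rewrite h in h0. unfold Rdiv in h0. rewrite Rmult_0_l in h0. lra. }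
    assert (j1 : w (F c) * F' / X = (Win (G c) c * G' + 2 * delta / s ^ 2 * (s * rr - 1)) / Y).
    { apply Rmult_eq_reg_l with (s / 2); [| lra].
      replace (s / 2 * (w (F c) * F' / X)) with (/ X * (s / 2 * w (F c)) * F') by (field; lra).
      rewrite i1. unfold rr. field. lra. }
    assert (j2 : w (F c) * F' * X = (Win (G c) c * G' - 2 * delta / s ^ 2 * (s * rr + 1)) * Y).
    { apply Rmult_eq_reg_l with (- (s / 2)); [| lra].
      replace (- (s / 2) * (w (F c) * F' * X)) with (- (X * (s / 2 * w (F c))) * F') by (field; lra).
      rewrite i2. unfold rr. field. lra. }
    set (a := w (F c) * F') in *. set (g := Win (G c) c * G') in *.
    assert (j3 : a * Y = X * (g + 2 * delta / s ^ 2 * (s * rr - 1))).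
    { replace (a * Y) with ((a / X) * (X * Y)) by (field; lra). rewrite j1. field. lra. }
    assert (ea : a = 4 * delta * rr / s * (X * Y) / (Y * Y - X * X)).
    { apply Rmult_eq_reg_r with (2 := hXY).
      replace (4 * delta * rr / s * (X * Y) / (Y * Y - X * X) * (Y * Y - X * X))
        with (4 * delta * rr / s * (X * Y)) by (field; repeat split; lra).
      replace (a * (Y * Y - X * X)) with ((a * Y) * Y - (a * X) * X) by ring.
      rewrite j3, j2. field. lra. }
    assert (eg : g = 2 * delta / s ^ 2 * (1 + s * rr * (Y * Y + X * X) / (Y * Y - X * X))).
    { apply Rmult_eq_reg_r with (2 := hXY).
      replace (2 * delta / s ^ 2 * (1 + s * rr * (Y * Y + X * X) / (Y * Y - X * X)) * (Y * Y - X * X))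
        with (2 * delta / s ^ 2 * ((Y * Y - X * X) + s * rr * (Y * Y + X * X)))
        by (field; repeat split; lra).
      assert (a * Y * X = a * X * Y) as h by ring. rewrite j3, j2 in h.
      replace (g * (Y * Y - X * X)) with ((g - 2 * delta / s ^ 2 * (s * rr + 1)) * Y * Y
         + 2 * delta / s ^ 2 * (s * rr + 1) * (Y * Y) - g * (X * X)) by ring.
      rewrite <- h. ring. }
    assert (vS : sinh (s * (G c - F c)) = (Y * Y - X * X) / (2 * (X * Y))).
    { apply Rmult_eq_reg_l with 2; [| lra]. rewrite hsh. field. lra. }
    assert (vC : cosh (s * (G c - F c)) = (Y * Y + X * X) / (2 * (X * Y))).
    { apply Rmult_eq_reg_l with 2; [| lra]. rewrite hch. field. lra. }
    split.
    + replace (dF (F c) (G c) c) with F'; [exact dF' |].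
      unfold dF. fold rr. rewrite vS.
      apply Rmult_eq_reg_l with (w (F c)); [| lra]. fold a. rewrite ea. field.
      repeat split; lra.
    + replace (dG (F c) (G c) c) with G'; [exact dG' |].
      unfold dG. fold rr. rewrite vS, vC.
      apply Rmult_eq_reg_l with (Win (G c) c); [| lra]. fold g. rewrite eg. field.
      repeat split; lra.
Qed.

Lemma tends_dF (c : R) : 0 < c < cm ->
  tends (locally c) (fun e => dF (F e) (G e) e) (dF (F c) (G c) c).
Proof.
  intros hc. pose proof (sinh_gap c hc) as hS. pose proof delta_pos as hdel.
  destruct (FG_cont c hc) as [hF hG].
  destruct (sol c hc) as [h1 [h2 [h3 [h4 [h5 [h6 [e1 e2]]]]]]].
  assert (hw : 0 < w (F c)) by (apply w_pos; lra).
  unfold dF. apply tends_div.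
  - apply Rgt_not_eq. apply Rmult_lt_0_compat; [nra | assumption].
  - apply tends_mult; [apply tends_const |]. apply tends_minus; [| exact hG].
    apply tends_plus; [apply tends_id | apply tends_const].
  - apply tends_mult; [apply tends_mult; [apply tends_const |] |].
    + apply tends_comp; [| exact hF]. apply (ex_derive_continuous w). unfold w, beta. auto_derive. exact I.
    + apply tends_comp.
      * apply sinh_cont.
      * apply tends_mult; [apply tends_const | apply tends_minus; assumption].
Qed.

Lemma tends_dG (c : R) : 0 < c < cm ->
  tends (locally c) (fun e => dG (F e) (G e) e) (dG (F c) (G c) c).
Proof.
  intros hc. pose proof (sinh_gap c hc) as hS. pose proof delta_pos as hdel.
  destruct (FG_cont c hc) as [hF hG].
  destruct (sol c hc) as [h1 [h2 [h3 [h4 [h5 [h6 [e1 e2]]]]]]].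
  assert (lv : tends (locally c) (fun e => s * (G e - F e)) (s * (G c - F c))).
  { apply tends_mult; [apply tends_const | apply tends_minus; assumption]. }
  unfold dG. apply tends_mult.
  - apply tends_div; [apply Rgt_not_eq, Rmult_lt_0_compat; nra | apply tends_const |].
    apply tends_mult; [apply tends_const |]. unfold Win, w, xc.
    tends_auto; lra.
  - apply tends_plus; [apply tends_const |]. apply tends_div; [lra | |].
    + apply tends_mult; [apply tends_mult; [apply tends_const |] |].
      * apply tends_minus; [| exact hG]. apply tends_plus; [apply tends_id | apply tends_const].
      * apply tends_comp; [| exact lv].
        apply cosh_cont.
    + apply tends_comp; [| exact lv].
      apply sinh_cont.
Qed.

(** ** The boundaries for small [c] *)

Lemma FG_gap0 : exists K, 0 <= K /\
  within (fun c => 0 < c < cm) (locally 0)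
    (fun c => Rabs (F c - 1 / (2 * delta)) <= K * c /\ Rabs (G c - 1 / (2 * delta)) <= K * c).
Proof.
  destruct smooth_fit_gap as [K [hK hl]]. exists (K + 1). split; [lra |].
  apply filter_imp with (2 := hl). intros c k hc.
  specialize (k (F c) (G c) ltac:(lra) (sol c hc)).
  destruct (sol c hc) as [h1 [h2 [h3 _]]]. unfold xc in *.
  split; apply Rabs_le; split; nra.
Qed.

Lemma FG_lim0 :
  tends (within (fun c => 0 < c < cm) (locally 0)) F (1 / (2 * delta)) /\
  tends (within (fun c => 0 < c < cm) (locally 0)) G (1 / (2 * delta)).
Proof.
  destruct FG_gap0 as [K [hK hl]].
  assert (l0 : tends (within (fun c => 0 < c < cm) (locally 0)) (fun c => K * c) 0).
  { apply tends_within; [apply locally_filter |]. replace 0 with (K * 0) at 2 by ring.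
    apply tends_mult; [apply tends_const | apply tends_id]. }
  split; apply tends_squeeze with (2 := l0); apply filter_imp with (2 := hl); tauto.
Qed.

(** The limit of [dG] at [0] is [1 / 2 + delta / (s ^ 2 * w (1 / (2 * delta)))],
    and [s ^ 2 / 2 * w x < delta] for every [x <> 0]. *)
Lemma dG_gt_1_near_0 :
  within (fun c => 0 < c < cm) (locally 0) (fun c => 1 < dG (F c) (G c) c).
Proof.
  pose proof delta_pos as hdel. pose proof beta_pos as hbe. pose proof x0_lt_phi as hx0.
  set (Fil := within (fun c => 0 < c < cm) (locally 0)).
  destruct FG_lim0 as [lF lG]. fold Fil in lF, lG.
  set (x0 := 1 / (2 * delta)) in *.
  assert (hx0' : 0 < x0) by (apply Rdiv_lt_0_compat; lra).
  assert (w0 : 0 < w x0) by (apply w_pos; lra).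
  assert (contw : continuous w x0).
  { apply (ex_derive_continuous w). unfold w, beta. auto_derive. exact I. }
  assert (lwF : tends Fil (fun c => w (F c)) (w x0)) by now apply tends_comp.
  assert (lwG : tends Fil (fun c => w (G c)) (w x0)) by now apply tends_comp.
  assert (lid : tends Fil (fun c => c) 0).
  { apply tends_within; [apply locally_filter | apply tends_id]. }
  assert (lW : tends Fil (fun c => Win (G c) c) (Win x0 0)).
  { unfold Win. apply tends_plus; [exact lwG |]. unfold xc.
    tends_auto; lra. }
  assert (lC : tends Fil (fun c => cosh (s * (G c - F c))) (cosh (s * (x0 - x0)))).
  { apply tends_comp.
    - apply cosh_cont.
    - apply tends_mult; [apply tends_const | now apply tends_minus]. }
  assert (eC : cosh (s * (x0 - x0)) = 1) by (rewrite Rminus_diag, Rmult_0_r; apply cosh_0).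
  assert (eW : Win x0 0 = w x0) by (unfold Win; ring).
  set (E := fun c => 2 * delta + s ^ 2 / 2 * w (G c) * cosh (s * (G c - F c))
    - 2 * delta * (w (F c) / w (G c)) * (cosh (s * (G c - F c)) / (cosh (s * (G c - F c)) + 1))
    - s ^ 2 * Win (G c) c).
  assert (lE : tends Fil E (delta - s ^ 2 / 2 * w x0)).
  { replace (delta - s ^ 2 / 2 * w x0) with
      (2 * delta + s ^ 2 / 2 * w x0 * cosh (s * (x0 - x0))
      - 2 * delta * (w x0 / w x0) * (cosh (s * (x0 - x0)) / (cosh (s * (x0 - x0)) + 1))
      - s ^ 2 * Win x0 0).
    - unfold E. tends_auto; first [lra | rewrite eC; lra].
    - rewrite eC, eW. field. lra. }
  assert (hpos : 0 < delta - s ^ 2 / 2 * w x0).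
  { replace (delta - s ^ 2 / 2 * w x0) with (s ^ 2 / 2 * (beta * x0 ^ 2)) by (unfold w; field; lra).
    assert (0 < beta * x0 ^ 2) by (apply Rmult_lt_0_compat; nra).
    assert (0 < s ^ 2 / 2) by nra. now apply Rmult_lt_0_compat. }
  assert (k1 := tends_gt _ _ 0 lE hpos). assert (k2 := tends_gt _ _ 0 lwG w0).
  assert (k3 : Fil (fun c => 0 < c < cm)).
  { apply (filter_imp (F := locally 0)) with (2 := filter_true). auto. }
  apply (filter_imp (F := Fil)) with (2 := filter_and _ _ k1 (filter_and _ _ k2 k3)).
  intros c [j1 [j2 j3]].
  pose proof (dG_lower (F c) (G c) c ltac:(lra) (sol c j3) j2) as low.
  destruct (sol c j3) as [_ [_ [_ [_ [_ [hW _]]]]]].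
  unfold E in j1. assert (hsW : 0 < s ^ 2 * Win (G c) c) by (apply Rmult_lt_0_compat; nra).
  apply Rmult_lt_reg_l with (1 := hsW). lra.
Qed.


(** * The value function *)

Section Value.

Context (c0 : R) (c0_le : c0 <= cm)
  (dG_gt : forall c, 0 < c < c0 -> 1 < dG (F c) (G c) c)
  (F_0 : F 0 = 1 / (2 * delta)) (G_0 : G 0 = 1 / (2 * delta)).

Definition D0 (c : R) : Prop := 0 <= c < c0.

Lemma D0_cm (c : R) : D0 c -> c <> 0 -> 0 < c < cm.
Proof. unfold D0. lra. Qed.

Lemma FG_cont_on (c : R) : D0 c ->
  tends (within D0 (locally c)) F (F c) /\ tends (within D0 (locally c)) G (G c).
Proof.
  intros hc. destruct (Req_dec c 0) as [-> | hne].
  - destruct FG_lim0 as [lF lG]. rewrite F_0, G_0.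
    assert (ext : forall u, u 0 = 1 / (2 * delta) ->
      tends (within (fun c => 0 < c < cm) (locally 0)) u (1 / (2 * delta)) ->
      tends (within D0 (locally 0)) u (1 / (2 * delta))).
    { intros u hu hl. apply (tends_eps (Fil := within D0 (locally 0))). intros eps he.
      pose proof (proj1 (tends_eps (Fil := within (fun c => 0 < c < cm) (locally 0)) _ _) hl eps he) as h.
      unfold within in *. apply filter_imp with (2 := h). intros e k hD.
      destruct (Req_dec e 0) as [-> | hne].
      - rewrite hu, Rminus_diag, Rabs_R0. exact he.
      - apply k. now apply D0_cm. }
    split; apply ext; assumption.
  - destruct (FG_cont c (D0_cm c hc hne)) as [hF hG].
    split; apply tends_within; try apply locally_filter; assumption.
Qed.

(** Since [G' > 1], the right boundary stays to the right of the translate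
    [c + 1 / (2 * delta)], and then [F' < 0]. *)
Lemma G_shift (c : R) : 0 < c < c0 -> c + 1 / (2 * delta) < G c.
Proof.
  intros hc. destruct FG_lim0 as [_ lG].
  assert (1 / (2 * delta) - 0 < G c - c); [| lra].
  apply (right_limit_lt (fun c => G c - c) _ cm c0); try assumption.
  - intros a b ha hab hb.
    apply (incr_lt (fun c => G c - c) (fun c => dG (F c) (G c) c - 1) a b hab).
    + intros x hx. destruct (FG_derive x ltac:(lra)) as [_ d].
      apply (is_derive_minus G (fun c => c)); [exact d | apply (is_derive_id x)].
    + intros x hx. pose proof (dG_gt x ltac:(lra)). lra.
  - apply tends_minus; [exact lG |]. apply tends_within; [apply locally_filter | apply tends_id].
Qed.

Lemma dF_neg (c : R) : 0 < c < c0 -> dF (F c) (G c) c < 0.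
Proof.
  intros hc. pose proof (G_shift c hc) as hg. pose proof (sinh_gap c ltac:(lra)) as hS.
  destruct (sol c ltac:(lra)) as [h1 [h2 [h3 [h4 [h5 _]]]]].
  pose proof delta_pos as hdel. pose proof (w_pos (F c) ltac:(lra)) as hw.
  unfold dF. apply Rmult_lt_reg_r with (s * w (F c) * sinh (s * (G c - F c))).
  - apply Rmult_lt_0_compat; [nra | assumption].
  - unfold Rdiv at 1. rewrite Rmult_assoc, Rinv_l, Rmult_0_l.
    + nra.
    + apply Rgt_not_eq. apply Rmult_lt_0_compat; [nra | assumption].
Qed.

Lemma F_lt (c : R) : 0 < c < c0 -> F c < 1 / (2 * delta).
Proof.
  intros hc. destruct FG_lim0 as [lF _].
  assert (- (1 / (2 * delta)) < - F c); [| lra].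
  apply (right_limit_lt (fun c => - F c) _ cm c0); try assumption.
  - intros a b ha hab hb.
    apply (incr_lt (fun c => - F c) (fun c => - dF (F c) (G c) c) a b hab).
    + intros x hx. destruct (FG_derive x ltac:(lra)) as [d _].
      apply (is_derive_opp F); exact d.
    + intros x hx. pose proof (dF_neg x ltac:(lra)). lra.
  - now apply tends_opp.
Qed.

Lemma FG_order (c : R) : D0 c ->
  0 < F c <= 1 / (2 * delta) /\ c + 1 / (2 * delta) <= G c < phi + c.
Proof.
  intros hc. pose proof delta_pos. pose proof x0_lt_phi.
  assert (0 < 1 / (2 * delta)) by (apply Rdiv_lt_0_compat; lra).
  destruct (Req_dec c 0) as [-> | hne].
  - rewrite F_0, G_0. lra.
  - unfold D0 in hc. pose proof (G_shift c ltac:(lra)). pose proof (F_lt c ltac:(lra)).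
    destruct (sol c ltac:(lra)) as [h1 [h2 [h3 [h4 _]]]]. lra.
Qed.

(** ** The three pieces and their derivatives *)

Definition mid (x c : R) : R :=
  mu * x ^ 2 + 2 * mu / s ^ 2 + P (F c) * exp (s * x) + N (F c) * exp (- (s * x)).
Definition mid_x (x c : R) : R :=
  2 * mu * x + s * (P (F c) * exp (s * x) - N (F c) * exp (- (s * x))).
Definition mid_xx (x c : R) : R :=
  2 * mu + s ^ 2 * (P (F c) * exp (s * x) + N (F c) * exp (- (s * x))).
Definition mid_c (x c : R) : R :=
  2 * delta * (c + 1 / (2 * delta) - G c) * (sinh (s * (x - F c)) / sinh (s * (G c - F c))).

Definition Val (x c : R) : R :=
  if Rle_dec x (F c) then delta * x ^ 2
  else if Rlt_dec x (G c) then mid x c else U (x - c) + c.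
Definition Val_x (x c : R) : R :=
  if Rle_dec x (F c) then 2 * delta * x
  else if Rlt_dec x (G c) then mid_x x c else dU (x - c).
Definition Val_xx (x c : R) : R :=
  if Rle_dec x (F c) then 2 * delta
  else if Rlt_dec x (G c) then mid_xx x c
  else if Rle_dec x (phi + c) then 2 * delta else ddtail (x - c).
Definition Val_c (x c : R) : R :=
  if Rle_dec x (F c) then 0
  else if Rlt_dec x (G c) then mid_c x c else 1 - dU (x - c).

Lemma mid_derive (x c : R) : is_derive (fun z => mid z c) x (mid_x x c).
Proof. unfold mid, mid_x. auto_derive; [exact I |]. ring. Qed.

Lemma mid_x_derive (x c : R) : is_derive (fun z => mid_x z c) x (mid_xx x c).
Proof. unfold mid_x, mid_xx. auto_derive; [exact I |]. ring. Qed.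

Lemma exp_inv (x : R) : exp (s * x) * exp (- (s * x)) = 1.
Proof. rewrite <- exp_plus, Rplus_opp_r. apply exp_0. Qed.

Lemma PN_sum (x : R) : P x * exp (s * x) + N x * exp (- (s * x)) = beta * x ^ 2 - 2 * mu / s ^ 2.
Proof.
  unfold P, N. set (q1 := beta * x ^ 2 + 2 * beta * x / s - 2 * mu / s ^ 2).
  set (q2 := beta * x ^ 2 - 2 * beta * x / s - 2 * mu / s ^ 2).
  replace (exp (- (s * x)) / 2 * q1 * exp (s * x) + exp (s * x) / 2 * q2 * exp (- (s * x)))
    with (exp (s * x) * exp (- (s * x)) * (q1 + q2) / 2) by field.
  rewrite exp_inv. unfold q1, q2. field. lra.
Qed.

Lemma PN_diff (x : R) : P x * exp (s * x) - N x * exp (- (s * x)) = 2 * beta * x / s.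
Proof.
  unfold P, N. set (q1 := beta * x ^ 2 + 2 * beta * x / s - 2 * mu / s ^ 2).
  set (q2 := beta * x ^ 2 - 2 * beta * x / s - 2 * mu / s ^ 2).
  replace (exp (- (s * x)) / 2 * q1 * exp (s * x) - exp (s * x) / 2 * q2 * exp (- (s * x)))
    with (exp (s * x) * exp (- (s * x)) * (q1 - q2) / 2) by field.
  rewrite exp_inv. unfold q1, q2. field. lra.
Qed.

Lemma PNin_sum (x c : R) : Pin x c * exp (s * x) + Nin x c * exp (- (s * x))
  = beta * x ^ 2 - 2 * mu / s ^ 2 - 2 * delta * c * (x - xc c).
Proof.
  unfold Pin, Nin. set (k := delta * c / s). set (v := s * (x - xc c)).
  replace ((P x - k * exp (- (s * x)) * (1 + v)) * exp (s * x) +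
    (N x + k * exp (s * x) * (1 - v)) * exp (- (s * x)))
    with (P x * exp (s * x) + N x * exp (- (s * x)) - k * (2 * v) * (exp (s * x) * exp (- (s * x))))
    by ring.
  rewrite PN_sum, exp_inv. unfold k, v. field. lra.
Qed.

Lemma PNin_diff (x c : R) : Pin x c * exp (s * x) - Nin x c * exp (- (s * x))
  = 2 * beta * x / s - 2 * delta * c / s.
Proof.
  unfold Pin, Nin. set (k := delta * c / s). set (v := s * (x - xc c)).
  replace ((P x - k * exp (- (s * x)) * (1 + v)) * exp (s * x) -
    (N x + k * exp (s * x) * (1 - v)) * exp (- (s * x)))
    with (P x * exp (s * x) - N x * exp (- (s * x)) - k * 2 * (exp (s * x) * exp (- (s * x))))
    by ring.
  rewrite PN_diff, exp_inv. unfold k, v. field. lra.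
Qed.

Lemma mid_F (c : R) : mid (F c) c = delta * F c ^ 2 /\ mid_x (F c) c = 2 * delta * F c.
Proof.
  unfold mid, mid_x. rewrite PN_diff. split.
  - rewrite (Rplus_assoc _ (P _ * _)), PN_sum. unfold beta. ring.
  - unfold beta. field. lra.
Qed.

Lemma mid_G (c : R) : D0 c ->
  mid (G c) c = delta * (G c - c) ^ 2 + c /\ mid_x (G c) c = 2 * delta * (G c - c) /\
  mid_xx (G c) c = 2 * delta - s ^ 2 * Win (G c) c.
Proof.
  intros hc. pose proof delta_pos as hdel.
  assert (e : P (F c) = Pin (G c) c /\ N (F c) = Nin (G c) c).
  { destruct (Req_dec c 0) as [-> | hne].
    - rewrite F_0, G_0. unfold Pin, Nin. split; field; lra.
    - destruct (sol c (D0_cm c hc hne)) as [_ [_ [_ [_ [_ [_ [e1 e2]]]]]]]. auto. }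
  destruct e as [e1 e2].
  unfold mid, mid_x, mid_xx. rewrite e1, e2, PNin_diff. repeat split.
  - rewrite (Rplus_assoc _ (Pin _ _ * _)), PNin_sum. unfold beta, xc. field. lra.
  - unfold beta. field. lra.
  - rewrite PNin_sum. unfold Win, w, beta. field. lra.
Qed.

Lemma mid_c_F (c : R) : mid_c (F c) c = 0.
Proof. unfold mid_c. rewrite Rminus_diag, Rmult_0_r, sinh_0. unfold Rdiv. ring. Qed.

Lemma mid_c_G (c : R) : D0 c -> mid_c (G c) c = 1 - 2 * delta * (G c - c).
Proof.
  intros hc. pose proof delta_pos as hdel. unfold mid_c. destruct (Req_dec c 0) as [-> | hne].
  - rewrite G_0. unfold Rdiv. ring_simplify. field. lra.
  - pose proof (sinh_gap c (D0_cm c hc hne)). field. lra.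
Qed.

(** Smooth fit makes adjacent formulas agree on the common boundary, so each one
    is valid on its closed interval; this is the form that the gluing lemmas
    take. *)
Lemma Val_pieces (x c : R) : D0 c ->
  (x <= F c -> Val x c = delta * x ^ 2) /\
  (F c <= x <= G c -> Val x c = mid x c) /\
  (G c <= x -> Val x c = U (x - c) + c).
Proof.
  intros hc. pose proof (FG_order c hc) as hFG. pose proof x0_lt_phi. unfold D0 in hc.
  destruct (mid_F c) as [f _]. destruct (mid_G c hc) as [g _].
  assert (U (G c - c) = delta * (G c - c) ^ 2) by (apply U_left; lra).
  assert (U (F c) = delta * F c ^ 2) by (apply U_left; lra).
  unfold Val. repeat split; intros hx; destruct (Rle_dec x (F c)); destruct (Rlt_dec x (G c));
    try lra; try reflexivity.
  - replace x with (F c) by lra. lra.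
  - replace x with (F c) by lra. lra.
  - replace x with (G c) by lra. lra.
  - (* only at [c = 0], where the boundaries meet *)
    assert (c = 0) as -> by lra. replace x with (F 0) by lra. rewrite Rminus_0_r. lra.
Qed.

Lemma Val_x_pieces (x c : R) : D0 c ->
  (x <= F c -> Val_x x c = 2 * delta * x) /\
  (F c <= x <= G c -> Val_x x c = mid_x x c) /\
  (G c <= x -> Val_x x c = dU (x - c)).
Proof.
  intros hc. pose proof (FG_order c hc) as hFG. pose proof x0_lt_phi. unfold D0 in hc.
  destruct (mid_F c) as [_ f]. destruct (mid_G c hc) as [_ [g _]].
  assert (dU (G c - c) = 2 * delta * (G c - c)) by (apply dU_left; lra).
  assert (dU (F c) = 2 * delta * F c) by (apply dU_left; lra).
  unfold Val_x. repeat split; intros hx; destruct (Rle_dec x (F c)); destruct (Rlt_dec x (G c));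
    try lra; try reflexivity.
  - replace x with (F c) by lra. lra.
  - replace x with (F c) by lra. lra.
  - replace x with (G c) by lra. lra.
  - assert (c = 0) as -> by lra. replace x with (F 0) by lra. rewrite Rminus_0_r. lra.
Qed.

Lemma Val_c_pieces (x c : R) : D0 c ->
  (x <= F c -> Val_c x c = 0) /\
  (F c <= x <= G c -> Val_c x c = mid_c x c) /\
  (G c <= x -> Val_c x c = 1 - dU (x - c)).
Proof.
  intros hc. pose proof (FG_order c hc) as hFG. pose proof x0_lt_phi. pose proof delta_pos.
  pose proof (mid_c_F c) as f. pose proof (mid_c_G c hc) as g. unfold D0 in hc.
  assert (dU (G c - c) = 2 * delta * (G c - c)) by (apply dU_left; lra).
  assert (dU (F c) = 2 * delta * F c) by (apply dU_left; lra).
  unfold Val_c. repeat split; intros hx; destruct (Rle_dec x (F c)); destruct (Rlt_dec x (G c));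
    try lra; try reflexivity.
  - replace x with (F c) by lra. lra.
  - replace x with (F c) by lra. lra.
  - replace x with (G c) by lra. lra.
  - assert (c = 0) as -> by lra. replace x with (F 0) by lra. rewrite Rminus_0_r.
    rewrite H2, F_0. field. lra.
Qed.

Lemma Val_derive_x (x c : R) : D0 c -> is_derive (fun z => Val z c) x (Val_x x c).
Proof.
  intros hc. apply is_derive_dwithin.
  apply (dwithin_cover3 _ (fun z => z <= F c) (fun z => F c <= z <= G c) (fun z => G c <= z)
    _ (fun z => delta * z ^ 2) (fun z => mid z c) (fun z => U (z - c) + c)).
  - intros z _. destruct (Val_pieces z c hc) as [k1 [k2 k3]].
    destruct (Rle_lt_dec z (F c)); [left; auto |].
    destruct (Rle_lt_dec z (G c)); right; [left | right].
    + split; [lra | apply k2; lra].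
    + split; [lra | apply k3; lra].
  - destruct (Rle_lt_dec x (F c)) as [h | h].
    + left. split; [now apply Val_pieces |]. rewrite (proj1 (Val_x_pieces x c hc)) by assumption.
      apply dwithin_weaken. auto_derive; [exact I | ring].
    + right. apply filter_imp with (2 := locally_gt x _ h). intros y hy _. lra.
  - destruct (Rle_lt_dec (F c) x) as [h | h].
    + destruct (Rle_lt_dec x (G c)) as [h' | h'].
      * left. split; [now apply Val_pieces |]. rewrite (proj1 (proj2 (Val_x_pieces x c hc))) by lra.
        apply dwithin_weaken. apply mid_derive.
      * right. apply filter_imp with (2 := locally_gt x _ h'). intros y hy _. lra.
    + right. apply filter_imp with (2 := locally_lt x _ h). intros y hy _. lra.
  - destruct (Rle_lt_dec (G c) x) as [h | h].
    + left. split; [now apply Val_pieces |]. rewrite (proj2 (proj2 (Val_x_pieces x c hc))) by assumption.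
      apply dwithin_weaken. pose proof (U_derive (x - c)) as d.
      auto_derive; [eexists; exact d |].
      derive_value U (x + - c) d. ring.
    + right. apply filter_imp with (2 := locally_lt x _ h). intros y hy _. lra.
Qed.

Lemma Val_derive_c (x c : R) : D0 c -> dwithin D0 (fun e => Val x e) c (Val_c x c).
Proof.
  intros hc. destruct (FG_cont_on c hc) as [hF hG].
  apply (dwithin_cover3 _ (fun e => x <= F e) (fun e => F e <= x <= G e) (fun e => G e <= x)
    _ (fun e => delta * x ^ 2) (fun e => mid x e) (fun e => U (x - e) + e)).
  - intros e he. destruct (Val_pieces x e he) as [k1 [k2 k3]].
    destruct (Rle_lt_dec x (F e)); [left; auto |].
    destruct (Rle_lt_dec x (G e)); right; [left | right].
    + split; [lra | apply k2; lra].
    + split; [lra | apply k3; lra].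
  - destruct (Rle_lt_dec x (F c)) as [h | h].
    + left. split; [now apply Val_pieces |]. rewrite (proj1 (Val_c_pieces x c hc)) by assumption.
      apply dwithin_weaken. auto_derive; [exact I | ring].
    + right. pose proof (tends_lt _ _ x hF h) as k. unfold within in k.
      apply filter_imp with (2 := k). intros e he hD. specialize (he hD). lra.
  - destruct (Rle_lt_dec (F c) x) as [h | h].
    + destruct (Rle_lt_dec x (G c)) as [h' | h'].
      * left. split; [now apply Val_pieces |]. rewrite (proj1 (proj2 (Val_c_pieces x c hc))) by lra.
        destruct (Req_dec c 0) as [-> | hne].
        -- (* both boundaries sit at [x]: the second piece is stationary in [F]
              there, and [F] is Lipschitz at [0] *)
           assert (hx : x = F 0) by lra.
           rewrite hx, mid_c_F. clear h h'.
           set (m := fun t => P t * exp (s * F 0) + N t * exp (- (s * F 0))).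
           assert (dm : is_derive m (F 0) 0).
           { unfold m. pose proof (P_derive (F 0)) as dp. pose proof (N_derive (F 0)) as dn.
             auto_derive; [repeat split; eexists; eassumption |].
             derive_value P (F 0) dp.
             derive_value N (F 0) dn. ring. }
           destruct FG_gap0 as [K [hK hg]]. rewrite <- F_0 in hg. unfold within in hg.
           destruct (proj1 (locally_R _ _) hg) as [r [hr hg']].
           rewrite is_derive_dwithin in dm. intros eps he.
           destruct (dm (eps / (K + 1)) ltac:(apply Rdiv_lt_0_compat; lra)) as [d [hd hm]].
           exists (Rmin r (d / (K + 1))).
           assert (hdk : 0 < d / (K + 1)) by (apply Rdiv_lt_0_compat; lra).
           split; [now apply Rmin_glb_lt |]. intros e [[he0 he1] _] hed.
           assert (hr1 := Rlt_le_trans _ _ _ hed (Rmin_l _ _)).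
           assert (hr2 := Rlt_le_trans _ _ _ hed (Rmin_r _ _)).
           rewrite Rminus_0_r in *.
           replace (mid (F 0) e - mid (F 0) 0 - 0 * e) with (m (F e) - m (F 0) - 0 * (F e - F 0))
             by (unfold mid, m; ring).
           destruct (Req_dec e 0) as [-> | hne'].
           { rewrite !Rminus_diag, Rmult_0_r, Rminus_0_r, Rabs_R0. lra. }
           destruct (Rlt_dec e cm) as [hecm | hecm].
           ++ specialize (hg' e ltac:(now rewrite Rminus_0_r) ltac:(lra)).
              destruct hg' as [hg1 _]. rewrite (Rabs_pos_eq e) in * by lra.
              assert (hFd : Rabs (F e - F 0) < d).
              { apply Rle_lt_trans with (K * e); [exact hg1 |].
                apply Rle_lt_trans with ((K + 1) * e); [nra |].
                replace d with ((K + 1) * (d / (K + 1))) by (field; lra).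
                apply Rmult_lt_compat_l; lra. }
              apply Rle_trans with (1 := hm (F e) I hFd).
              replace (eps * e) with (eps / (K + 1) * ((K + 1) * e)) by (field; lra).
              apply Rmult_le_compat_l; [apply Rlt_le, Rdiv_lt_0_compat; lra |]. nra.
           ++ lra.
        -- apply dwithin_weaken. pose proof (D0_cm c hc hne) as hcm.
           destruct (FG_derive c hcm) as [dFc _].
           pose proof (sinh_gap c hcm) as hS. pose proof delta_pos as hdel.
           destruct (sol c hcm) as [h1 [h2 [h3 [h4 [h5 _]]]]].
           pose proof (w_pos (F c) ltac:(lra)) as hw.
           pose proof (P_derive (F c)) as dp. pose proof (N_derive (F c)) as dn.
           unfold mid. auto_derive.
           { repeat split; eexists; eassumption. }
           derive_value F c dFc.
           derive_value P (F c) dp.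
           derive_value N (F c) dn.
           unfold mid_c, dF. rewrite (Rmult_minus_distr_l s x), sinh_minus. field. lra.
      * right. pose proof (tends_lt _ _ x hG h') as k. unfold within in k.
        apply filter_imp with (2 := k). intros e he hD. specialize (he hD). lra.
    + right. pose proof (tends_gt _ _ x hF h) as k. unfold within in k.
      apply filter_imp with (2 := k). intros e he hD. specialize (he hD). lra.
  - destruct (Rle_lt_dec (G c) x) as [h | h].
    + left. split; [now apply Val_pieces |]. rewrite (proj2 (proj2 (Val_c_pieces x c hc))) by assumption.
      apply dwithin_weaken. pose proof (U_derive (x - c)) as d.
      auto_derive; [eexists; exact d |].
      derive_value U (x + - c) d. ring.
    + right. pose proof (tends_gt _ _ x hG h) as k. unfold within in k.
      apply filter_imp with (2 := k). intros e he hD. specialize (he hD). lra.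
Qed.


(** ** Joint regularity *)

Section Joint.

Context {T : Type} (Fil : (T -> Prop) -> Prop) {FF : Filter Fil}
  (y e : T -> R) (x c : R) (hc : D0 c) (ly : tends Fil y x) (le : tends Fil e c)
  (hD : Fil (fun p => D0 (e p))).

Lemma tends_boundaries :
  tends Fil (fun p => F (e p)) (F c) /\ tends Fil (fun p => G (e p)) (G c).
Proof.
  destruct (FG_cont_on c hc) as [hF hG].
  assert (le' : filterlim e Fil (within D0 (locally c))).
  { intros Q hQ. unfold filtermap, within in *.
    apply (filter_imp (F := Fil)) with (2 := filter_and _ _ (le _ hQ) hD).
    intros p [k1 k2]. now apply k1. }
  split; [exact (filterlim_comp _ _ _ e F _ _ _ le' hF) | exact (filterlim_comp _ _ _ e G _ _ _ le' hG)].
Qed.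

Lemma tends_pieces (l : R) (u u1 u2 u3 : R -> R -> R) :
  (forall x c, D0 c -> (x <= F c -> u x c = u1 x c) /\
     (F c <= x <= G c -> u x c = u2 x c) /\ (G c <= x -> u x c = u3 x c)) ->
  (x <= F c -> tends Fil (fun p => u1 (y p) (e p)) l) ->
  (F c <= x <= G c ->
     tends (within (fun p => F (e p) <= y p <= G (e p)) Fil) (fun p => u2 (y p) (e p)) l) ->
  (G c <= x -> tends Fil (fun p => u3 (y p) (e p)) l) ->
  tends Fil (fun p => u (y p) (e p)) l.
Proof.
  intros hu t1 t2 t3. destruct tends_boundaries as [lF lG].
  apply (tends_cover3 Fil (fun p => y p <= F (e p)) (fun p => F (e p) <= y p <= G (e p))
    (fun p => G (e p) <= y p) _ (fun p => u1 (y p) (e p)) (fun p => u2 (y p) (e p))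
    (fun p => u3 (y p) (e p))).
  - apply (filter_imp (F := Fil)) with (2 := hD). intros p hp.
    destruct (hu (y p) (e p) hp) as [k1 [k2 k3]].
    destruct (Rle_lt_dec (y p) (F (e p))); [left; auto |].
    destruct (Rle_lt_dec (y p) (G (e p))); right; [left | right].
    + split; [lra | apply k2; lra].
    + split; [lra | apply k3; lra].
  - destruct (Rle_lt_dec x (F c)) as [h | h].
    + apply tends_within; [assumption | now apply t1].
    + apply tends_within_empty; [assumption |].
      apply (filter_imp (F := Fil)) with (2 := tends_lt_lt _ _ _ _ _ lF ly h). intros p k. lra.
  - destruct (Rle_lt_dec (F c) x) as [h | h].
    + destruct (Rle_lt_dec x (G c)) as [h' | h'].
      * apply t2. lra.
      * apply tends_within_empty; [assumption |].
        apply (filter_imp (F := Fil)) with (2 := tends_lt_lt _ _ _ _ _ lG ly h'). intros p k. lra.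
    + apply tends_within_empty; [assumption |].
      apply (filter_imp (F := Fil)) with (2 := tends_lt_lt _ _ _ _ _ ly lF h). intros p k. lra.
  - destruct (Rle_lt_dec (G c) x) as [h | h].
    + apply tends_within; [assumption | now apply t3].
    + apply tends_within_empty; [assumption |].
      apply (filter_imp (F := Fil)) with (2 := tends_lt_lt _ _ _ _ _ ly lG h). intros p k. lra.
Qed.

Lemma tends_PN : tends Fil (fun p => P (F (e p))) (P (F c)) /\ tends Fil (fun p => N (F (e p))) (N (F c)).
Proof.
  destruct tends_boundaries as [lF _].
  split; apply tends_comp; try exact lF.
  - apply (ex_derive_continuous P). eexists. apply P_derive.
  - apply (ex_derive_continuous N). eexists. apply N_derive.
Qed.

Lemma tends_mid_xx : tends Fil (fun p => mid_xx (y p) (e p)) (mid_xx x c).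
Proof. destruct tends_PN as [lP lN]. unfold mid_xx. tends_auto. Qed.

Lemma tends_shift : tends Fil (fun p => y p - e p) (x - c).
Proof. now apply tends_minus. Qed.

Lemma tends_Val : tends Fil (fun p => Val (y p) (e p)) (Val x c).
Proof.
  destruct tends_PN as [lP lN].
  apply (tends_pieces _ Val (fun x c => delta * x ^ 2) mid (fun x c => U (x - c) + c));
    auto; try apply Val_pieces.
  - intros h. rewrite (proj1 (Val_pieces x c hc)) by assumption. tends_auto.
  - intros h. rewrite (proj1 (proj2 (Val_pieces x c hc))) by assumption.
    apply tends_within; [assumption |]. unfold mid. tends_auto.
  - intros h. rewrite (proj2 (proj2 (Val_pieces x c hc))) by assumption.
    apply tends_plus; [| assumption]. apply tends_comp; [apply U_cont | exact tends_shift].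
Qed.

Lemma tends_Val_x : tends Fil (fun p => Val_x (y p) (e p)) (Val_x x c).
Proof.
  destruct tends_PN as [lP lN].
  apply (tends_pieces _ Val_x (fun x c => 2 * delta * x) mid_x (fun x c => dU (x - c)));
    auto; try apply Val_x_pieces.
  - intros h. rewrite (proj1 (Val_x_pieces x c hc)) by assumption. tends_auto.
  - intros h. rewrite (proj1 (proj2 (Val_x_pieces x c hc))) by assumption.
    apply tends_within; [assumption |]. unfold mid_x. tends_auto.
  - intros h. rewrite (proj2 (proj2 (Val_x_pieces x c hc))) by assumption.
    apply tends_comp; [apply dU_cont | exact tends_shift].
Qed.

(** Where the boundaries meet, the quotient of hyperbolic sines has no limit but
    stays in [[0, 1]], and its prefactor vanishes. *)
Lemma tends_Val_c : tends Fil (fun p => Val_c (y p) (e p)) (Val_c x c).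
Proof.
  destruct tends_boundaries as [lF lG]. pose proof delta_pos as hdel.
  apply (tends_pieces _ Val_c (fun x c => 0) mid_c (fun x c => 1 - dU (x - c)));
    auto; try apply Val_c_pieces.
  - intros h. rewrite (proj1 (Val_c_pieces x c hc)) by assumption. tends_auto.
  - intros h. rewrite (proj1 (proj2 (Val_c_pieces x c hc))) by assumption.
    destruct (Req_dec c 0) as [-> | hne].
    + assert (hz : mid_c x 0 = 0).
      { unfold mid_c. rewrite G_0. unfold Rdiv. ring. }
      rewrite hz.
      apply (tends_squeeze (Fil := within (fun p => F (e p) <= y p <= G (e p)) Fil))
        with (g := fun p => Rabs (2 * delta * (e p + 1 / (2 * delta) - G (e p)))).
      * unfold within. apply (filter_imp (F := Fil)) with (2 := hD). intros p hp hr.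
        rewrite Rminus_0_r. unfold mid_c. rewrite Rabs_mult.
        destruct (Req_dec (e p) 0) as [-> | hne].
        { rewrite G_0. rewrite Rplus_0_l, Rminus_diag, Rmult_0_r, Rabs_R0. lra. }
        pose proof (sinh_gap (e p) (D0_cm _ hp hne)) as hS.
        assert (hq : Rabs (sinh (s * (y p - F (e p))) / sinh (s * (G (e p) - F (e p)))) <= 1).
        { assert (h0 : 0 <= sinh (s * (y p - F (e p)))).
          { destruct (Req_dec (y p) (F (e p))) as [-> | hne'].
            - rewrite Rminus_diag, Rmult_0_r, sinh_0. lra.
            - apply Rlt_le, sinh_pos, Rmult_lt_0_compat; lra. }
          assert (h1 : sinh (s * (y p - F (e p))) <= sinh (s * (G (e p) - F (e p)))).
          { destruct (Req_dec (y p) (G (e p))) as [-> | hne'].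
            - lra.
            - apply Rlt_le, sinh_lt, Rmult_lt_compat_l; lra. }
          rewrite Rabs_pos_eq by (apply Rdiv_le_0_compat; assumption).
          apply Rmult_le_reg_r with (1 := hS). unfold Rdiv. rewrite Rmult_assoc, Rinv_l by lra. lra. }
        rewrite <- (Rmult_1_r (Rabs (2 * delta * (e p + 1 / (2 * delta) - G (e p))))) at 2.
        apply Rmult_le_compat_l; [apply Rabs_pos | exact hq].
      * apply tends_within; [assumption |].
        replace 0 with (Rabs (2 * delta * (0 + 1 / (2 * delta) - G 0))).
        { tends_auto. }
        rewrite G_0, Rplus_0_l, Rminus_diag, Rmult_0_r. apply Rabs_R0.
    + apply tends_within; [assumption |]. pose proof (sinh_gap c (D0_cm c hc hne)).
      unfold mid_c. apply tends_mult; [tends_auto |]. apply tends_div; [lra | |];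
        (apply tends_comp; [apply sinh_cont | tends_auto]).
  - intros h. rewrite (proj2 (proj2 (Val_c_pieces x c hc))) by assumption.
    apply tends_minus; [apply tends_const |]. apply tends_comp; [apply dU_cont | exact tends_shift].
Qed.

(** Off the three curves the point stays, locally, in one of the four open
    regions. *)
Lemma tends_Val_xx : x <> F c -> x <> G c -> x <> phi + c ->
  tends Fil (fun p => Val_xx (y p) (e p)) (Val_xx x c).
Proof.
  intros n1 n2 n3. destruct tends_boundaries as [lF lG].
  pose proof (FG_order c hc) as ord. pose proof x0_lt_phi.
  assert (lp : tends Fil (fun p => phi + e p) (phi + c)) by tends_auto.
  unfold Val_xx at 2. destruct (Rle_dec x (F c)) as [h | h].
  { apply (tends_ext (fun _ => 2 * delta)); [| apply tends_const].
    apply (filter_imp (F := Fil)) with (2 := tends_lt_lt _ _ _ _ _ ly lF ltac:(lra)). intros p k.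
    unfold Val_xx. destruct (Rle_dec (y p) (F (e p))); [reflexivity | lra]. }
  assert (k1 := tends_lt_lt _ _ _ _ _ lF ly ltac:(lra)).
  destruct (Rlt_dec x (G c)) as [h' | h'].
  { apply (tends_ext (fun p => mid_xx (y p) (e p))); [| apply tends_mid_xx].
    apply (filter_imp (F := Fil)) with (2 := filter_and _ _ k1 (tends_lt_lt _ _ _ _ _ ly lG ltac:(lra))).
    intros p [j1 j2]. unfold Val_xx.
    destruct (Rle_dec (y p) (F (e p))); [lra |]. destruct (Rlt_dec (y p) (G (e p))); [reflexivity | lra]. }
  assert (k2 := tends_lt_lt _ _ _ _ _ lG ly ltac:(lra)).
  destruct (Rle_dec x (phi + c)) as [h'' | h''].
  - apply (tends_ext (fun _ => 2 * delta)); [| apply tends_const].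
    apply (filter_imp (F := Fil)) with
      (2 := filter_and _ _ k1 (filter_and _ _ k2 (tends_lt_lt _ _ _ _ _ ly lp ltac:(lra)))).
    intros p [j1 [j2 j3]]. unfold Val_xx.
    destruct (Rle_dec (y p) (F (e p))); [lra |]. destruct (Rlt_dec (y p) (G (e p))); [lra |].
    destruct (Rle_dec (y p) (phi + e p)); [reflexivity | lra].
  - apply (tends_ext (fun p => ddtail (y p - e p))).
    + apply (filter_imp (F := Fil)) with
        (2 := filter_and _ _ k1 (filter_and _ _ k2 (tends_lt_lt _ _ _ _ _ lp ly ltac:(lra)))).
      intros p [j1 [j2 j3]]. unfold Val_xx.
      destruct (Rle_dec (y p) (F (e p))); [lra |]. destruct (Rlt_dec (y p) (G (e p))); [lra |].
      destruct (Rle_dec (y p) (phi + e p)); [lra | reflexivity].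
    + unfold ddtail. pose proof tends_shift. tends_auto.
Qed.

Lemma Val_xx_bounded : exists M, Fil (fun p => Rabs (Val_xx (y p) (e p)) <= M).
Proof.
  pose proof tends_mid_xx as l1.
  assert (l2 : tends Fil (fun p => ddtail (y p - e p)) (ddtail (x - c))).
  { unfold ddtail. pose proof tends_shift. tends_auto. }
  assert (k1 := proj1 (tends_eps _ _) l1 1 Rlt_0_1).
  assert (k2 := proj1 (tends_eps _ _) l2 1 Rlt_0_1).
  exists (Rabs (2 * delta) + (Rabs (mid_xx x c) + 1) + (Rabs (ddtail (x - c)) + 1)).
  apply (filter_imp (F := Fil)) with (2 := filter_and _ _ k1 k2). intros p [j1 j2].
  pose proof (Rabs_pos (2 * delta)). pose proof (Rabs_pos (mid_xx x c)).
  pose proof (Rabs_pos (ddtail (x - c))).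
  pose proof (Rabs_triang_inv (mid_xx (y p) (e p)) (mid_xx x c)).
  pose proof (Rabs_triang_inv (ddtail (y p - e p)) (ddtail (x - c))).
  unfold Val_xx. destruct (Rle_dec (y p) (F (e p))); [lra |].
  destruct (Rlt_dec (y p) (G (e p))); [lra |].
  destruct (Rle_dec (y p) (phi + e p)); lra.
Qed.

End Joint.

Lemma Val_x_derive (x c : R) : D0 c -> x <> F c -> x <> G c -> x <> phi + c ->
  is_derive (fun z => Val_x z c) x (Val_xx x c).
Proof.
  intros hc n1 n2 n3. pose proof (FG_order c hc) as ord. pose proof x0_lt_phi.
  unfold Val_xx. destruct (Rle_dec x (F c)) as [h | h].
  { apply (is_derive_ext_loc (fun z => 2 * delta * z)).
    - apply filter_imp with (2 := locally_lt x (F c) ltac:(lra)). intros z hz.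
      symmetry. apply Val_x_pieces; [assumption | lra].
    - auto_derive; [exact I | ring]. }
  assert (r1 : F c < x) by lra.
  destruct (Rlt_dec x (G c)) as [h' | h'].
  { apply (is_derive_ext_loc (fun z => mid_x z c)); [| apply mid_x_derive].
    apply filter_imp with
      (2 := filter_and _ _ (locally_gt x (F c) r1) (locally_lt x (G c) h')).
    intros z [k1 k2]. symmetry. apply (proj1 (proj2 (Val_x_pieces z c hc))). lra. }
  assert (r2 : G c < x) by lra.
  destruct (Rle_dec x (phi + c)) as [h'' | h''].
  - assert (r3 : x < phi + c) by lra.
    apply (is_derive_ext_loc (fun z => 2 * delta * (z - c))).
    + apply filter_imp with
        (2 := filter_and _ _ (locally_gt x (G c) r2) (locally_lt x (phi + c) r3)).
      intros z [k1 k2]. rewrite (proj2 (proj2 (Val_x_pieces z c hc))) by lra.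
      symmetry. apply dU_left. lra.
    + auto_derive; [exact I | ring].
  - assert (r3 : phi + c < x) by lra.
    apply (is_derive_ext_loc (fun z => dtail (z - c))).
    + apply filter_imp with
        (2 := filter_and _ _ (locally_gt x (G c) r2) (locally_gt x (phi + c) r3)).
      intros z [k1 k2]. rewrite (proj2 (proj2 (Val_x_pieces z c hc))) by lra.
      symmetry. apply dU_right. lra.
    + pose proof (dtail_derive (x - c)) as d. auto_derive; [eexists; exact d |].
      derive_value dtail (x + - c) d. ring.
Qed.

(** ** The inequalities *)

(** [Win] is concave in [x] and positive at both ends of the interval. *)
Lemma Win_right (x c : R) : D0 c -> G c <= x <= phi + c -> 0 < Win x c.
Proof.
  intros hc hx. pose proof (FG_order c hc) as ord. pose proof x0_lt_phi.
  assert (h0 : 0 < Win (G c) c).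
  { destruct (Req_dec c 0) as [-> | hne].
    - rewrite G_0. unfold Win. rewrite Rmult_0_r, Rmult_0_l, Rplus_0_r. apply w_pos.
      rewrite G_0 in ord. lra.
    - apply (sol c (D0_cm c hc hne)). }
  destruct (Req_dec x (G c)) as [-> | hne]; [assumption |].
  unfold D0 in hc. apply (Win_pos_after (G c)); lra.
Qed.

(** On the middle interval [- mid] satisfies [u'' = s ^ 2 * u + k] with
    [k = s ^ 2 * mu * x ^ 2 >= 0], and is nonpositive at both ends. *)
Lemma Val_nonneg (x c : R) : D0 c -> 0 <= Val x c.
Proof.
  intros hc. pose proof (FG_order c hc) as ord. pose proof delta_pos as hdel.
  destruct (Val_pieces x c hc) as [k1 [k2 k3]]. destruct (mid_F c) as [v1 _].
  destruct (mid_G c hc) as [v2 _]. pose proof (pow2_ge_0 x). pose proof (pow2_ge_0 (G c - c)).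
  pose proof (pow2_ge_0 (F c)).
  assert (hc' : 0 <= c) by (unfold D0 in hc; lra).
  destruct (Rle_lt_dec x (F c)) as [h | h].
  { rewrite k1 by assumption. nra. }
  destruct (Rle_lt_dec (G c) x) as [h' | h'].
  { rewrite k3 by assumption. pose proof (U_nonneg (x - c)). lra. }
  rewrite k2 by lra.
  assert (- mid x c <= 0); [| lra].
  (* [G c + 1]: the right-hand side does not change sign on the interval *)
  apply (max_principle (fun x => - mid x c) (fun x => - mid_x x c)
    (fun x => s ^ 2 * (mu * x ^ 2)) (F c) (G c + 1) (G c)); try lra.
  - intros z _. apply (is_derive_opp (fun x => mid x c)). apply mid_derive.
  - intros z _.
    replace (s ^ 2 * - mid z c + s ^ 2 * (mu * z ^ 2)) with (- mid_xx z c).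
    + apply (is_derive_opp (fun x => mid_x x c)). apply mid_x_derive.
    + unfold mid_xx, mid. field. lra.
  - intros z _ _. pose proof (pow2_ge_0 z). assert (0 <= mu * z ^ 2) by nra. nra.
  - intros z hz hm. lra.
  - rewrite v1. nra.
  - rewrite v2. nra.
Qed.

Lemma Val_le (x c : R) :
  (forall z e, 0 < e < c0 -> F e <= z <= G e -> mid z e <= delta * z ^ 2) ->
  D0 c -> 0 <= x -> Val x c <= delta * x ^ 2.
Proof.
  intros hp hc hx. pose proof (FG_order c hc) as ord. pose proof delta_pos as hdel.
  destruct (Val_pieces x c hc) as [k1 [k2 k3]].
  destruct (Rle_lt_dec x (F c)) as [h | h].
  { rewrite k1 by assumption. lra. }
  destruct (Rle_lt_dec (G c) x) as [h' | h'].
  - rewrite k3 by assumption. unfold D0 in hc.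
    assert (hz : 0 <= x - c).
    { assert (0 < 1 / (2 * delta)) by (apply Rdiv_lt_0_compat; lra). lra. }
    pose proof (U_le (x - c) hz).
    assert (hxc : 1 <= 2 * delta * (x - c)).
    { replace 1 with (2 * delta * (1 / (2 * delta))) by (field; lra).
      apply Rmult_le_compat_l; lra. }
    assert (0 <= c * (2 * delta * (x - c) - 1)) by (apply Rmult_le_pos; lra).
    assert (0 <= delta * c ^ 2) by nra.
    replace (delta * x ^ 2) with (delta * (x - c) ^ 2 + c + c * (2 * delta * (x - c) - 1)
      + delta * c ^ 2) by ring. lra.
  - rewrite k2 by lra. apply hp; [| lra].
    (* the middle interval is empty for [c = 0] *)
    destruct (Req_dec c 0) as [-> | hne]; [| unfold D0 in hc; lra].
    rewrite F_0, G_0 in *. lra.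
Qed.

(** Equality holds to the right of [G c], and [F c <= 1 / (2 * delta)] gives the
    inequality to the left of [F c]. On the middle piece [Val_x + Val_c - 1] solves
    the equation of [max_principle] with [k x = s ^ 2 * (1 - 2 * mu * x)]; smooth
    fit along the moving boundary makes its slope at [G c] equal to
    [s ^ 2 * Win * (G' - 1)]. *)
Lemma gradient_le (x c : R) : 0 < c < c0 -> Val_x x c + Val_c x c <= 1.
Proof.
  intros hc. assert (hD : D0 c) by (unfold D0; lra).
  pose proof (FG_order c hD) as ord. pose proof delta_pos as hdel. pose proof (F_lt c hc) as hF.
  destruct (Val_x_pieces x c hD) as [k1 [k2 k3]]. destruct (Val_c_pieces x c hD) as [j1 [j2 j3]].
  assert (hF1 : 2 * delta * F c < 1).
  { replace 1 with (2 * delta * (1 / (2 * delta))) by (field; lra).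
    apply Rmult_lt_compat_l; lra. }
  destruct (Rle_lt_dec x (F c)) as [h | h].
  { rewrite k1, j1 by assumption. assert (2 * delta * x <= 2 * delta * F c) by (apply Rmult_le_compat_l; lra).
    lra. }
  destruct (Rle_lt_dec (G c) x) as [h' | h'].
  { rewrite k3, j3 by assumption. lra. }
  rewrite k2, j2 by lra.
  pose proof (sinh_gap c ltac:(lra)) as hS.
  destruct (mid_F c) as [_ vF]. destruct (mid_G c hD) as [_ [vG vG']].
  set (q := 2 * delta * (c + 1 / (2 * delta) - G c) / sinh (s * (G c - F c))).
  assert (eq : forall z, mid_c z c = q * sinh (s * (z - F c))).
  { intros z. unfold mid_c, q. field. lra. }
  assert (mid_x x c + mid_c x c - 1 <= 0); [| lra].
  apply (max_principle (fun z => mid_x z c + mid_c z c - 1)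
    (fun z => mid_xx z c + q * s * cosh (s * (z - F c)))
    (fun z => s ^ 2 * (1 - 2 * mu * z)) (F c) (1 / (2 * mu)) (G c)); try lra.
  - intros z _. pose proof (mid_x_derive z c) as d.
    apply (is_derive_ext (fun z => mid_x z c + q * sinh (s * (z - F c)) - 1)).
    { intros t. now rewrite eq. }
    auto_derive; [eexists; exact d |].
    replace (Derive (fun x => mid_x x c) z) with (mid_xx z c)
      by (symmetry; apply is_derive_unique; exact d).
    change (z + - F c) with (z - F c). ring.
  - intros z _. rewrite eq. unfold mid_xx, mid_x. auto_derive; [exact I |].
    change (z + - F c) with (z - F c). ring.
  - intros z _ hz. assert (2 * mu * z <= 1).
    { replace 1 with (2 * mu * (1 / (2 * mu))) by (field; lra). apply Rmult_le_compat_l; lra. }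
    assert (0 <= s ^ 2) by nra. nra.
  - intros z _ hz. assert (1 <= 2 * mu * z).
    { replace 1 with (2 * mu * (1 / (2 * mu))) by (field; lra). apply Rmult_le_compat_l; lra. }
    assert (0 <= s ^ 2) by nra. nra.
  - rewrite vF, mid_c_F. lra.
  - rewrite vG, mid_c_G by assumption. lra.
  - intros _. rewrite vG'.
    destruct (sol c ltac:(lra)) as [_ [_ [_ [_ [_ [hW _]]]]]].
    replace (2 * delta - s ^ 2 * Win (G c) c + q * s * cosh (s * (G c - F c)))
      with (s ^ 2 * Win (G c) c * (dG (F c) (G c) c - 1)).
    + pose proof (dG_gt c hc). assert (0 < s ^ 2) by nra.
      apply Rmult_le_pos; [| lra]. apply Rmult_le_pos; lra.
    + unfold dG, q. field. repeat split; lra.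
Qed.

(** The left-hand side [v'' / 2 + lambda * x ^ 2 - alpha * v] for [v = Val]. *)
Definition gen (x c : R) : R :=
  1 / 2 * Val_xx x c + s ^ 2 / 2 * mu * x ^ 2 - s ^ 2 / 2 * Val x c.

Lemma gen_left (x c : R) : D0 c -> x < F c -> gen x c = s ^ 2 / 2 * w x.
Proof.
  intros hc hx. unfold gen. rewrite (proj1 (Val_pieces x c hc)) by lra.
  unfold Val_xx. destruct (Rle_dec x (F c)); [| lra]. unfold w, beta. field. lra.
Qed.

Lemma gen_middle (x c : R) : D0 c -> F c < x < G c -> gen x c = 0.
Proof.
  intros hc hx. unfold gen. rewrite (proj1 (proj2 (Val_pieces x c hc))) by lra.
  unfold Val_xx. destruct (Rle_dec x (F c)); [lra |]. destruct (Rlt_dec x (G c)); [| lra].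
  unfold mid_xx, mid. field. lra.
Qed.

Lemma gen_nonneg (x c : R) : D0 c -> 0 <= x -> x <> F c -> x <> G c -> 0 <= gen x c.
Proof.
  intros hc hx n1 n2. pose proof (FG_order c hc) as ord. pose proof x0_lt_phi as hx0.
  assert (hs2 : 0 < s ^ 2 / 2) by nra.
  destruct (Rlt_dec x (F c)) as [h | h].
  { rewrite gen_left by assumption. pose proof (w_pos x ltac:(lra)). nra. }
  destruct (Rlt_dec x (G c)) as [h' | h'].
  { rewrite gen_middle by (assumption || lra). lra. }
  assert (hc' : 0 <= c) by (unfold D0 in hc; lra).
  unfold gen. rewrite (proj2 (proj2 (Val_pieces x c hc))) by lra.
  unfold Val_xx. destruct (Rle_dec x (F c)); [lra |]. destruct (Rlt_dec x (G c)); [lra |].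
  destruct (Rle_dec x (phi + c)) as [h'' | h''].
  - rewrite U_left by lra. pose proof (Win_right x c hc ltac:(lra)).
    replace (1 / 2 * (2 * delta) + s ^ 2 / 2 * mu * x ^ 2 - s ^ 2 / 2 * (delta * (x - c) ^ 2 + c))
      with (s ^ 2 / 2 * Win x c).
    + nra.
    + unfold Win, w, xc, beta. pose proof delta_pos. field. lra.
  - rewrite U_right by lra. pose proof (Wout_nonneg x c hc' ltac:(lra)).
    replace (1 / 2 * ddtail (x - c) + s ^ 2 / 2 * mu * x ^ 2 - s ^ 2 / 2 * (tail (x - c) + c))
      with (s ^ 2 / 2 * Wout x c).
    + nra.
    + unfold ddtail, tail, Wout. field. lra.
Qed.

(** In each open region one of the three factors vanishes. *)
Lemma complementarity (x c : R) : 0 < c < c0 -> x <> F c -> x <> G c ->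
  (delta * x ^ 2 - Val x c) * (1 - Val_x x c - Val_c x c) * gen x c = 0.
Proof.
  intros hc n1 n2. assert (hD : D0 c) by (unfold D0; lra).
  destruct (Rlt_dec x (F c)) as [h | h].
  { rewrite (proj1 (Val_pieces x c hD)) by lra. ring. }
  destruct (Rlt_dec x (G c)) as [h' | h'].
  { rewrite gen_middle by (assumption || lra). ring. }
  rewrite (proj2 (proj2 (Val_x_pieces x c hD))), (proj2 (proj2 (Val_c_pieces x c hD))) by lra. ring.
Qed.

(** Outside the middle interval [Val_x] lies between [0] and [2 * delta * x]; on it
    the coefficients are bounded since [F c] stays in [[0, phi]], and the
    exponentials since [G c < phi + c0]. *)
Lemma Val_x_growth : exists K, 0 < K /\
  forall x c, D0 c -> 0 <= x -> Rabs (Val_x x c) <= K * (1 + x).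
Proof.
  pose proof delta_pos as hdel. pose proof x0_lt_phi as hx0.
  set (M := Rabs (P 0) + (Rabs (N 0) + Rabs (N phi))).
  set (E := exp (s * (phi + Rabs c0)) + 1).
  assert (hM : 0 <= M).
  { unfold M. pose proof (Rabs_pos (P 0)). pose proof (Rabs_pos (N 0)).
    pose proof (Rabs_pos (N phi)). lra. }
  assert (hE : 1 < E) by (unfold E; pose proof (exp_pos (s * (phi + Rabs c0))); lra).
  assert (hsME : 0 <= s * (M * E)) by (apply Rmult_le_pos; [lra | apply Rmult_le_pos; lra]).
  exists (2 * delta + s * (M * E)). split; [lra |].
  intros x c hc hx. pose proof (FG_order c hc) as ord.
  assert (hlin : Rabs (Val_x x c) <= 2 * delta * x + s * (M * E)).
  2: { assert (0 <= s * (M * E) * x) by (apply Rmult_le_pos; lra). nra. }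
  destruct (Val_x_pieces x c hc) as [k1 [k2 k3]].
  destruct (Rle_lt_dec x (F c)) as [h | h].
  { rewrite k1 by assumption. rewrite Rabs_pos_eq by nra. lra. }
  destruct (Rle_lt_dec (G c) x) as [h' | h'].
  { rewrite k3 by assumption. unfold D0 in hc.
    assert (0 < 1 / (2 * delta)) by (apply Rdiv_lt_0_compat; lra).
    pose proof (dU_bounds (x - c) ltac:(lra)). rewrite Rabs_pos_eq by lra. nra. }
  rewrite k2 by lra. unfold mid_x.
  assert (bP : Rabs (P (F c)) <= M).
  { assert (P 0 <= P (F c) <= 0).
    { rewrite <- P_phi at 2. split; left; apply P_incr; lra. }
    unfold M. pose proof (Rabs_pos (N 0)). pose proof (Rabs_pos (N phi)).
    rewrite (Rabs_left1 (P (F c))), (Rabs_left1 (P 0)) by lra. lra. }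
  assert (bN : Rabs (N (F c)) <= M).
  { assert (N phi <= N (F c) <= N 0).
    { pose proof (N_compare (F c) phi ltac:(lra) ltac:(lra) ltac:(lra)) as [q1 _].
      pose proof (N_compare 0 (F c) ltac:(lra) ltac:(lra) ltac:(lra)) as [q2 _].
      pose proof (P_incr (F c) phi ltac:(lra) ltac:(lra) ltac:(lra)).
      pose proof (P_incr 0 (F c) ltac:(lra) ltac:(lra) ltac:(lra)).
      pose proof (exp_pos (2 * s * F c)). pose proof (exp_pos (2 * s * 0)).
      split; nra. }
    unfold M. pose proof (Rabs_pos (P 0)).
    pose proof (Rle_abs (N 0)). pose proof (Rle_abs (- N phi)) as hh. rewrite Rabs_Ropp in hh.
    pose proof (Rabs_pos (N 0)). pose proof (Rabs_pos (N phi)).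
    apply Rabs_le. lra. }
  assert (bE : exp (s * x) + exp (- (s * x)) <= E).
  { unfold E. apply Rplus_le_compat.
    - apply exp_le, Rmult_le_compat_l; [lra |]. unfold D0 in hc. pose proof (Rle_abs c0). lra.
    - rewrite <- exp_0. apply exp_le. nra. }
  eapply Rle_trans; [apply Rabs_triang |]. apply Rplus_le_compat.
  { rewrite Rabs_pos_eq by nra. apply Rmult_le_compat_r; lra. }
  rewrite Rabs_mult, (Rabs_pos_eq s) by lra. apply Rmult_le_compat_l; [lra |].
  unfold Rminus. eapply Rle_trans; [apply Rabs_triang |].
  rewrite Rabs_Ropp, !Rabs_mult, (Rabs_pos_eq (exp (s * x))), (Rabs_pos_eq (exp (- (s * x))))
    by (left; apply exp_pos).
  pose proof (exp_pos (s * x)). pose proof (exp_pos (- (s * x))).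
  apply Rle_trans with (M * (exp (s * x) + exp (- (s * x)))).
  - assert (Rabs (P (F c)) * exp (s * x) <= M * exp (s * x)) by (apply Rmult_le_compat_r; lra).
    assert (Rabs (N (F c)) * exp (- (s * x)) <= M * exp (- (s * x))) by (apply Rmult_le_compat_r; lra).
    lra.
  - apply Rmult_le_compat_l; lra.
Qed.

End Value.
End Family.


(** * From the convex minorant to the smooth-fit equations *)

Section Minorant.

Local Notation al := (s ^ 2 / 2).
Local Notation la := (s ^ 2 / 2 * mu).

Context (phi_f0 : f0 al delta la = phi).

Lemma s2a_s : s2a al = s.
Proof.
  unfold s2a. replace (2 * (s ^ 2 / 2)) with (s ^ 2) by field. apply sqrt_pow2. lra.
Qed.

Lemma Psi_eq (x : R) : Psi al x = exp (2 * s * x).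
Proof. unfold Psi. now rewrite s2a_s. Qed.

Lemma Psi_inv_eq (y : R) : Psi_inv al y = ln y / (2 * s).
Proof. unfold Psi_inv. now rewrite s2a_s. Qed.

Lemma Psi_K (x : R) : Psi_inv al (Psi al x) = x.
Proof. rewrite Psi_eq, Psi_inv_eq, ln_exp. field. lra. Qed.

Lemma Psi_inv_K (y : R) : 0 < y -> Psi al (Psi_inv al y) = y.
Proof.
  intros hy. rewrite Psi_eq, Psi_inv_eq.
  replace (2 * s * (ln y / (2 * s))) with (ln y) by (field; lra). now apply exp_ln.
Qed.

Lemma Psi_pos (x : R) : 0 < Psi al x.
Proof. rewrite Psi_eq. apply exp_pos. Qed.

Lemma Psi_lt (x y : R) : x < y -> Psi al x < Psi al y.
Proof. intros h. rewrite !Psi_eq. apply exp_increasing. nra. Qed.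

Lemma Psi_lt_inv (x y : R) : Psi al x < Psi al y -> x < y.
Proof.
  intros h. apply Rnot_le_lt. intros [hlt | ->]; [| lra].
  pose proof (Psi_lt y x hlt). lra.
Qed.

Lemma Psi_0 : Psi al 0 = 1.
Proof. rewrite Psi_eq, Rmult_0_r. apply exp_0. Qed.

(** In the coordinate [y = exp (2 * s * x)] a tangent line
    [slope * y + intercept] of [y -> exp (s * x) * r x] is, after division by
    [exp (s * x)], the combination of [exp (s * x)] and [exp (- (s * x))] that
    fits [r] smoothly; hence tangents turn into [P], [N] and their analogues. *)
Lemma coord_derive (r : R -> R) (x r' : R) : is_derive r x r' ->
  is_derive (fun y => exp (s2a al * Psi_inv al y) * r (Psi_inv al y)) (Psi al x)
    (exp (- (s * x)) / (2 * s) * (r' + s * r x)).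
Proof.
  intros d. apply (is_derive_ext (fun y => exp (s * (ln y / (2 * s))) * r (ln y / (2 * s)))).
  { intros t. now rewrite s2a_s, Psi_inv_eq. }
  assert (hx : ln (Psi al x) / (2 * s) = x) by (rewrite <- Psi_inv_eq; apply Psi_K).
  pose proof (Psi_pos x) as hp.
  assert (inner : is_derive (fun y => ln y / (2 * s)) (Psi al x) (/ (2 * s) / Psi al x)).
  { auto_derive; [assumption |]. field. lra. }
  assert (d' : is_derive (fun y => r (ln y / (2 * s))) (Psi al x) (/ (2 * s) / Psi al x * r')).
  { apply (is_derive_comp r (fun y => ln y / (2 * s)) (Psi al x) r'); [| exact inner].
    rewrite hx. exact d. }
  assert (e : is_derive (fun y => exp (s * (ln y / (2 * s)))) (Psi al x)
                (/ (2 * s) / Psi al x * (s * exp (s * x)))).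
  { apply (is_derive_comp (fun z => exp (s * z)) (fun y => ln y / (2 * s)) (Psi al x));
      [| exact inner].
    rewrite hx. auto_derive; [exact I | ring]. }
  apply (is_derive_congr (fun y => exp (s * (ln y / (2 * s))) * r (ln y / (2 * s))) _ _
    (/ (2 * s) / Psi al x * (s * exp (s * x)) * r (ln (Psi al x) / (2 * s))
     + exp (s * (ln (Psi al x) / (2 * s))) * (/ (2 * s) / Psi al x * r'))).
  - reflexivity.
  - rewrite hx. rewrite Psi_eq, exp_Ropp. replace (2 * s * x) with (s * x + s * x) by ring.
    rewrite exp_plus. field. repeat split; first [lra | apply Rgt_not_eq, exp_pos].
  - apply (is_derive_mult (fun y => exp (s * (ln y / (2 * s))))
      (fun y => r (ln y / (2 * s)))); [exact e | exact d' | intros; apply Rmult_comm].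
Qed.

Lemma coord_intercept (v v' x : R) :
  exp (s2a al * Psi_inv al (Psi al x)) * v
    - exp (- (s * x)) / (2 * s) * (v' + s * v) * Psi al x
  = exp (s * x) / (2 * s) * (- v' + s * v).
Proof.
  rewrite s2a_s, Psi_K, Psi_eq, exp_Ropp. replace (2 * s * x) with (s * x + s * x) by ring.
  rewrite exp_plus. field. repeat split; first [lra | apply Rgt_not_eq, exp_pos].
Qed.

(** ** The left regime *)

Lemma hl_eq (x : R) : hl al delta la x = beta * x ^ 2 - 2 * mu / s ^ 2.
Proof. unfold hl, beta. field. lra. Qed.

Lemma hl_derive (x : R) : is_derive (hl al delta la) x (2 * beta * x).
Proof.
  apply (is_derive_ext (fun x => beta * x ^ 2 - 2 * mu / s ^ 2)).
  { intros t. now rewrite hl_eq. }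
  auto_derive; [exact I | ring].
Qed.

Lemma dHl_Psi (x : R) : dHl al delta la (Psi al x) = P x.
Proof.
  unfold dHl. apply is_derive_unique. unfold Hl.
  apply (is_derive_congr _ _ _ _ _ (fun _ => eq_refl)) with (2 := coord_derive _ x _ (hl_derive x)).
  rewrite hl_eq. unfold P. field. lra.
Qed.

Lemma Hl_intercept (x : R) :
  Hl al delta la (Psi al x) - dHl al delta la (Psi al x) * Psi al x = N x.
Proof.
  rewrite dHl_Psi. unfold Hl.
  replace (P x) with (exp (- (s * x)) / (2 * s) * (2 * beta * x + s * hl al delta la x)).
  - rewrite Psi_K at 2. rewrite coord_intercept, hl_eq. unfold N. field. lra.
  - rewrite hl_eq. unfold P. field. lra.
Qed.

(** ** The right regime *)

Lemma hr1_eq (x c : R) : hr1 al delta la x c =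
  delta * c * (c - 2 * x) + beta * x ^ 2 + c - 2 * mu / s ^ 2.
Proof. unfold hr1, beta. field. lra. Qed.

Lemma B0_eq : B0 al delta la = - (2 * beta * phi / s * exp (s * phi)).
Proof.
  unfold B0. rewrite phi_f0, s2a_s, (Rmult_comm phi s). unfold beta. field. lra.
Qed.

Lemma hr2_eq (x c : R) : hr2 al delta la x c =
  mu * c * (c - 2 * x) + c - 2 * beta * phi / s * exp (- (s * (x - phi - c))).
Proof.
  unfold hr2. rewrite B0_eq, s2a_s.
  replace (- (s * (x - phi - c))) with (s * phi + - (x - c) * s) by ring.
  rewrite exp_plus. field. lra.
Qed.

Lemma hr_corner (c : R) : hr1 al delta la (phi + c) c = hr2 al delta la (phi + c) c.
Proof.
  rewrite hr1_eq, hr2_eq. replace (- (s * (phi + c - phi - c))) with 0 by ring. rewrite exp_0.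
  replace (2 * mu / s ^ 2) with (beta * phi ^ 2 + 2 * beta * phi / s)
    by (rewrite <- phi_root; field; lra).
  unfold beta. field. lra.
Qed.

Lemma hr_left (x c : R) : x <= phi + c -> hr al delta la x c = hr1 al delta la x c.
Proof.
  intros h. unfold hr. rewrite phi_f0. destruct (Rle_dec x (phi + c)); [reflexivity | lra].
Qed.

Lemma hr_right (x c : R) : phi + c <= x -> hr al delta la x c = hr2 al delta la x c.
Proof.
  intros h. unfold hr. rewrite phi_f0. destruct (Rle_dec x (phi + c)); [| reflexivity].
  replace x with (phi + c) by lra. apply hr_corner.
Qed.

Lemma hr1_derive (x c : R) : is_derive (fun z => hr1 al delta la z c) x (2 * beta * x - 2 * delta * c).
Proof.
  apply (is_derive_ext (fun x => delta * c * (c - 2 * x) + beta * x ^ 2 + c - 2 * mu / s ^ 2)).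
  { intros t. now rewrite hr1_eq. }
  auto_derive; [exact I | ring].
Qed.

Lemma hr2_derive (x c : R) : is_derive (fun z => hr2 al delta la z c) x
  (2 * beta * phi * exp (- (s * (x - phi - c))) - 2 * mu * c).
Proof.
  apply (is_derive_ext (fun x => mu * c * (c - 2 * x) + c
     - 2 * beta * phi / s * exp (- (s * (x - phi - c))))).
  { intros t. now rewrite hr2_eq. }
  auto_derive; [exact I |]. unfold Rminus. field. lra.
Qed.

Lemma hr_derive (x c l : R) :
  (x <= phi + c -> l = 2 * beta * x - 2 * delta * c) ->
  (phi + c <= x -> l = 2 * beta * phi * exp (- (s * (x - phi - c))) - 2 * mu * c) ->
  is_derive (fun z => hr al delta la z c) x l.
Proof.
  intros e1 e2. apply is_derive_dwithin.
  apply (dwithin_cover3 _ (fun z => z <= phi + c) (fun z => phi + c <= z) (fun _ => False)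
    _ (fun z => hr1 al delta la z c) (fun z => hr2 al delta la z c) (fun _ => 0)).
  - intros z _. destruct (Rle_lt_dec z (phi + c)).
    + left. split; [assumption | now apply hr_left].
    + right; left. split; [lra | apply hr_right; lra].
  - destruct (Rle_lt_dec x (phi + c)) as [h | h].
    + left. split; [now apply hr_left |]. rewrite e1 by assumption.
      apply dwithin_weaken, hr1_derive.
    + right. apply filter_imp with (2 := locally_gt x _ h). intros y hy _. lra.
  - destruct (Rle_lt_dec (phi + c) x) as [h | h].
    + left. split; [now apply hr_right |]. rewrite e2 by assumption.
      apply dwithin_weaken, hr2_derive.
    + right. apply filter_imp with (2 := locally_lt x _ h). intros y hy _. lra.
  - right. apply filter_forall. tauto.
Qed.

Lemma hr_derive_left (x c : R) : x <= phi + c ->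
  is_derive (fun z => hr al delta la z c) x (2 * beta * x - 2 * delta * c).
Proof.
  intros h. apply hr_derive; [reflexivity |]. intros h'. replace x with (phi + c) by lra.
  replace (- (s * (phi + c - phi - c))) with 0 by ring. rewrite exp_0. unfold beta. ring.
Qed.

Lemma hr_derive_right (x c : R) : phi + c <= x ->
  is_derive (fun z => hr al delta la z c) x
    (2 * beta * phi * exp (- (s * (x - phi - c))) - 2 * mu * c).
Proof.
  intros h. apply hr_derive; [| reflexivity]. intros h'. replace x with (phi + c) by lra.
  replace (- (s * (phi + c - phi - c))) with 0 by ring. rewrite exp_0. unfold beta. ring.
Qed.

Lemma Hr_derive_left (x c : R) : x <= phi + c ->
  is_derive (fun y => Hr al delta la y c) (Psi al x) (Pin x c).
Proof.
  intros h. unfold Hr.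
  apply (is_derive_congr _ _ _ _ _ (fun _ => eq_refl)) with
    (2 := coord_derive (fun z => hr al delta la z c) x _ (hr_derive_left x c h)).
  rewrite hr_left, hr1_eq by assumption. unfold Pin, P, xc, beta.
  pose proof delta_pos. field. lra.
Qed.

Lemma Hr_derive_right (x c : R) : phi + c <= x ->
  is_derive (fun y => Hr al delta la y c) (Psi al x) (Pout x c).
Proof.
  intros h. unfold Hr.
  apply (is_derive_congr _ _ _ _ _ (fun _ => eq_refl)) with
    (2 := coord_derive (fun z => hr al delta la z c) x _ (hr_derive_right x c h)).
  rewrite hr_right, hr2_eq by assumption. unfold Pout. field. lra.
Qed.

Lemma dHr_left (x c : R) : x <= phi + c -> dHr al delta la (Psi al x) c = Pin x c.
Proof. intros h. apply is_derive_unique. now apply Hr_derive_left. Qed.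

Lemma dHr_right (x c : R) : phi + c <= x -> dHr al delta la (Psi al x) c = Pout x c.
Proof. intros h. apply is_derive_unique. now apply Hr_derive_right. Qed.

Lemma Hr_intercept_left (x c : R) : x <= phi + c ->
  Hr al delta la (Psi al x) c - Pin x c * Psi al x = Nin x c.
Proof.
  intros h. unfold Hr. pose proof delta_pos.
  replace (Pin x c) with
    (exp (- (s * x)) / (2 * s) * (2 * beta * x - 2 * delta * c + s * hr al delta la x c)).
  - rewrite Psi_K at 2. rewrite coord_intercept, hr_left, hr1_eq by assumption.
    unfold Nin, N, xc, beta. field. lra.
  - rewrite hr_left, hr1_eq by assumption. unfold Pin, P, xc, beta. field. lra.
Qed.

Lemma Hr_intercept_right (x c : R) : phi + c <= x ->
  Hr al delta la (Psi al x) c - Pout x c * Psi al x = Nout x c.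
Proof.
  intros h. unfold Hr.
  replace (Pout x c) with (exp (- (s * x)) / (2 * s)
    * (2 * beta * phi * exp (- (s * (x - phi - c))) - 2 * mu * c + s * hr al delta la x c)).
  - rewrite Psi_K at 2. rewrite coord_intercept, hr_right, hr2_eq by assumption.
    unfold Nout. replace (- (s * (x - phi - c))) with (s * (phi + c) + - (s * x)) by ring.
    rewrite exp_plus, exp_Ropp. field. repeat split; first [lra | apply Rgt_not_eq, exp_pos].
  - rewrite hr_right, hr2_eq by assumption. unfold Pout. field. lra.
Qed.

(** ** Convexity and the sign of [Win] *)

Lemma Pin_mono (k x y c : R) : x < y -> (forall z, x <= z <= y -> 0 < k * Win z c) ->
  k * Pin x c < k * Pin y c.
Proof.
  intros hxy hW.
  apply (incr_lt (fun z => k * Pin z c) (fun z => k * (exp (- (s * z)) * (s / 2 * Win z c))) x y hxy).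
  - intros z _. apply (is_derive_scal (fun z => Pin z c) z k). apply Pin_derive.
  - intros z hz. replace (k * (exp (- (s * z)) * (s / 2 * Win z c)))
      with (exp (- (s * z)) * (s / 2 * (k * Win z c))) by ring.
    pose proof (exp_pos (- (s * z))). specialize (hW z hz).
    apply Rmult_lt_0_compat; [assumption |]. apply Rmult_lt_0_compat; lra.
Qed.

(** With [k = 1] and [k = - 1] this relates the sign of [Win] to convexity and to
    concavity of [Hr]. *)
Lemma Hr_midpoint (k a b c : R) : a < b -> b <= phi + c ->
  (forall x, a <= x <= b -> 0 < k * Win x c) ->
  k * Hr al delta la (/ 2 * Psi al a + (1 - / 2) * Psi al b) c
  < / 2 * (k * Hr al delta la (Psi al a) c) + (1 - / 2) * (k * Hr al delta la (Psi al b) c).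
Proof.
  intros hab hb hW.
  assert (hin : forall y, Psi al a <= y <= Psi al b ->
            exists x, a <= x <= b /\ y = Psi al x).
  { intros y hy. exists (Psi_inv al y). pose proof (Psi_pos a).
    rewrite Psi_inv_K by lra. split; [| reflexivity]. split; apply Rnot_lt_le; intros hlt;
      pose proof (Psi_lt _ _ hlt) as h; rewrite Psi_inv_K in h by lra; lra. }
  apply (midpoint_strict (fun y => k * Hr al delta la y c) (fun y => k * Pin (Psi_inv al y) c)).
  - now apply Psi_lt.
  - intros y hy. destruct (hin y hy) as [x [hx ->]]. rewrite Psi_K.
    apply (is_derive_scal (fun y => Hr al delta la y c) (Psi al x) k).
    apply Hr_derive_left. lra.
  - intros y z h1 h2 h3. destruct (hin y ltac:(lra)) as [x [hx ->]].
    destruct (hin z ltac:(lra)) as [x' [hx' ->]]. rewrite !Psi_K.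
    apply Pin_mono; [now apply Psi_lt_inv |]. intros t ht. apply hW. lra.
Qed.

(** If [Win x c <= 0], then [Win] is negative to the left of [x] by
    [Win_pos_after], and [Hr] would be strictly concave on an interval past the
    inflection point. *)
Lemma Win_pos_past_inflection (c v x : R) : 0 < c ->
  inflection_point al delta la c v -> v < Psi al x -> x <= phi + c -> 0 < Win x c.
Proof.
  intros hc [[hv1 hv2] [hconv _]] hx hxp. apply Rnot_le_lt. intros hneg.
  assert (hvpos : 0 < v) by (unfold y_ in hv1; pose proof (Psi_pos (1 / (2 * delta) + c / 2)); lra).
  set (xv := Psi_inv al v).
  assert (hxv : xv < x) by (apply Psi_lt_inv; unfold xv; now rewrite Psi_inv_K).
  assert (hW : forall z, z < x -> Win z c < 0).
  { intros z hz. apply Rnot_le_lt. intros h.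
    pose proof (Win_pos_after z x c ltac:(lra) hz hxp h). lra. }
  set (a := (2 * xv + x) / 3). set (b := (xv + 2 * x) / 3).
  pose proof (Hr_midpoint (-1) a b c ltac:(unfold a, b; lra) ltac:(unfold b; lra)) as hmid.
  assert (hs : forall z, xv < z -> v < Psi al z).
  { intros z hz. replace v with (Psi al xv) by (unfold xv; now apply Psi_inv_K). now apply Psi_lt. }
  assert (hab : Psi al a < Psi al b) by (apply Psi_lt; unfold a, b; lra).
  pose proof (hconv (Psi al a) (Psi al b) (/ 2) (hs a ltac:(unfold a; lra))
    (hs b ltac:(unfold b; lra)) ltac:(lra) ltac:(lra)) as hc2.
  cbv beta in hc2.
  assert (forall z, a <= z <= b -> 0 < -1 * Win z c) as hh.
  { intros z hz. pose proof (hW z ltac:(unfold b in hz; lra)). lra. }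
  specialize (hmid hh). lra.
Qed.

(** Otherwise [Hr] would be both convex, as [Win > 0], and concave just to the left
    of [x]. *)
Lemma past_inflection (c v x : R) : 0 < c ->
  inflection_point al delta la c v -> xc c < x -> x < phi + c -> 0 < Win x c -> v < Psi al x.
Proof.
  intros hc [[hv1 hv2] [_ hconc]] hx1 hx2 hW. apply Rnot_le_lt. intros hle.
  assert (l1 : locally x (fun z => 0 < Win z c)).
  { apply tends_gt with (a := Win x c); [| exact hW].
    apply (ex_derive_continuous (fun z => Win z c)). unfold Win, w, xc. auto_derive. exact I. }
  destruct (proj1 (locally_R _ _) (filter_and _ _ l1 (locally_gt x (xc c) hx1))) as [d [hd hd']].
  set (a := x - d / 2). set (b := x - d / 4).
  pose proof (Hr_midpoint 1 a b c ltac:(unfold a, b; lra) ltac:(unfold b; lra)) as hmid.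
  assert (hs : forall z, a <= z <= b -> y_ al delta c < Psi al z < v).
  { intros z hz. unfold a, b in hz.
    destruct (hd' z ltac:(apply Rabs_def1; lra)) as [_ k].
    pose proof (Psi_lt _ _ k) as k1. pose proof (Psi_lt z x ltac:(lra)).
    unfold y_. fold (xc c). lra. }
  assert (hab : Psi al a < Psi al b) by (apply Psi_lt; unfold a, b; lra).
  pose proof (hconc (Psi al a) (Psi al b) (/ 2) (hs a ltac:(unfold a, b; lra))
    (hs b ltac:(unfold a, b; lra)) ltac:(lra) ltac:(lra)) as hc2.
  cbv beta in hc2.
  assert (forall z, a <= z <= b -> 0 < 1 * Win z c) as hh.
  { intros z hz. unfold a, b in hz.
    destruct (hd' z ltac:(apply Rabs_def1; lra)) as [k _]. lra. }
  specialize (hmid hh). lra.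
Qed.


(** * The boundaries given by the convex minorant *)

Section Boundaries.

Context (yv : R -> R)
  (Hyv : forall c, 0 < c -> unique (inflection_point al delta la c) (yv c))
  (y1h y2h : R -> R) (c1 : R)
  (Hc1 : admissible_c1 al delta la y1h y2h yv c1)
  (h1inv : R -> R) (Hh1inv : inverse_of_h1 al delta la h1inv).

Local Notation Fb := (F al delta y1h).
Local Notation Gb := (G al delta y2h).
Local Notation cmax := (c2 al delta la h1inv c1).
Local Notation cend := (c0 al delta la y2h h1inv c1).

Lemma h1_eq (x : R) : h1 al delta la x = P x.
Proof.
  unfold h1, rho, P. rewrite s2a_s. replace (- x * s) with (- (s * x)) by ring.
  pose proof beta_pos. replace (al * delta - la) with (s ^ 2 / 2 * beta) by (unfold beta; ring).
  field. lra.
Qed.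

Lemma h2_eq (x : R) : h2 al delta la x = N x.
Proof.
  unfold h2, rho, N. rewrite s2a_s. replace (x * s) with (s * x) by ring.
  pose proof beta_pos. replace (al * delta - la) with (s ^ 2 / 2 * beta) by (unfold beta; ring).
  field. lra.
Qed.

Lemma h1inv_spec (z : R) : P 0 <= z <= 0 -> 0 <= h1inv z <= phi /\ P (h1inv z) = z.
Proof.
  intros hz. rewrite <- h1_eq, <- phi_f0. apply Hh1inv.
  rewrite P_0 in hz. replace (la / (2 * al ^ 2)) with (mu / s ^ 2) by (field; lra). exact hz.
Qed.

Lemma L_corner (c : R) : L al delta la h1inv (f0 al delta la + c) c
  = Nin (phi + c) c - N (h1inv (Pin (phi + c) c)).
Proof.
  unfold L. rewrite phi_f0, h2_eq. pose proof delta_pos.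
  assert (e3 : H3 al delta la (phi + c) c = Pin (phi + c) c).
  { unfold H3. 
    replace (Derive (fun z => hr1 al delta la z c) (phi + c)) with (2 * beta * (phi + c) - 2 * delta * c)
      by (symmetry; apply is_derive_unique, hr1_derive).
    rewrite hr1_eq, s2a_s.
    replace (- (phi + c) * s) with (- (s * (phi + c))) by ring.
    unfold Pin, P, xc, beta. field. lra. }
  assert (e4 : H4 al delta la (phi + c) c = Nin (phi + c) c).
  { unfold H4. 
    replace (Derive (fun z => hr1 al delta la z c) (phi + c)) with (2 * beta * (phi + c) - 2 * delta * c)
      by (symmetry; apply is_derive_unique, hr1_derive).
    rewrite hr1_eq, s2a_s.
    replace ((phi + c) * s) with (s * (phi + c)) by ring.
    unfold Nin, N, xc, beta. field. lra. }
  now rewrite e3, e4.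
Qed.

Lemma corner_root (c : R) : 0 <= c ->
  0 <= h1inv (Pin (phi + c) c) <= phi /\ P (h1inv (Pin (phi + c) c)) = Pin (phi + c) c.
Proof. intros hc. now apply h1inv_spec, Pin_corner. Qed.

Lemma c1_pos : 0 < c1.
Proof. apply Hc1. Qed.

(** Positivity comes from [corner_neg]. *)
Lemma cmax_spec : 0 < cmax <= c1 /\
  forall c, 0 < c < cmax -> Nin (phi + c) c - N (h1inv (Pin (phi + c) c)) < 0.
Proof.
  destruct (min_glb c1 (fun c => 0 < c < c1 /\ L al delta la h1inv (f0 al delta la + c) c >= 0)
    c1_pos) as [m1 [m2 m3]]; [tauto |].
  fold cmax in m1, m2, m3. split; [split |].
  - destruct (proj1 (locally_R _ _) corner_neg) as [d [hd hneg]].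
    apply (m3 d hd). intros c [hc hL]. apply Rnot_lt_le. intros hcd.
    rewrite L_corner in hL. destruct (corner_root c ltac:(lra)) as [r1 r2].
    pose proof (hneg c ltac:(rewrite Rminus_0_r, Rabs_pos_eq; lra) _ ltac:(lra) r1 r2). lra.
  - exact m1.
  - intros c hc. apply Rnot_le_lt. intros hle. apply (m2 c ltac:(lra)).
    split; [lra |]. rewrite L_corner. lra.
Qed.

Lemma Fb_eq (c : R) : 0 < c -> Fb c = Psi_inv al (y1h c).
Proof. intros hc. unfold F. destruct (Req_EM_T c 0); [lra | reflexivity]. Qed.

Lemma Gb_eq (c : R) : 0 < c -> Gb c = Psi_inv al (y2h c).
Proof. intros hc. unfold G. destruct (Req_EM_T c 0); [lra | reflexivity]. Qed.

Lemma y1h_eq (c : R) : 0 < c < c1 -> y1h c = Psi al (Fb c).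
Proof.
  intros hc. rewrite Fb_eq by lra. destruct Hc1 as [_ h]. destruct (h c hc) as [[[[h1 _] _] _] _].
  symmetry. apply Psi_inv_K. lra.
Qed.

Lemma y2h_eq (c : R) : 0 < c < c1 -> y2h c = Psi al (Gb c).
Proof.
  intros hc. rewrite Gb_eq by lra. destruct Hc1 as [_ h].
  destruct (h c hc) as [[[[h1 [h2 [h3 h4]]] _] _] _].
  symmetry. apply Psi_inv_K. lra.
Qed.

(** Below [cmax] the difference that [corner_nonneg] bounds is negative, so the
    tangency on the right takes place in the inner regime. *)
Lemma boundaries_sol (c : R) : 0 < c < cmax -> smooth_fit (Fb c) (Gb c) c.
Proof.
  intros hc. destruct cmax_spec as [[_ hle] hneg].
  assert (hc1 : 0 < c < c1) by lra.
  pose proof (y1h_eq c hc1) as e1. pose proof (y2h_eq c hc1) as e2.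
  destruct Hc1 as [_ h]. destruct (h c hc1) as [[[[t1 [t2 [t3 t4]]] [t5 t6]] _] [t7 _]].
  clear h. rewrite phi_f0 in t7.
  set (a := Fb c) in *. set (b := Gb c) in *. rewrite e1, e2 in *.
  rewrite <- Psi_0 in t1. apply Psi_lt_inv in t1.
  unfold y_ in t2, t3. fold (xc c) in t2, t3.
  pose proof (Rle_lt_trans _ _ _ t3 t4) as t8.
  apply Psi_lt_inv in t2. apply Psi_lt_inv in t7. apply Psi_lt_inv in t8.
  rewrite Hl_intercept in t6. rewrite dHl_Psi in t5.
  destruct (Rlt_le_dec b (phi + c)) as [hb | hb].
  - rewrite dHr_left in t5, t6 by lra. rewrite Hr_intercept_left in t6 by lra.
    unfold smooth_fit. repeat split; try assumption.
    apply (Win_pos_past_inflection c (yv c)); try lra. apply Hyv. lra.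
  - exfalso.
    rewrite dHr_right in t5, t6 by lra. rewrite Hr_intercept_right in t6 by lra.
    destruct (corner_root c ltac:(lra)) as [r1 r2].
    pose proof (corner_nonneg b c a (h1inv (Pin (phi + c) c)) ltac:(lra) hb ltac:(lra) r1 t5 t6 r2).
    specialize (hneg c hc). lra.
Qed.

(** A solution of the smooth-fit equations is a tangent couple, since
    [past_inflection] recovers the condition on the inflection point. *)
Lemma boundaries_unique (a b c : R) : 0 < c < cmax -> smooth_fit a b c -> a = Fb c /\ b = Gb c.
Proof.
  intros hc [s1 [s2 [s3 [s4 [s5 [s6 [s7 s8]]]]]]]. destruct cmax_spec as [[_ hle] _].
  assert (hc1 : 0 < c < c1) by lra.
  destruct Hc1 as [_ h]. destruct (h c hc1) as [[_ huniq] _].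
  destruct (Hyv c ltac:(lra)) as [hinf _].
  assert (tc : tangent_couple al delta la yv c (Psi al a, Psi al b)).
  { unfold tangent_couple. repeat split.
    - rewrite <- Psi_0. now apply Psi_lt.
    - unfold y_. fold (xc c). now apply Psi_lt.
    - apply hinf.
    - now apply (past_inflection c).
    - rewrite dHl_Psi, dHr_left by lra. exact s7.
    - rewrite Hl_intercept, dHr_left, Hr_intercept_left by lra. exact s8. }
  apply huniq in tc. injection tc as e1 e2.
  rewrite Fb_eq, Gb_eq, e1, e2, !Psi_K by lra. auto.
Qed.

Lemma Fb_0 : Fb 0 = 1 / (2 * delta).
Proof. unfold F. destruct (Req_EM_T 0 0); [reflexivity | lra]. Qed.

Lemma Gb_0 : Gb 0 = 1 / (2 * delta).
Proof. unfold G. destruct (Req_EM_T 0 0); [reflexivity | lra]. Qed.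

Lemma boundaries_derive (c : R) : 0 < c < cmax ->
  is_derive Fb c (dF (Fb c) (Gb c) c) /\ is_derive Gb c (dG (Fb c) (Gb c) c).
Proof.
  apply (FG_derive Fb Gb h1inv cmax boundaries_sol boundaries_unique h1inv_spec).
Qed.

(** Positivity comes from [dG_gt_1_near_0]. *)
Lemma cend_spec : 0 < cend <= cmax /\
  forall c, 0 < c < cend -> 1 < dG (Fb c) (Gb c) c.
Proof.
  destruct cmax_spec as [[hpos _] _].
  destruct (min_glb cmax (fun c => 0 < c < cmax /\ Derive Gb c <= 1) hpos)
    as [m1 [m2 m3]]; [tauto |].
  fold cend in m1, m2, m3.
  assert (hder : forall c, 0 < c < cmax -> Derive Gb c = dG (Fb c) (Gb c) c).
  { intros c hc. apply is_derive_unique. now apply boundaries_derive. }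
  split; [split |].
  - pose proof (dG_gt_1_near_0 Fb Gb cmax boundaries_sol) as hs. unfold within in hs.
    destruct (proj1 (locally_R _ _) hs) as [d [hd hnear]].
    apply (m3 d hd). intros c [hc hD]. apply Rnot_lt_le. intros hcd.
    rewrite hder in hD by assumption.
    pose proof (hnear c ltac:(rewrite Rminus_0_r, Rabs_pos_eq; lra) hc). lra.
  - exact m1.
  - intros c hc. rewrite <- hder by lra. apply Rnot_le_lt. intros hle.
    apply (m2 c ltac:(lra)). split; [lra | exact hle].
Qed.

Local Notation VV := (Val Fb Gb).
Local Notation VVx := (Val_x Fb Gb).
Local Notation VVc := (Val_c Fb Gb).
Local Notation VVxx := (Val_xx Fb Gb).
Local Notation Dom := (D0 cend).

Lemma cend_le : cend <= cmax.
Proof. apply cend_spec. Qed.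


Ltac family_hyps :=
  first [exact boundaries_sol | exact boundaries_unique | exact h1inv_spec | exact cend_le
    | exact (proj2 cend_spec) | exact Fb_0 | exact Gb_0 | assumption
    | apply within_filter, locally_filter].

Lemma boundaries_order (c : R) : Dom c ->
  0 < Fb c <= 1 / (2 * delta) /\ c + 1 / (2 * delta) <= Gb c < phi + c.
Proof. intros hc. eapply FG_order; family_hyps. Qed.

Lemma boundaries_c1 (c : R) : Dom c -> c <> 0 -> 0 < c < cmax /\ 0 < c < c1.
Proof.
  intros [h1 h2] hne. pose proof cend_le. destruct cmax_spec as [[_ h3] _]. lra.
Qed.

Lemma pieces (x c : R) : Dom c ->
  (x <= Fb c -> VV x c = delta * x ^ 2) /\
  (Fb c <= x <= Gb c -> VV x c = mid Fb x c) /\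
  (Gb c <= x -> VV x c = U (x - c) + c).
Proof. intros hc. eapply Val_pieces; family_hyps. Qed.

Lemma V0_eq (z : R) : 0 <= z -> V0 al delta la z = U z.
Proof.
  intros hz. unfold V0, U. rewrite phi_f0, Rabs_pos_eq by assumption.
  destruct (Rle_dec z phi); [reflexivity |].
  unfold tail. rewrite B0_eq, s2a_s. replace (- z * s) with (- (s * z)) by ring. field. lra.
Qed.

Lemma A_eq (c : R) : 0 < c < c1 -> A al delta la y1h c = P (Fb c).
Proof. intros hc. unfold A. rewrite y1h_eq by assumption. apply dHl_Psi. Qed.

Lemma B_eq (c : R) : 0 < c < c1 -> B al delta la y1h c = N (Fb c).
Proof.
  intros hc. unfold B, A. rewrite y1h_eq by assumption. apply Hl_intercept.
Qed.

(** At [c = 0] the boundaries meet and the middle piece disappears, which makes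
    the formula for positive [c] valid there as well. *)
Lemma Q_eq (x c : R) : Dom c -> Q al delta la y1h y2h x c = VV (Rabs x) c.
Proof.
  intros hc. pose proof (boundaries_order c hc) as ord. pose proof delta_pos as hdel.
  assert (hx0 : 0 < 1 / (2 * delta)) by (apply Rdiv_lt_0_compat; lra).
  unfold Q. set (z := Rabs x). assert (hz : 0 <= z) by apply Rabs_pos.
  unfold Defs.V. destruct (Req_EM_T c 0) as [-> | hne].
  - rewrite V0_eq by assumption. pose proof x0_lt_phi.
    destruct (pieces z 0 hc) as [k1 [k2 k3]]. rewrite Fb_0, Gb_0 in *.
    destruct (Rle_lt_dec z (1 / (2 * delta))) as [h | h].
    + rewrite k1 by assumption. apply U_left. lra.
    + rewrite k3 by lra. now rewrite Rminus_0_r, Rplus_0_r.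
  - destruct (boundaries_c1 c hc hne) as [_ hc1].
    unfold Val. destruct (Rle_dec z (Fb c)); [reflexivity |].
    destruct (Rlt_dec z (Gb c)).
    + unfold mid. rewrite A_eq, B_eq, s2a_s by assumption.
      replace (z * s) with (s * z) by ring. replace (- z * s) with (- (s * z)) by ring.
      field. lra.
    + rewrite V0_eq; [reflexivity |]. lra.
Qed.

(** The tangent line lies below [H], hence below [Hl]; dividing by [exp (s * z)]
    gives the inequality. *)
Lemma mid_le (z c : R) : 0 < c < cend -> Fb c <= z <= Gb c -> mid Fb z c <= delta * z ^ 2.
Proof.
  intros hc hz. assert (hD : Dom c) by (unfold D0; lra).
  pose proof (boundaries_order c hD) as ord.
  destruct (boundaries_c1 c hD ltac:(lra)) as [_ hc1].
  destruct Hc1 as [_ h]. destruct (h c hc1) as [_ [_ [_ hle]]]. clear h.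
  assert (hy : 1 < Psi al z) by (rewrite <- Psi_0; apply Psi_lt; lra).
  specialize (hle (Psi al z) hy). rewrite A_eq, B_eq in hle by assumption.
  unfold H in hle. rewrite s2a_s, Psi_K in hle.
  assert (hh : h al delta la z c <= hl al delta la z) by apply Rmin_l.
  rewrite hl_eq in hh. rewrite Psi_eq in hle. replace (2 * s * z) with (s * z + s * z) in hle by ring.
  rewrite exp_plus in hle.
  pose proof (exp_pos (s * z)) as hp. pose proof (exp_pos (- (s * z))) as hm.
  pose proof (exp_inv z) as hi.
  assert (hle2 : P (Fb c) * (exp (s * z) * exp (s * z)) + N (Fb c)
            <= exp (s * z) * (beta * z ^ 2 - 2 * mu / s ^ 2)).
  { apply Rle_trans with (1 := hle). apply Rmult_le_compat_l; lra. }
  assert (hle3 : exp (- (s * z)) * (P (Fb c) * (exp (s * z) * exp (s * z)) + N (Fb c))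
            <= exp (- (s * z)) * (exp (s * z) * (beta * z ^ 2 - 2 * mu / s ^ 2))).
  { apply Rmult_le_compat_l; lra. }
  replace (exp (- (s * z)) * (P (Fb c) * (exp (s * z) * exp (s * z)) + N (Fb c)))
    with (P (Fb c) * exp (s * z) * (exp (s * z) * exp (- (s * z))) + N (Fb c) * exp (- (s * z)))
    in hle3 by ring.
  replace (exp (- (s * z)) * (exp (s * z) * (beta * z ^ 2 - 2 * mu / s ^ 2)))
    with (exp (s * z) * exp (- (s * z)) * (beta * z ^ 2 - 2 * mu / s ^ 2)) in hle3 by ring.
  rewrite hi in hle3. unfold mid. unfold beta in *. lra.
Qed.

Lemma Val_x_linear (z c : R) : Dom c -> z <= Fb c -> VVx z c = 2 * delta * z.
Proof.
  intros hc hz.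
  unfold Val_x. destruct (Rle_dec z (Fb c)); [reflexivity | lra].
Qed.

Lemma Q_derive_x (x c : R) : Dom c ->
  is_derive (fun z => Q al delta la y1h y2h z c) x (odd_ext (fun z => VVx z c) x).
Proof.
  intros hc. pose proof (boundaries_order c hc) as ord.
  apply (is_derive_ext (fun z => VV (Rabs z) c)).
  { intros t. symmetry. now apply Q_eq. }
  apply (even_derive (fun z => VV z c) (fun z => VVx z c) delta (Fb c)).
  - lra.
  - intros z hz. now apply pieces.
  - rewrite Val_x_linear by (assumption || lra). ring.
  - eapply Val_derive_x; family_hyps.
Qed.

Lemma Qx_eq (x c : R) : Dom c -> Qx al delta la y1h y2h x c = odd_ext (fun z => VVx z c) x.
Proof. intros hc. apply is_derive_unique. now apply Q_derive_x. Qed.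

Lemma Qx_right (x c : R) : Dom c -> 0 <= x -> Qx al delta la y1h y2h x c = VVx x c.
Proof.
  intros hc hx. rewrite Qx_eq by assumption. unfold odd_ext.
  destruct (Rle_dec 0 x); [reflexivity | lra].
Qed.

Lemma Q_derive_c (x c : R) : Dom c ->
  dwithin Dom (fun e => Q al delta la y1h y2h x e) c (VVc (Rabs x) c).
Proof.
  intros hc. apply (dwithin_ext Dom (fun e => VV (Rabs x) e)).
  - intros e he. symmetry. now apply Q_eq.
  - assumption.
  - eapply Val_derive_c; family_hyps.
Qed.

Lemma Qc_eq (x c : R) : 0 < c < cend -> Qc al delta la y1h y2h x c = VVc (Rabs x) c.
Proof.
  intros hc. apply is_derive_unique. apply (dwithin_interior Dom).
  - apply filter_imp with (2 := filter_and _ _ (locally_gt c 0 (proj1 hc)) (locally_lt c cend (proj2 hc))).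
    intros e he. unfold D0. lra.
  - apply Q_derive_c. unfold D0. lra.
Qed.

Lemma Qxx_derive (x c : R) : Dom c -> Rabs x <> Fb c -> Rabs x <> Gb c -> Rabs x <> phi + c ->
  is_derive (Derive (fun z => Q al delta la y1h y2h z c)) x (VVxx (Rabs x) c).
Proof.
  intros hc n1 n2 n3. pose proof (boundaries_order c hc) as ord.
  apply (is_derive_ext (odd_ext (fun z => VVx z c))).
  { intros t. symmetry. apply is_derive_unique. now apply Q_derive_x. }
  apply (odd_derive _ (2 * delta) (Fb c)).
  - lra.
  - intros z hz. now apply Val_x_linear.
  - eapply Val_x_derive; family_hyps.
Qed.

Lemma Qxx_eq (x c : R) : Dom c -> Rabs x <> Fb c -> Rabs x <> Gb c -> Rabs x <> phi + c ->
  Qxx al delta la y1h y2h x c = VVxx (Rabs x) c.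
Proof. intros hc n1 n2 n3. apply is_derive_unique. now apply Qxx_derive. Qed.

Lemma not_exceptional (x c : R) : ~ exceptional al delta la y1h y2h x c ->
  Rabs x <> Fb c /\ Rabs x <> Gb c /\ Rabs x <> phi + c.
Proof. unfold exceptional. rewrite phi_f0. tauto. Qed.

(** ** Properties of the extended value function *)

Lemma cend_pos : 0 < cend.
Proof. apply cend_spec. Qed.

Lemma Q_nonneg (x c : R) : Dom c -> 0 <= Q al delta la y1h y2h x c.
Proof. intros hc. rewrite Q_eq by assumption. eapply Val_nonneg; family_hyps. Qed.

Lemma boundaries_cont :
  continuous_on Dom Fb /\ continuous_on Dom Gb.
Proof.
  split; intros c hc.
  - apply (FG_cont_on Fb Gb h1inv cmax boundaries_sol boundaries_unique h1inv_spec cend cend_le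
      Fb_0 Gb_0 c hc).
  - apply (FG_cont_on Fb Gb h1inv cmax boundaries_sol boundaries_unique h1inv_spec cend cend_le
      Fb_0 Gb_0 c hc).
Qed.

Lemma boundaries_C1 (c : R) : 0 < c < cend ->
  ex_derive Fb c /\ continuous (Derive Fb) c /\
  ex_derive Gb c /\ continuous (Derive Gb) c /\
  Derive Fb c <= 0 /\ Derive Gb c > 0.
Proof.
  intros hc. pose proof cend_le. assert (hcm : 0 < c < cmax) by lra.
  destruct (boundaries_derive c hcm) as [d1 d2].
  assert (near : locally c (fun e => 0 < e < cmax)).
  { exact (filter_and _ _ (locally_gt c 0 (proj1 hcm)) (locally_lt c cmax (proj2 hcm))). }
  split; [eexists; exact d1 |]. split; [| split; [eexists; exact d2 | split]].
  - unfold continuous. rewrite (is_derive_unique Fb c _ d1).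
    apply (tends_ext (fun e => dF (Fb e) (Gb e) e)).
    + apply filter_imp with (2 := near). intros e he. symmetry. apply is_derive_unique.
      now apply boundaries_derive.
    + apply (tends_dF Fb Gb h1inv cmax boundaries_sol boundaries_unique h1inv_spec c hcm).
  - unfold continuous. rewrite (is_derive_unique Gb c _ d2).
    apply (tends_ext (fun e => dG (Fb e) (Gb e) e)).
    + apply filter_imp with (2 := near). intros e he. symmetry. apply is_derive_unique.
      now apply boundaries_derive.
    + apply (tends_dG Fb Gb h1inv cmax boundaries_sol boundaries_unique h1inv_spec c hcm).
  - rewrite (is_derive_unique Fb c _ d1), (is_derive_unique Gb c _ d2). split.
    + apply Rlt_le. eapply dF_neg; family_hyps.
    + pose proof (proj2 cend_spec c hc). lra.
Qed.

Lemma boundaries_lt (c : R) : 0 < c < cend -> Fb c < Gb c.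
Proof.
  intros hc. pose proof (boundaries_order c ltac:(unfold D0; lra)). lra.
Qed.

Section JointAt.

Context (x c : R) (hc : Dom c).
Let Fil := within (fun p : R * R => Dom (snd p)) (locally (x, c)).

Lemma at_fst : tends Fil fst x.
Proof. apply tends_within; [apply locally_filter | apply tends_fst]. Qed.

Lemma at_snd : tends Fil snd c.
Proof. apply tends_within; [apply locally_filter | apply tends_snd]. Qed.

Lemma at_Dom : Fil (fun p => Dom (snd p)).
Proof. unfold Fil, within. apply filter_forall. auto. Qed.

Lemma at_abs : tends Fil (fun p => Rabs (fst p)) (Rabs x).
Proof. apply tends_abs. apply at_fst. Qed.

Lemma Q_joint : tends Fil (fun p => VV (Rabs (fst p)) (snd p)) (VV (Rabs x) c).
Proof.
  pose proof at_abs. pose proof at_snd. pose proof at_Dom.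
  eapply (tends_Val Fb Gb) with (y := fun p => Rabs (fst p)) (e := snd); family_hyps.
Qed.

Lemma Qc_joint : tends Fil (fun p => VVc (Rabs (fst p)) (snd p)) (VVc (Rabs x) c).
Proof.
  pose proof at_abs. pose proof at_snd. pose proof at_Dom.
  eapply (tends_Val_c Fb Gb) with (y := fun p => Rabs (fst p)) (e := snd); family_hyps.
Qed.

(** In this form the odd extension is composed of continuous functions. *)
Lemma odd_parts (z e : R) : Dom e -> odd_ext (fun t => VVx t e) z
  = VVx ((z + Rabs z) / 2) e - VVx ((Rabs z - z) / 2) e.
Proof.
  intros he. pose proof (boundaries_order e he) as ord.
  assert (h0 : VVx 0 e = 0) by (rewrite Val_x_linear by (assumption || lra); ring).
  unfold odd_ext. destruct (Rle_dec 0 z).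
  - rewrite Rabs_pos_eq by assumption. replace ((z + z) / 2) with z by field.
    replace ((z - z) / 2) with 0 by field. rewrite h0. ring.
  - rewrite Rabs_left by lra. replace ((z + - z) / 2) with 0 by field.
    replace ((- z - z) / 2) with (- z) by field. rewrite h0. ring.
Qed.

Lemma Qx_joint : tends Fil (fun p => odd_ext (fun z => VVx z (snd p)) (fst p))
  (odd_ext (fun z => VVx z c) x).
Proof.
  pose proof at_fst as l1. pose proof at_snd as l2. pose proof at_Dom as l3. pose proof at_abs as l4.
  rewrite odd_parts by assumption.
  apply (tends_ext (fun p => VVx ((fst p + Rabs (fst p)) / 2) (snd p)
    - VVx ((Rabs (fst p) - fst p) / 2) (snd p))).
  { apply filter_imp with (2 := l3). intros p hp. symmetry. now apply odd_parts. }
  assert (l5 : tends Fil (fun p => (fst p + Rabs (fst p)) / 2) ((x + Rabs x) / 2)).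
  { apply tends_div; [lra | now apply tends_plus | apply tends_const]. }
  assert (l6 : tends Fil (fun p => (Rabs (fst p) - fst p) / 2) ((Rabs x - x) / 2)).
  { apply tends_div; [lra | now apply tends_minus | apply tends_const]. }
  apply tends_minus.
  - eapply (tends_Val_x Fb Gb) with (y := fun p => (fst p + Rabs (fst p)) / 2) (e := snd); family_hyps.
  - eapply (tends_Val_x Fb Gb) with (y := fun p => (Rabs (fst p) - fst p) / 2) (e := snd); family_hyps.
Qed.

Lemma Qxx_joint : Rabs x <> Fb c -> Rabs x <> Gb c -> Rabs x <> phi + c ->
  tends Fil (fun p => VVxx (Rabs (fst p)) (snd p)) (VVxx (Rabs x) c).
Proof.
  intros n1 n2 n3. pose proof at_abs. pose proof at_snd. pose proof at_Dom.
  eapply (tends_Val_xx Fb Gb) with (y := fun p => Rabs (fst p)) (e := snd); family_hyps.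
Qed.

Lemma Qxx_bounded : exists M, Fil (fun p => Rabs (VVxx (Rabs (fst p)) (snd p)) <= M).
Proof.
  pose proof at_abs. pose proof at_snd. pose proof at_Dom.
  eapply (Val_xx_bounded Fb Gb) with (y := fun p => Rabs (fst p)) (e := snd)
    (x := Rabs x) (c := c); family_hyps.
Qed.

End JointAt.

Lemma Q_cont : continuous_on (fun p : R * R => Dom (snd p))
  (fun p => Q al delta la y1h y2h (fst p) (snd p)).
Proof.
  intros [x c] hc. simpl in *. rewrite Q_eq by assumption.
  apply (tends_ext (fun p => VV (Rabs (fst p)) (snd p))).
  - apply filter_imp with (2 := at_Dom x c). intros p hp. symmetry. now apply Q_eq.
  - now apply Q_joint.
Qed.

Lemma Q_C1 : C1_on_strip cend (Q al delta la y1h y2h).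
Proof.
  exists (fun x c => odd_ext (fun z => VVx z c) x), (fun x c => VVc (Rabs x) c).
  split; [| split].
  - intros x c hc. split; [now apply Q_derive_x |].
    apply (dwithin_filterdiff Dom); [exact hc | now apply Q_derive_c].
  - intros [x c] hc. now apply Qx_joint.
  - intros [x c] hc. now apply Qc_joint.
Qed.

Lemma Qxx_cont : continuous_on
  (fun p : R * R => Dom (snd p) /\ ~ exceptional al delta la y1h y2h (fst p) (snd p))
  (fun p => Qxx al delta la y1h y2h (fst p) (snd p)).
Proof.
  intros [x c] [hc hn]. simpl in *. destruct (not_exceptional _ _ hn) as [n1 [n2 n3]].
  rewrite Qxx_eq by assumption.
  set (E := fun p : R * R => Dom (snd p) /\ ~ exceptional al delta la y1h y2h (fst p) (snd p)).
  apply (tends_ext (Fil := within E (locally (x, c))) (fun p => VVxx (Rabs (fst p)) (snd p))).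
  - unfold within. apply filter_forall. intros p [hp hpn].
    destruct (not_exceptional _ _ hpn) as [m1 [m2 m3]]. symmetry. now apply Qxx_eq.
  - apply filterlim_filter_le_1 with (2 := Qxx_joint x c hc n1 n2 n3).
    intros R0 hR. unfold within in *. apply filter_imp with (2 := hR). intros p hp hE.
    apply hp. apply hE.
Qed.

Lemma Qxx_loc_bounded (x c : R) : Dom c ->
  exists M, locally (x, c) (fun p : R * R =>
    Dom (snd p) -> ~ exceptional al delta la y1h y2h (fst p) (snd p) ->
    Rabs (Qxx al delta la y1h y2h (fst p) (snd p)) <= M).
Proof.
  intros hc. destruct (Qxx_bounded x c hc) as [M hM]. exists M.
  unfold within in hM. apply (filter_imp (F := locally (x, c))) with (2 := hM). intros p hp hD hn.
  destruct (not_exceptional _ _ hn) as [m1 [m2 m3]]. rewrite Qxx_eq by assumption. now apply hp.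
Qed.

Lemma Qx_growth : exists K : R -> R,
  (forall c, 0 <= c -> 0 < K c) /\
  continuous_on (fun c => 0 <= c) K /\
  (forall c c', 0 <= c -> c < c' -> K c < K c') /\
  (forall x c, 0 <= x -> Dom c -> Rabs (Qx al delta la y1h y2h x c) <= K c * (1 + Rabs x)).
Proof.
  assert (hg : exists K, 0 < K /\ forall x c, Dom c -> 0 <= x -> Rabs (VVx x c) <= K * (1 + x)).
  { eapply Val_x_growth; family_hyps. }
  destruct hg as [K [hK hg]]. exists (fun c => K + c). split; [| split; [| split]].
  - intros c hc. lra.
  - intros c hc. apply tends_within; [apply locally_filter |].
    apply tends_plus; [apply tends_const | apply tends_id].
  - intros c c' _ h. lra.
  - intros x c hx hc. rewrite Qx_right, (Rabs_pos_eq x) by assumption.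
    apply Rle_trans with (1 := hg x c hc hx).
    apply Rmult_le_compat_r; [lra |]. unfold D0 in hc. lra.
Qed.

Lemma Q_le (x c : R) : 0 <= x -> Dom c -> Q al delta la y1h y2h x c <= delta * x ^ 2.
Proof.
  intros hx hc. rewrite Q_eq, Rabs_pos_eq by assumption.
  eapply Val_le; try family_hyps. exact mid_le.
Qed.

Lemma Q_gradient (x c : R) : 0 <= x -> 0 < c < cend ->
  Qx al delta la y1h y2h x c + Qc al delta la y1h y2h x c <= 1.
Proof.
  intros hx hc. rewrite Qx_right, Qc_eq, Rabs_pos_eq by (assumption || (unfold D0; lra)).
  eapply gradient_le; family_hyps.
Qed.

Lemma Q_gen (x c : R) : 0 <= x -> Dom c -> x <> Fb c -> x <> Gb c -> x <> phi + c ->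
  1 / 2 * Qxx al delta la y1h y2h x c + la * x ^ 2 - al * Q al delta la y1h y2h x c
  = gen Fb Gb x c.
Proof.
  intros hx hc n1 n2 n3. rewrite Qxx_eq, Q_eq by (rewrite ?Rabs_pos_eq; assumption).
  rewrite Rabs_pos_eq by assumption. reflexivity.
Qed.

Lemma Q_subsolution (x c : R) : 0 <= x -> Dom c -> x <> Fb c -> x <> Gb c -> x <> phi + c ->
  al * Q al delta la y1h y2h x c <= 1 / 2 * Qxx al delta la y1h y2h x c + la * x ^ 2.
Proof.
  intros hx hc n1 n2 n3. pose proof (Q_gen x c hx hc n1 n2 n3) as e.
  assert (0 <= gen Fb Gb x c) by (eapply gen_nonneg; family_hyps). lra.
Qed.

Lemma Q_complementarity (x c : R) : 0 <= x -> 0 < c < cend ->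
  x <> Fb c -> x <> Gb c -> x <> phi + c ->
  (delta * x ^ 2 - Q al delta la y1h y2h x c)
  * (1 - Qx al delta la y1h y2h x c - Qc al delta la y1h y2h x c)
  * (1 / 2 * Qxx al delta la y1h y2h x c + la * x ^ 2 - al * Q al delta la y1h y2h x c) = 0.
Proof.
  intros hx hc n1 n2 n3. assert (hD : Dom c) by (unfold D0; lra).
  rewrite Q_gen, Q_eq, Qx_right, Qc_eq, Rabs_pos_eq by assumption.
  eapply complementarity; family_hyps.
Qed.

End Boundaries.
End Minorant.
End FreeBoundary.

Lemma f0_root (s delta mu : R) : 0 < s -> 0 < mu -> mu < delta ->
  let phi := f0 (s ^ 2 / 2) delta (s ^ 2 / 2 * mu) in
  0 < phi /\ s ^ 2 * (delta - mu) * phi ^ 2 + 2 * s * (delta - mu) * phi = 2 * mu.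
Proof.
  intros hs hmu hlt phi.
  assert (e : (s ^ 2 / 2 * delta + s ^ 2 / 2 * mu) / (s ^ 2 / 2 * delta - s ^ 2 / 2 * mu)
              = (delta + mu) / (delta - mu)).
  { replace (s ^ 2 / 2 * delta - s ^ 2 / 2 * mu) with (s ^ 2 / 2 * (delta - mu)) by ring.
    field. lra. }
  assert (hphi : s * phi + 1 = sqrt ((delta + mu) / (delta - mu))).
  { unfold phi, f0. rewrite e, s2a_s by assumption. field. lra. }
  assert (h1 : 1 < (delta + mu) / (delta - mu)).
  { apply Rmult_lt_reg_r with (delta - mu); [lra |]. unfold Rdiv.
    rewrite Rmult_assoc, Rinv_l by lra. lra. }
  assert (hgt : 1 < s * phi + 1).
  { rewrite hphi. rewrite <- sqrt_1 at 1. apply sqrt_lt_1; lra. }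
  split.
  - apply Rmult_lt_reg_l with (1 := hs). lra.
  - assert (sq : (s * phi + 1) ^ 2 = (delta + mu) / (delta - mu)).
    { rewrite hphi. apply pow2_sqrt. lra. }
    assert (sq' : (s * phi + 1) ^ 2 * (delta - mu) = delta + mu) by (rewrite sq; field; lra).
    nra.
Qed.


Theorem theorem3
  (alpha delta lambda : R)
  (Halpha : 0 < alpha) (Hdelta : 0 < delta)
  (Hlambda : 0 < lambda < alpha * delta)
  (Hf0 : f0 alpha delta lambda > alpha / (2 * lambda))
  (yv : R -> R)
  (Hyv : forall c, 0 < c ->
     unique (inflection_point alpha delta lambda c) (yv c))
  (y1h y2h : R -> R) (c1 : R)
  (Hc1 : admissible_c1 alpha delta lambda y1h y2h yv c1)
  (h1inv : R -> R)
  (Hh1inv : inverse_of_h1 alpha delta lambda h1inv) :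
  let phi := f0 alpha delta lambda in
  let cm := c0 alpha delta lambda y2h h1inv c1 in
  let f := F alpha delta y1h in
  let g := G alpha delta y2h in
  let q := Q alpha delta lambda y1h y2h in
  let qx := Qx alpha delta lambda y1h y2h in
  let qc := Qc alpha delta lambda y1h y2h in
  let qxx := Qxx alpha delta lambda y1h y2h in
  let exc := exceptional alpha delta lambda y1h y2h in
  0 < cm /\
  (forall x c, 0 <= c < cm -> 0 <= q x c) /\
  (* (i) *)
  ((forall c, 0 <= c < cm -> 0 < f c /\ 0 < g c) /\
   continuous_on (fun c => 0 <= c < cm) f /\
   continuous_on (fun c => 0 <= c < cm) g /\
   (forall c, 0 < c < cm ->
      ex_derive f c /\ continuous (Derive f) c /\
      ex_derive g c /\ continuous (Derive g) c /\
      Derive f c <= 0 /\ Derive g c > 0) /\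
   f 0 <= g 0 /\
   (forall c, 0 < c < cm -> f c < g c)) /\
  (* (ii) *)
  ((forall x c, 0 <= c < cm -> q (- x) c = q x c) /\
   continuous_on (fun p : R * R => 0 <= snd p < cm)
     (fun p => q (fst p) (snd p)) /\
   C1_on_strip cm q /\
   (forall x c, 0 <= c < cm -> ~ exc x c ->
      ex_derive_n (fun x' => q x' c) 2 x) /\
   continuous_on (fun p : R * R => 0 <= snd p < cm /\ ~ exc (fst p) (snd p))
     (fun p => qxx (fst p) (snd p)) /\
   (forall x c, 0 <= c < cm ->
      exists M, locally (x, c) (fun p : R * R =>
        0 <= snd p < cm -> ~ exc (fst p) (snd p) ->
        Rabs (qxx (fst p) (snd p)) <= M))) /\
  (* (iii) *)
  (exists K : R -> R,
     (forall c, 0 <= c -> 0 < K c) /\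
     continuous_on (fun c => 0 <= c) K /\
     (forall c c', 0 <= c -> c < c' -> K c < K c') /\
     (forall x c, 0 <= x -> 0 <= c < cm ->
        Rabs (qx x c) <= K c * (1 + Rabs x))) /\
  (* (iv) *)
  (forall x c, 0 <= x -> 0 <= c < cm -> q x c <= delta * x ^ 2) /\
  (* (v) *)
  (forall x c, 0 <= x -> 0 < c < cm -> qx x c + qc x c <= 1) /\
  (* (vi) *)
  (forall x c, 0 <= x -> 0 <= c < cm -> x <> f c -> x <> g c -> x <> phi + c ->
     alpha * q x c <= 1 / 2 * qxx x c + lambda * x ^ 2) /\
  (* (vii) *)
  (forall x c, 0 <= x -> 0 < c < cm -> x <> f c -> x <> g c -> x <> phi + c ->
     (delta * x ^ 2 - q x c) * (1 - qx x c - qc x c)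
     * (1 / 2 * qxx x c + lambda * x ^ 2 - alpha * q x c) = 0).
Proof.
  (* the parameters in which [s2a] is a variable instead of a square root *)
  assert (param : exists s mu, 0 < s /\ 0 < mu /\ mu < delta /\
            alpha = s ^ 2 / 2 /\ lambda = s ^ 2 / 2 * mu).
  { exists (sqrt (2 * alpha)), (lambda / alpha).
    assert (e : sqrt (2 * alpha) ^ 2 / 2 = alpha) by (rewrite pow2_sqrt by lra; field).
    rewrite e. repeat split.
    - apply sqrt_lt_R0. lra.
    - apply Rdiv_lt_0_compat; lra.
    - apply Rmult_lt_reg_l with (1 := Halpha).
      replace (alpha * (lambda / alpha)) with lambda by (field; lra). lra.
    - field. lra. }
  destruct param as [s [mu [hs [hmu [hlt [-> ->]]]]]].
  destruct (f0_root s delta mu hs hmu hlt) as [hphi hroot].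
  assert (hlarge : 1 < 2 * mu * f0 (s ^ 2 / 2) delta (s ^ 2 / 2 * mu)).
  { replace (s ^ 2 / 2 / (2 * (s ^ 2 / 2 * mu))) with (1 / (2 * mu)) in Hf0 by (field; lra).
    replace 1 with (2 * mu * (1 / (2 * mu))) at 1 by (field; lra).
    apply Rmult_lt_compat_l; lra. }
  intros phi cm f g q qx qc qxx exc.
  fold phi in hphi, hroot, hlarge.
  assert (ephi : f0 (s ^ 2 / 2) delta (s ^ 2 / 2 * mu) = phi) by reflexivity.
  assert (order : forall c, 0 <= c < cm ->
    0 < f c <= 1 / (2 * delta) /\ c + 1 / (2 * delta) <= g c < phi + c).
  { eapply boundaries_order with (s := s) (mu := mu) (phi := phi); eassumption. }
  split; [eapply cend_pos with (s := s) (mu := mu) (phi := phi); eassumption |].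
  split; [intros x c; eapply Q_nonneg with (s := s) (mu := mu) (phi := phi); eassumption |].
  split; [| split; [| split; [| split; [| split; [| split]]]]].
  - assert (cont : continuous_on (fun c => 0 <= c < cm) f /\ continuous_on (fun c => 0 <= c < cm) g).
    { eapply boundaries_cont with (s := s) (mu := mu) (phi := phi); eassumption. }
    destruct cont as [c1f c1g].
    assert (hx0 : 0 < 1 / (2 * delta)) by (apply Rdiv_lt_0_compat; lra).
    split; [| split; [exact c1f | split; [exact c1g | split; [| split]]]].
    + intros c hc. specialize (order c hc). lra.
    + eapply boundaries_C1 with (s := s) (mu := mu) (phi := phi); eassumption.
    + right. unfold f, g. now rewrite Fb_0, Gb_0.
    + eapply boundaries_lt with (s := s) (mu := mu) (phi := phi); eassumption.
  - split; [| split; [| split; [| split; [| split]]]].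
    + intros x c _. unfold q, Q. now rewrite Rabs_Ropp.
    + eapply Q_cont with (s := s) (mu := mu) (phi := phi); eassumption.
    + eapply Q_C1 with (s := s) (mu := mu) (phi := phi); eassumption.
    + intros x c hc hn. eexists.
      assert (d := not_exceptional s delta mu phi ephi y1h y2h x c hn).
      destruct d as [n1 [n2 n3]].
      eapply Qxx_derive with (s := s) (mu := mu) (phi := phi); eassumption.
    + eapply Qxx_cont with (s := s) (mu := mu) (phi := phi); eassumption.
    + eapply Qxx_loc_bounded with (s := s) (mu := mu) (phi := phi); eassumption.
  - eapply Qx_growth with (s := s) (mu := mu) (phi := phi); eassumption.
  - eapply Q_le with (s := s) (mu := mu) (phi := phi); eassumption.
  - eapply Q_gradient with (s := s) (mu := mu) (phi := phi); eassumption.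
  - eapply Q_subsolution with (s := s) (mu := mu) (phi := phi); eassumption.
  - eapply Q_complementarity with (s := s) (mu := mu) (phi := phi); eassumption.
Qed.
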